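(* Let $n$ be an even positive integer. There is no infinitely smooth convex body $K$ in $\mathbb{R}^n$ containing the origin in its interior for which there exists $N\in\mathbb{N}$ such that for every even integer $m\ge N$ and every $\xi\in S^{n-1}$ we have $$A_{K,\xi}^{(m)}(0)=0.$$
   Context: A convex body in $\mathbb{R}^n$ is a compact convex set with non-empty interior. For a convex body $K$ containing the origin in its interior, its Minkowski functional is $\|x\|_K=\min\{a\ge 0: x\in aK\}$, $x\in\mathbb{R}^n$; $K$ is called infinitely smooth if $\|\cdot\|_K$ is a $C^\infty$-function on $\mathbb{R}^n\setminus\{0\}$. $K$ is not assumed to be origin-symmetric. For $\xi\in S^{n-1}$, the parallel section function of $K$ in the direction $\xi$ is $A_{K,\xi}(t)=\mathrm{vol}_{n-1}(K\cap\{x\in\mathbb{R}^n:(x,\xi)=t\})$, $t\in\mathbb{R}$, where $(\cdot,\cdot)$ is the scalar product in $\mathbb{R}^n$. If $K$ is infinitely smooth and contains the origin in its interior, $A_{K,\xi}$ is infinitely differentiable in a neighborhood of $t=0$ (uniform in $\xi$), and $A_{K,\xi}^{(m)}(0)$ denotes its derivative of order $m$ at $t=0$. *)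

(* Defs.v *)
From HB Require Import structures.
From mathcomp Require Import all_boot all_order all_algebra.
From mathcomp Require Import all_classical all_reals all_analysis.

Set Implicit Arguments.
Unset Strict Implicit.
Unset Printing Implicit Defensive.
Import Order.TTheory GRing.Theory Num.Theory.
Import numFieldNormedType.Exports.
Local Open Scope classical_set_scope.
Local Open Scope ring_scope.

(* The library norm `|x| on 'rV[R]_n is the sup norm; it is only used through
   the topology it induces. The Euclidean structure is given by [dot]. *)
Definition dot (R : realType) (n : nat) (x y : 'rV[R]_n) : R :=
  \sum_(i < n) x ord0 i * y ord0 i.

Definition sphere (R : realType) (n : nat) : set 'rV[R]_n :=
  [set x | Num.sqrt (dot x x) = 1].

Definition convex_body (R : realType) (n : nat) (K : set 'rV[R]_n) : Prop :=
  [/\ compact K, convex_set K & K° !=set0].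

(* The infimum is a minimum when K is compact and contains the origin in its
   interior. *)
Definition minkowski (R : realType) (n : nat) (K : set 'rV[R]_n)
    (x : 'rV[R]_n) : R :=
  inf [set a | 0 <= a /\ exists2 y, K y & x = a *: y].

Definition partial (R : realType) (n : nat) (i : 'I_n) (f : 'rV[R]_n -> R)
    (x : 'rV[R]_n) : R :=
  'D_(delta_mx ord0 i) f x.

(* C^oo on the open set U: the partial derivatives of all orders exist and are
   continuous at every point of U. *)
Definition smooth_on (R : realType) (n : nat) (U : set 'rV[R]_n)
    (f : 'rV[R]_n -> R) : Prop :=
  forall (s : seq 'I_n) (x : 'rV[R]_n), U x ->
    {for x, continuous (foldr (@partial R n) f s)} /\
    forall i : 'I_n,
      derivable (foldr (@partial R n) f s) x (delta_mx ord0 i).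

Definition infinitely_smooth (R : realType) (n : nat) (K : set 'rV[R]_n) :
    Prop :=
  smooth_on [set x | x != 0] (minkowski K).

Definition tuple_cons (R : realType) (k : nat)
    (p : measurableTypeR R * k.-tuple (measurableTypeR R)) :
    k.+1.-tuple (measurableTypeR R) :=
  [tuple of p.1 :: p.2].

(* Lebesgue measure on R^k, as the k-fold product of [lebesgue_measure]. *)
Fixpoint lebesgue_tuple (R : realType) (k : nat) :
    set (k.-tuple (measurableTypeR R)) -> \bar R :=
  match k with
  | 0 => \d_([tuple])
  | k'.+1 =>
      pushforward (lebesgue_measure \x @lebesgue_tuple R k')%E
        (@tuple_cons R k')
  end.

Lemma measurable_tuple_cons (R : realType) (k : nat) :
  measurable_fun [set: measurableTypeR R * k.-tuple (measurableTypeR R)]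
    (@tuple_cons R k).
Proof. by apply: measurable_cons; [exact: measurable_fst|exact: measurable_snd]. Qed.

Lemma measurable_tuple_uncons (R : realType) (k : nat) :
  measurable_fun [set: k.+1.-tuple (measurableTypeR R)]
    (fun x => (thead x, [tuple of behead x])).
Proof.
apply: measurable_fun_pair; last exact: measurable_behead.
exact: (measurable_tnth ord0).
Qed.

Lemma sigma_finite_measure_pack (d : measure_display) (T : measurableType d)
    (R : realType) (mu : {measure set T -> \bar R}) :
  sigma_finite setT mu ->
  exists nu : {sigma_finite_measure set T -> \bar R},
    (nu : set T -> \bar R) = mu.
Proof.
move=> muS.
pose H1 := isSFinite.Build _ _ _ _ (sfinite_measure_sigma_finite muS).
pose H2 := isSigmaFinite.Build _ _ _ _ muS.
pose nu := HB.pack_for (SigmaFiniteMeasure.type T R) (Measure.sort mu) H1 H2.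
by exists nu.
Qed.

Lemma lebesgue_tuple_measure (R : realType) (k : nat) :
  exists mu : {sigma_finite_measure
      set (k.-tuple (measurableTypeR R)) -> \bar R},
    (mu : set _ -> \bar R) = @lebesgue_tuple R k.
Proof.
elim: k => [|k [mu muE]] /=; first by exists (\d_([tuple])).
rewrite -muE.
pose m : {measure set _ -> \bar R} :=
  lebesgue_integral_fubini_product_measure1__canonical__measure_function_Measure
    (@lebesgue_measure R) mu.
have mS : sigma_finite setT m.
  have /sigma_finiteP[F [TF ndF Foo]] := sigma_finiteT (@lebesgue_measure R).
  have /sigma_finiteP[G [TG ndG Goo]] := sigma_finiteT mu.
  exists (fun i => F i `*` G i).
    rewrite -setXTT TF TG predeqE => -[x y]; split.
      move=> [/= [i _ Fix] [j _ Gjy]]; exists (maxn i j) => //; split.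
        by move: x Fix; exact/subsetPset/ndF/leq_maxl.
      by move: y Gjy; exact/subsetPset/ndG/leq_maxr.
    by move=> [i _ []/= ? ?]; split; exists i.
  move=> i; have [? ?] := Foo i; have [? ?] := Goo i.
  split; first exact: measurableX.
  by rewrite /m/= product_measure1E// lte_mul_pinfty// ge0_fin_numE.
pose nu : {measure set _ -> \bar R} :=
  measure_function_pushforward__canonical__measure_function_Measure m
    (@measurable_tuple_cons R k).
have nuS : sigma_finite setT nu.
  have [F UF mF] := mS.
  exists (fun i => (fun x : k.+1.-tuple (measurableTypeR R) =>
                      (thead x, [tuple of behead x])) @^-1` F i).
    by rewrite -preimage_bigcup -UF preimage_setT.
  move=> i; have [mFi Fioo] := mF i; split.
    by rewrite -[X in measurable X]setTI; exact: measurable_tuple_uncons.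
  rewrite [X in (X < _)%E](_ : _ = m (F i))//.
  rewrite /nu /= /pushforward -comp_preimage; congr (m _).
  rewrite /preimage; apply/seteqP; split => -[a b] /=;
    by rewrite theadE (_ : [tuple of _] = b)//; apply/val_inj.
by have [nu' <-] := sigma_finite_measure_pack nuS; exists nu'.
Qed.

Lemma lebesgue_tuple_box (R : realType) (k : nat) (a b : 'I_k -> R) :
  (forall i, a i <= b i) ->
  lebesgue_tuple [set x : k.-tuple (measurableTypeR R) |
                   forall i, a i <= tnth x i <= b i] =
  (\prod_(i < k) (b i - a i))%:E.
Proof.
elim: k a b => [|k IH] a b ab /=.
  by rewrite big_ord0 /dirac/= indicE mem_set//=; case.
have [mu muE] := lebesgue_tuple_measure R k.
rewrite /pushforward -muE.
pose I i : set (measurableTypeR R) := [set` `[a i, b i]].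
have mI i : measurable (I i) by exact: measurable_itv.
pose B := [set x : k.-tuple (measurableTypeR R) |
  forall i, a (lift ord0 i) <= tnth x i <= b (lift ord0 i)].
rewrite (_ : _ @^-1` _ = I ord0 `*` B); last first.
  apply/seteqP; split => -[x y] /=.
    move=> xy; split; first by rewrite /I /= in_itv/=; have := xy ord0.
    by move=> i; have := xy (lift ord0 i); rewrite tnthS.
  rewrite /I /= in_itv/= => -[x0 yB] i.
  by have [j ->|->] := unliftP ord0 i; [rewrite tnthS; exact: yB|exact: x0].
have mB : measurable B.
  rewrite /B (_ : [set _ | _] = \bigcap_(i in [set: 'I_k])
    ((@tnth k _ ^~ i) @^-1` I (lift ord0 i))); last first.
    apply/seteqP; split=> x /= xP i.
      by move=> _; rewrite /I /= in_itv/=; exact: xP.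
    by have := xP i Logic.I; rewrite /I /= in_itv.
  apply: fin_bigcap_measurable => // i _.
  by rewrite -[X in measurable X]setTI; exact: measurable_tnth.
rewrite product_measure1E//= muE IH; last by move=> i; exact: ab.
rewrite lebesgue_measure_itv/= lte_fin big_ord_recl EFinM; congr (_ * _)%E.
have := ab ord0; rewrite le_eqVlt => /orP[/eqP ->|->]; last by rewrite EFinB.
by rewrite ltxx subrr.
Qed.

(* The rows of B form an orthonormal basis of the hyperplane orthogonal to
   xi. *)
Definition orthonormal_frame (R : realType) (n : nat) (xi : 'rV[R]_n) :
    set 'M[R]_(n.-1, n) :=
  [set B | (forall i j, dot (row i B) (row j B) = (i == j)%:R) /\
           (forall i, dot (row i B) xi = 0)].

Lemma dotE (R : realType) (n : nat) (x y : 'rV[R]_n) :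
  dot x y = (x *m y^T) ord0 ord0.
Proof. by rewrite mxE; apply: eq_bigr => i _; rewrite mxE. Qed.

Lemma orthonormal_frame_exists (R : realType) (n : nat) (xi : 'rV[R]_n) :
  sphere xi -> exists B, orthonormal_frame xi B.
Proof.
case: n xi => [|n] xi /=.
  by rewrite /sphere /= /dot big_ord0 sqrtr0 => /esym/eqP; rewrite oner_eq0.
move=> xi1; have {}xi1 : xi *m xi^T = 1%:M.
  have dp : 0 <= dot xi xi by apply: sumr_ge0 => i _; rewrite -expr2 sqr_ge0.
  apply/matrixP => i j; rewrite !ord1 -dotE mxE eqxx/=.
  by rewrite -(sqr_sqrtr dp) xi1 expr1n.
pose e : 'rV[R]_n.+1 := delta_mx ord0 ord0.
have ee : e *m e^T = 1%:M.
  rewrite trmx_delta mul_delta_mx; apply/matrixP => i j.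
  by rewrite !ord1 !mxE.
(* Householder reflection mapping e to xi *)
have [H HH eH] : exists2 H : 'M[R]_n.+1, H *m H^T = 1%:M & e *m H = xi.
  have [->|exi] := eqVneq xi e.
    by exists 1%:M; rewrite ?mulmx1 ?trmx1 ?mulmx1.
  have [v vE] : exists v, v = e - xi by exists (e - xi).
  pose d := dot v v.
  have vv : v *m v^T = d%:M.
    by apply/matrixP => i j; rewrite !ord1 -dotE mxE eqxx.
  have d0 : d != 0.
    apply: contra_neq exi => d0; apply/esym/eqP; rewrite -subr_eq0 -vE; apply/eqP.
    apply/rowP => i; rewrite [RHS]mxE; apply/eqP; rewrite -sqrf_eq0 expr2.
    apply/eqP; move: d0; rewrite /d /dot.
    have v2 j : true -> 0 <= v ord0 j * v ord0 j.
      by rewrite -expr2 sqr_ge0.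
    by move=> /(psumr_eq0P v2) ->.
  pose c := 2 / d.
  have ev : e *m v^T = (d / 2)%:M.
    have xe : xi *m e^T = e *m xi^T.
      by rewrite -[LHS]trmxK trmx_mul trmxK; apply/matrixP=> i j;
        rewrite !ord1 mxE.
    have : v *m v^T = (e *m v^T) *+ 2.
      rewrite vE linearB/= !mulmxBr !mulmxBl ee xi1 xe mulr2n.
      by rewrite opprB addrC.
    rewrite vv => dE; apply: (@scalerI _ _ (2 : R)); first by rewrite pnatr_eq0.
    by rewrite scaler_nat -dE scale_scalar_mx mulrC divfK ?pnatr_eq0.
  exists (1%:M - c *: (v^T *m v)).
    have -> : (1%:M - c *: (v^T *m v))^T = 1%:M - c *: (v^T *m v).
      by rewrite [LHS]raddfB/= tr_scalar_mx [in LHS]linearZ/= trmx_mul trmxK.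
    rewrite mulmxBl mul1mx mulmxBr mulmx1 -scalemxAl -scalemxAr.
    rewrite mulmxA -(mulmxA v^T) vv mul_mx_scalar -scalemxAl !scalerA.
    have -> : c * (c * d) = c + c by rewrite [c * d]divfK// mulr_natr mulr2n.
    by rewrite scalerDl opprB addrK subrK.
  rewrite mulmxBr mulmx1 -scalemxAr mulmxA ev mul_scalar_mx scalerA.
  have -> : c * (d / 2) = 1 by rewrite /c mulrA divfK// divff ?pnatr_eq0.
  by rewrite scale1r vE opprB addrC subrK.
have rowH i j : dot (row i H) (row j H) = (i == j)%:R.
  have := congr1 (fun A : 'M[R]_n.+1 => A i j) HH.
  by rewrite !mxE => <-; apply: eq_bigr => k _; rewrite !mxE.
have row0 : row ord0 H = xi by rewrite rowE.
have rowH' i : row i (row' ord0 H) = row (lift ord0 i) H.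
  by apply/rowP => j; rewrite !mxE.
exists (row' ord0 H); split => [i j|i].
  by rewrite !rowH' rowH (inj_eq lift_inj).
by rewrite -row0 rowH' rowH.
Qed.

Definition frame (R : realType) (n : nat) (xi : 'rV[R]_n) :
    'M[R]_(n.-1, n) :=
  xget 0 (orthonormal_frame xi).

Lemma frameP (R : realType) (n : nat) (xi : 'rV[R]_n) :
  sphere xi -> orthonormal_frame xi (frame xi).
Proof. by move=> /orthonormal_frame_exists[B]; exact: xgetI. Qed.

(* vol_(n-1) of a subset S of the affine hyperplane through p orthogonal to
   the unit vector xi: the Lebesgue measure of S in the Euclidean coordinates
   given by [frame xi]. By invariance of the Lebesgue measure under isometries
   it does not depend on the choice of the frame. *)
Definition hyperplane_volume (R : realType) (n : nat) (xi p : 'rV[R]_n)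
    (S : set 'rV[R]_n) : \bar R :=
  lebesgue_tuple [set y : n.-1.-tuple (measurableTypeR R) |
    S (p + (\row_j tnth y j) *m frame xi)].

Definition section_function (R : realType) (n : nat) (K : set 'rV[R]_n)
    (xi : 'rV[R]_n) (t : R) : R :=
  fine (hyperplane_volume xi (t *: xi) (K `&` [set x | dot x xi = t])).

(* Main.v *)
(* Put d = n - 1.
   The average of A_{K,xi}(t) over the sphere is, up to a constant, the integral
   over the sphere of (rho^2 - t^2)^(d/2), rho being the radial function of K,
   and since d is odd no Taylor coefficient of even order of this half-integer
   power vanishes.

   To stay away from the origin, K is replaced by E = B_R \ K with K inside the
   ball B_R; the sphere is replaced by the annulus W = B_2 \ B_1.  By Fubini,
   the pairs (x, v) in E x W with scalar product <= s can be measured in two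
   ways; take on both sides the forward difference of order m + 1 in s with a
   small step.
   For fixed v this is governed by the derivative of order m of
   A_{B_R} - A_{K,xi}, xi = v / |v|, that is, uniformly in xi, by the Taylor
   coefficient of A_{B_R}; for fixed x by that of A_{B_2} - A_{B_1}.  The latter
   has a factor 2^(d - m) - 1, hence for m > d the two sides have opposite
   signs, the first one strictly.

   The uniformity in xi comes from the polar formula for A_{K,xi}(t), whose
   integrand is smooth in t by implicit differentiation of
   ||t xi + u w||_K = 1. *)
Require Import Defs.
From mathcomp Require Import all_boot all_order all_algebra.
From mathcomp Require Import all_classical all_reals all_analysis.
From mathcomp Require Import measurable_realfun ring lra zify.
Import Order.TTheory GRing.Theory Num.Theory.
Import numFieldNormedType.Exports.
Local Open Scope classical_set_scope.
Local Open Scope ring_scope.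
Set Implicit Arguments.
Unset Strict Implicit.
Unset Printing Implicit Defensive.

(** * Real functions of one variable *)

(** Averaging over annuli and balls rather than spheres keeps every integral a Lebesgue integral,
    and forward differences pass through integrals by linearity alone. Their order is [m + 1]
    because the volume of [{x in E | x.v <= s}] is an antiderivative in [s] of the section function.
    The price is that directions are no longer unit vectors: normalising [v] turns the step [h] into
    [h / |v|], so [|v|] must be bounded away from 0 on both sides. This holds on [W] by construction
    and on [E] because [K] contains a ball about the origin.

    One step [h] has to serve all directions. Vanishing of the derivative of order [m] at 0 for each
    [xi] separately does not suffice for this; the derivative of order [m + 1] must be bounded
    uniformly in [xi]. In the implicit differentiation this comes down to a uniform lower bound on
    the derivative of the gauge in the direction [w], which Euler's identity for homogeneous
    functions supplies at small heights.

    The sign of the Taylor coefficient depends on [m], so both sides are multiplied by it. *)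

Section is_derive_fun.
Context {R : realType}.
Implicit Types (f g : R -> R) (x a b : R).

Lemma is_derive_funD f g x a b : is_derive x 1 f a -> is_derive x 1 g b ->
  is_derive x 1 (fun y => f y + g y) (a + b).
Proof. by move=> fa gb; exact: is_deriveD. Qed.

Lemma is_derive_funB f g x a b : is_derive x 1 f a -> is_derive x 1 g b ->
  is_derive x 1 (fun y => f y - g y) (a - b).
Proof. by move=> fa gb; exact: is_deriveB. Qed.

Lemma is_derive_funM f g x a b : is_derive x 1 f a -> is_derive x 1 g b ->
  is_derive x 1 (fun y => f y * g y) (a * g x + f x * b).
Proof.
move=> fa gb; apply: (is_derive_eq (is_deriveM fa gb)).
by rewrite addrC mulrC.
Qed.

Lemma is_derive_funZ (c : R) f x a : is_derive x 1 f a ->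
  is_derive x 1 (fun y => c * f y) (c * a).
Proof.
move=> fa; have := is_derive_funM (is_derive_cst c x 1) fa.
by rewrite mul0r add0r.
Qed.

Lemma is_derive_funX (n : nat) f x a : is_derive x 1 f a ->
  is_derive x 1 (fun y => f y ^+ n) (n%:R * f x ^+ n.-1 * a).
Proof.
move=> fa; elim: n => [|n IH].
  by rewrite mulr0n !mul0r; exact: is_derive_cst.
rewrite (_ : (fun y => _) = fun y => f y * f y ^+ n); last first.
  by apply/funext => y; rewrite exprS.
apply: (is_derive_eq (is_derive_funM fa IH)) => /=.
case: n {IH} => [|n]; first by rewrite expr0 mulr0n; ring.
by rewrite exprS -!natr1 /=; ring.
Qed.

Lemma is_derive_funV f x a : f x != 0 -> is_derive x 1 f a ->
  is_derive x 1 (fun y => (f y)^-1) (- (f x)^-1 ^+ 2 * a).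
Proof.
move=> fx0 fa; apply: (is_derive_eq (is_deriveV fx0 fa)).
by rewrite exprVn.
Qed.

Lemma is_derive_comp_fun f g x a b : is_derive x 1 f a ->
  is_derive (f x) 1 g b -> is_derive x 1 (fun y => g (f y)) (b * a).
Proof.
move=> fa gb; have df : derivable f x 1 by [].
have dg : derivable g (f x) 1 by [].
apply: DeriveDef; last first.
  by rewrite -derive1E derive1_comp// !derive1E !derive_val.
apply/derivable1_diffP; apply: (differentiable_comp (f := f) (g := g)).
  exact/derivable1_diffP.
exact/derivable1_diffP.
Qed.

Lemma is_derive_continuous f x a : is_derive x 1 f a -> {for x, continuous f}.
Proof.
move=> fa; apply: differentiable_continuous; apply/derivable1_diffP.
exact: ex_derive.
Qed.

Lemma is_derive_near f g x a : (\forall y \near x, f y = g y) ->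
  is_derive x 1 f a -> is_derive x 1 g a.
Proof. exact: near_eq_is_derive. Qed.

End is_derive_fun.

(** * Forward differences and chains of derivatives *)

Fixpoint fdiff (R : realType) (k : nat) (h : R) (f : R -> R) (x : R) : R :=
  if k is k'.+1 then fdiff k' h f (x + h) - fdiff k' h f x else f x.

(** The recursion of [fdiff] takes the outermost difference; here one difference is moved into the
    function, the form needed for the induction in [fdiff_lower_bound]. *)
Lemma fdiff_shiftB (R : realType) (k : nat) (h : R) (f : R -> R) (x : R) :
  fdiff k h (fun y => f (y + h) - f y) x = fdiff k h f (x + h) - fdiff k h f x.
Proof. by elim: k x => //= k IH x; rewrite !IH; ring. Qed.

Lemma fdiffZ (R : realType) (k : nat) (h a : R) (f : R -> R) (x : R) :
  fdiff k h (fun y => a * f y) x = a * fdiff k h f x.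
Proof. by elim: k x => //= k IH x; rewrite !IH; ring. Qed.

Lemma fdiff_rescale (R : realType) (k : nat) (h a : R) (f : R -> R) (x : R) :
  fdiff k h (fun y => f (y / a)) x = fdiff k (h / a) f (x / a).
Proof. by elim: k x => //= k IH x; rewrite !IH mulrDl. Qed.

Lemma is_derive_MVT (R : realType) (f df : R -> R) (a b : R) : a <= b ->
  (forall x, a <= x <= b -> is_derive x 1 f (df x)) ->
  exists2 c, a <= c <= b & f b - f a = df c * (b - a).
Proof.
move=> ab fdf; have [x|x|c cab fE] := @MVT_segment R f df a b ab.
- by rewrite in_itv/= => /andP[ax xb]; apply: fdf; rewrite !ltW.
- apply: continuous_in_subspaceT => y; rewrite inE /= in_itv/= => yab.
  exact: is_derive_continuous (fdf _ yab).
- by exists c => //; move: cab; rewrite in_itv.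
Qed.

(** The derivatives are supplied as functions instead of through [derive1n], so that explicit
    formulas can be plugged in. *)
Definition derivative_chain (R : realType) (a b : R) (k : nat)
    (g : nat -> R -> R) : Prop :=
  forall j x, (j < k)%N -> a < x < b -> is_derive x 1 (g j) (g j.+1 x).

(** Induction on [k] with the chain [g j (y + h) - g j y] on the shorter interval []a, b - h[]: the
    mean value theorem turns the bound [c] on the last derivative into the bound [c * h] on the new
    last function. *)
Lemma fdiff_lower_bound (R : realType) (k : nat) (a b h c x : R)
    (g : nat -> R -> R) : 0 <= h -> derivative_chain a b k g ->
  (forall y, a < y < b -> c <= g k y) -> a < x -> x + k%:R * h < b ->
  c * h ^+ k <= fdiff k h (g 0%N) x.
Proof.
move=> h0; elim: k g b c => [|k IH] g b c gch gc ax xb.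
  by rewrite expr0 mulr1 /= gc// ax -[x]addr0 -(mul0r h).
rewrite [leRHS]/= -fdiff_shiftB exprS mulrA.
apply: (IH (fun j y => g j (y + h) - g j y) (b - h)) => //.
- move=> j y jk /andP[ay yb]; apply: is_derive_funB; last first.
    by apply: gch; rewrite ?(ltn_trans jk)// ay (lt_le_trans yb)// gerBl.
  have d1 : is_derive y 1 (fun z => z + h) 1.
    by apply: (is_derive_eq (is_derive_funD (is_derive_id y 1) (is_derive_cst h
      y 1)));
      rewrite addr0.
  have d2 : is_derive (y + h) 1 (g j) (g j.+1 (y + h)).
    apply: gch; first by rewrite (ltn_trans jk).
    by rewrite (lt_le_trans ay) ?lerDl//= -ltrBrDr.
  by apply: (is_derive_eq (is_derive_comp_fun d1 d2)); rewrite mulr1.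
- move=> y /andP[ay yb].
  have [|z|z /andP[yz zy] ->] := @is_derive_MVT _ (g k) (g k.+1) y (y + h).
  + by rewrite lerDl.
  + move=> /andP[yz zy]; apply: gch => //.
    by rewrite (lt_le_trans ay)// (le_lt_trans zy)// -ltrBrDr.
  rewrite addrAC subrr add0r ler_wpM2r// gc// (lt_le_trans ay)//=.
  by rewrite (le_lt_trans zy)// -ltrBrDr.
- by rewrite ltrBrDr (le_lt_trans _ xb)// -natr1; lra.
Qed.

(* Derivatives of [t |-> (rho^2 - t^2)^(d/2)], from the differential equation
   [(rho^2 - t^2) f' = - d t f] differentiated [j] times; the pair holds the
   derivatives of orders [j] and [j - 1]. *)
Fixpoint cap_derivs (R : realType) (d : nat) (rho : R) (j : nat) :
    (R -> R) * (R -> R) :=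
  if j is i.+1 then
    let p := cap_derivs d rho i in
    ((fun t => ((2 * i%:R - d%:R) * (t * p.1 t) +
                i%:R * (i%:R - 1 - d%:R) * p.2 t) / (rho ^+ 2 - t ^+ 2)), p.1)
  else (fun t => Num.sqrt (rho ^+ 2 - t ^+ 2) ^+ d, fun=> 0).

Definition cap (R : realType) (d : nat) (rho : R) (j : nat) : R -> R :=
  (cap_derivs d rho j).1.

(** At [j = 0] the truncated predecessor [j.-1] is harmless, being multiplied by [j%:R]. *)
Lemma capS (R : realType) (d : nat) (rho t : R) (j : nat) :
  cap d rho j.+1 t = ((2 * j%:R - d%:R) * (t * cap d rho j t) +
    j%:R * (j%:R - 1 - d%:R) * cap d rho j.-1 t) / (rho ^+ 2 - t ^+ 2).
Proof. by case: j => [|j] //=; rewrite /cap /= !mul0r. Qed.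

Lemma sqr_lt_norm (R : realType) (t rho : R) : `|t| < rho -> t ^+ 2 < rho ^+ 2.
Proof.
move=> trho; rewrite -(real_normK (num_real t)).
by rewrite ltr_pXn2r ?nnegrE// ltW// (le_lt_trans _ trho).
Qed.

Lemma is_derive_cap (R : realType) (d : nat) (rho t : R) (j : nat) :
  `|t| < rho -> is_derive t 1 (cap d rho j) (cap d rho j.+1 t).
Proof.
move=> trho; have D0 : 0 < rho ^+ 2 - t ^+ 2 by rewrite subr_gt0 sqr_lt_norm.
have Dn0 : rho ^+ 2 - t ^+ 2 != 0 by rewrite gt_eqF.
have dD : is_derive t 1 (fun x => rho ^+ 2 - x ^+ 2) (- (2 * t)).
  apply: (is_derive_eq (is_derive_funB (is_derive_cst (rho ^+ 2) t 1)
    (is_derive_funX 2 (is_derive_id t 1)))).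
  by rewrite sub0r mulr1 expr1.
have base : is_derive t 1 (cap d rho 0) (cap d rho 1 t).
  have ds := is_derive_comp_fun dD (is_derive1_sqrt D0).
  apply: (is_derive_eq (is_derive_funX d ds)).
  rewrite capS /= mulr0 sub0r !mul0r addr0 /cap /=.
  case: d => [|d]; first by rewrite !mul0r oppr0 mul0r mul0r.
  set s := Num.sqrt _; have s0 : s != 0 by rewrite gt_eqF// sqrtr_gt0.
  have -> : rho ^+ 2 - t ^+ 2 = s ^+ 2 by rewrite sqr_sqrtr// ltW.
  by rewrite exprS /=; field.
(* Differentiating the recursion for [cap d rho i.+1] involves the derivatives of orders [i] and
   [i.-1], the latter with a factor [i]; hence the alternative [i = 0], and the induction on two
   consecutive orders below. *)
have step i : is_derive t 1 (cap d rho i) (cap d rho i.+1 t) ->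
    is_derive t 1 (cap d rho i.-1) (cap d rho i t) \/ i = 0%N ->
    is_derive t 1 (cap d rho i.+1) (cap d rho i.+2 t).
  move=> d1 d2.
  have dN : is_derive t 1 (fun x => (2 * i%:R - d%:R) * (x * cap d rho i x) +
      i%:R * (i%:R - 1 - d%:R) * cap d rho i.-1 x)
      ((2 * i%:R - d%:R) * (1 * cap d rho i t + t * cap d rho i.+1 t) +
        i%:R * (i%:R - 1 - d%:R) * cap d rho i t).
    apply: is_derive_funD.
      by apply: is_derive_funZ; apply: is_derive_funM.
    case: d2 => [d2|->]; first exact: is_derive_funZ.
    by under eq_fun do rewrite !mul0r; rewrite !mul0r; exact: is_derive_cst.
  have dV := is_derive_funM dN (is_derive_funV (f := fun x =>
    rho ^+ 2 - x ^+ 2) Dn0 dD).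
  rewrite (_ : cap d rho i.+1 = fun x =>
    ((2 * i%:R - d%:R) * (x * cap d rho i x) +
      i%:R * (i%:R - 1 - d%:R) * cap d rho i.-1 x) * (rho ^+ 2 - x ^+ 2)^-1).
    apply: (is_derive_eq dV).
    by rewrite (capS _ _ _ i.+1) (capS _ _ _ i) /= -natr1; field.
  by apply/funext => x; rewrite capS.
suff : is_derive t 1 (cap d rho j) (cap d rho j.+1 t) /\
    is_derive t 1 (cap d rho j.+1) (cap d rho j.+2 t) by case.
elim: j => [|j [IH1 IH2]]; first by split=> //; apply: step => //; right.
by split => //; apply: step => //; left.
Qed.

(** At [t = 0] the recursion with [j = 2l + 1] leads from order [2l] to order [2l + 2] and gains the
    factor [(2l + 1)(2l - d)]. The product is [(2i)!] times the coefficient of [t^(2i)] in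
    [(1 - t^2)^(d/2)]. *)
Definition cap_coef (R : realType) (d i : nat) : R :=
  \prod_(l < i) ((2 * l + 1)%:R * ((2 * l)%:R - d%:R)).

Lemma cap_even0 (R : realType) (d i : nat) (rho : R) : 0 < rho ->
  cap d rho (2 * i) 0 = cap_coef R d i * rho ^+ d / rho ^+ (2 * i).
Proof.
move=> rho0; elim: i => [|i IH].
  rewrite /cap_coef big_ord0 mul1r /cap /= expr0 divr1.
  by rewrite (expr0n _ 2) subr0 sqrtr_sqr gtr0_norm.
rewrite mulnS add2n capS mul0r mulr0 add0r /= IH /cap_coef big_ord_recr /=.
rewrite (expr0n _ 2) subr0 -natr1 !exprS addn1 -[(2 * i).+1]addn1 natrD natrM.
  field.
by rewrite expf_neq0 ?gt_eqF.
Qed.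

Lemma cap_coef_neq0 (R : realType) (d i : nat) : odd d -> cap_coef R d i != 0.
Proof.
move=> dodd; rewrite /cap_coef prodf_seq_neq0; apply/allP => l _ /=.
rewrite mulf_neq0 ?pnatr_eq0 ?addn1// subr_eq0 eqr_nat.
by apply: contraTneq dodd => <-; rewrite mul2n odd_double.
Qed.

(** Derivatives up to order [k], each bounded on []-dl, dl[] uniformly in the parameter. Asking for
    some derivative function at each level makes closure under sums, products and integrals an
    induction on [k]. *)
Fixpoint bounded_derivs (R : realType) (I : Type) (P : set I) (dl : R) (k : nat)
    (f : I -> R -> R) : Prop :=
  (exists M, forall i t, P i -> `|t| < dl -> `|f i t| <= M) /\
  if k is k'.+1 then
    exists2 f' : I -> R -> R, (forall i (t : R),
      P i -> `|t| < dl -> is_derive t 1 (f i) (f' i t)) &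
      bounded_derivs P dl k' f'
  else True.

Section bounded_derivs.
Context {R : realType} {I : Type}.
Implicit Types (P : set I) (f g : I -> R -> R) (dl : R).

Lemma bounded_derivs_bound P dl k f : bounded_derivs P dl k f ->
  exists M, forall i t, P i -> `|t| < dl -> `|f i t| <= M.
Proof. by case: k => [|k] []. Qed.

Lemma bounded_derivsW P dl k f :
  bounded_derivs P dl k.+1 f -> bounded_derivs P dl k f.
Proof.
elim: k f => [|k IH] f [bf [f' df bf']]; split => //.
by exists f' => //; exact: IH.
Qed.

Lemma near_lt_norm (t dl : R) : `|t| < dl -> \forall s \near t, `|s| < dl.
Proof.
move=> tdl; exists (dl - `|t|); first by rewrite /= subr_gt0.
move=> s /= ts; rewrite -(subrK t s) (le_lt_trans (ler_normD _ _))//.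
by rewrite -ltrBrDr distrC.
Qed.

Lemma bounded_derivs_ext P dl k f g :
  (forall i t, P i -> `|t| < dl -> f i t = g i t) ->
  bounded_derivs P dl k f -> bounded_derivs P dl k g.
Proof.
move=> fg bf; have [M bM] := bounded_derivs_bound bf.
have bg : exists M, forall i t, P i -> `|t| < dl -> `|g i t| <= M.
  by exists M => i t Pi tdl; rewrite -fg// bM.
case: k bf => [//|k] [_ [f' df bf']]; split => //; exists f' => // i t Pi tdl.
apply: is_derive_near (df i t Pi tdl).
by apply: filterS (near_lt_norm tdl) => s /(fg i s Pi).
Qed.

Lemma bounded_derivs_cst P dl k (c : I -> R) M :
  (forall i, P i -> `|c i| <= M) -> bounded_derivs P dl k (fun i _ => c i).
Proof.
elim: k c M => [|k IH] c M cM; split => //; try by exists M => i t Pi _;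
  exact: cM.
exists (fun _ _ => 0); first by move=> i t _ _; exact: is_derive_cst.
by apply: (IH _ 0) => i _; rewrite normr0.
Qed.

Lemma bounded_derivsD P dl k f g : bounded_derivs P dl k f ->
  bounded_derivs P dl k g -> bounded_derivs P dl k (fun i t => f i t + g i t).
Proof.
elim: k f g => [|k IH] f g [[M bf] Hf] [[N bg] Hg]; split.
- exists (M + N) => i t Pi tdl.
  by rewrite (le_trans (ler_normD _ _))// lerD ?bf ?bg.
- by [].
- exists (M + N) => i t Pi tdl.
  by rewrite (le_trans (ler_normD _ _))// lerD ?bf ?bg.
case: Hf => f' df bf'; case: Hg => g' dg bg'.
exists (fun i t => f' i t + g' i t); last exact: IH.
by move=> i t Pi tdl; apply: is_derive_funD; [exact: df|exact: dg].
Qed.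

Lemma bounded_derivsM P dl k f g : bounded_derivs P dl k f ->
  bounded_derivs P dl k g -> bounded_derivs P dl k (fun i t => f i t * g i t).
Proof.
elim: k f g => [|k IH] f g bdf bdg;
  have [M bf] := bounded_derivs_bound bdf;
  have [N bg] := bounded_derivs_bound bdg;
  have bfg : exists M, forall i t, P i -> `|t| < dl -> `|f i t * g i t| <= M.
- by exists (M * N) => i t Pi tdl; rewrite normrM ler_pM ?bf ?bg.
- by split.
- by exists (M * N) => i t Pi tdl; rewrite normrM ler_pM ?bf ?bg.
split => //; have [_ [f' df bf']] := bdf; have [_ [g' dg bg']] := bdg.
exists (fun i t => f' i t * g i t + f i t * g' i t).
  by move=> i t Pi tdl; apply: is_derive_funM; [exact: df|exact: dg].
by apply: bounded_derivsD; apply: IH => //; exact: bounded_derivsW.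
Qed.

Lemma bounded_derivsN P dl k f : bounded_derivs P dl k f ->
  bounded_derivs P dl k (fun i t => - f i t).
Proof.
move=> bf; apply: (bounded_derivs_ext (f := fun i t => (-1) * f i t)).
  by move=> i t _ _; rewrite mulN1r.
apply: bounded_derivsM bf; apply: (@bounded_derivs_cst _ _ _ (fun=> -1) 1) =>
  i _.
by rewrite normrN1.
Qed.

Lemma bounded_derivsX P dl k f n : bounded_derivs P dl k f ->
  bounded_derivs P dl k (fun i t => f i t ^+ n).
Proof.
move=> bf; elim: n => [|n IH].
  apply: (@bounded_derivs_cst _ _ _ (fun=> 1) 1) => i _.
  by rewrite normr1.
apply: (bounded_derivs_ext (f := fun i t => f i t * f i t ^+ n)).
  by move=> i t _ _; rewrite exprS.
exact: bounded_derivsM.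
Qed.

Lemma bounded_derivs_sum (m : nat) P dl k (f : 'I_m -> I -> R -> R) :
  (forall l, bounded_derivs P dl k (f l)) ->
  bounded_derivs P dl k (fun i t => \sum_(l < m) f l i t).
Proof.
elim: m f => [|m IH] f bf.
  apply: (bounded_derivs_ext (f := fun _ _ => 0)).
    by move=> i t _ _; rewrite big_ord0.
  by apply: (@bounded_derivs_cst _ _ _ (fun=> 0) 0) => i _; rewrite normr0.
apply: (bounded_derivs_ext
    (f := fun i t => f ord0 i t + \sum_(l < m) f (lift ord0 l) i t)).
  by move=> i t _ _; rewrite big_ord_recl.
by apply: bounded_derivsD => //; apply: IH => l.
Qed.

Lemma bounded_derivs_reindex (J : Type) (Q : set J) (phi : J -> I) P dl k f :
  (forall j, Q j -> P (phi j)) -> bounded_derivs P dl k f ->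
  bounded_derivs Q dl k (fun j => f (phi j)).
Proof.
move=> QP; elim: k f => [|k IH] f [[M bf] Hf]; split => //.
- by exists M => j t /QP; exact: bf.
- by exists M => j t /QP; exact: bf.
- case: Hf => f' df bf'; exists (fun j => f' (phi j)); last exact: IH.
  by move=> j t /QP; exact: df.
Qed.

(** Collects the nested witnesses into one sequence, as required by [fdiff_lower_bound] and
    [derive1n_chain]. *)
Lemma bounded_derivs_chain P dl k f : bounded_derivs P dl k f ->
  exists g : nat -> I -> R -> R, [/\ g 0%N = f,
    forall j i (t : R), (j < k)%N -> P i -> `|t| < dl ->
      is_derive t 1 (g j i) (g j.+1 i t) &
    exists M, forall i t, P i -> `|t| < dl -> `|g k i t| <= M].
Proof.
elim: k f => [|k IH] f [bf Hf]; first by exists (fun=> f).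
case: Hf => f' df /IH[g [g0 dg bg]].
exists (fun j => if j is j'.+1 then g j' else f); split => // -[|j] i t.
  by move=> _ Pi tdl; rewrite g0; exact: df.
exact: dg.
Qed.

End bounded_derivs.

Lemma measurable_fun_is_derive (R : realType) d (T : measurableType d) (B : set
  T)
    (f : T -> R -> R) (f' : T -> R) (t dl : R) : measurable B -> `|t| < dl ->
  (forall s, `|s| < dl -> measurable_fun B (f ^~ s)) ->
  (forall y, B y -> is_derive t 1 (f y) (f' y)) -> measurable_fun B f'.
Proof.
move=> mB tdl mf df.
(* With [n.+2] the step is smaller than [dl - |t|] already at [n = 0], so the difference quotients
   stay inside []-dl, dl[]. *)
pose h n : R := (dl - `|t|) / n.+2%:R.
have hgt0 n : 0 < h n by rewrite divr_gt0// subr_gt0.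
have hlt n : `|t + h n| < dl.
  rewrite (le_lt_trans (ler_normD _ _))// (gtr0_norm (hgt0 n)) -ltrBrDl.
  by rewrite ltr_pdivrMr// ltr_pMr ?subr_gt0// ltr1n.
have h_cvg : h n @[n --> \oo] --> (0 : R).
  rewrite -[X in _ --> X](mulr0 (dl - `|t|)); apply: cvgM; first exact: cvg_cst.
  have := @cvg_shiftS _ (fun n => n.+1%:R^-1 : R) (nbhs 0).
  by move=> /= ->; exact: cvg_harmonic.
apply: (@measurable_fun_cvg _ _ _ B (fun n y =>
  (h n)^-1 * (f y (h n + t) - f y t))) => //.
  move=> n; apply: measurable_funM; first exact: measurable_cst.
  by apply: measurable_funB; apply: mf => //; rewrite addrC.
move=> y By; have dfy := df y By.
have /cvg_ex[l fl] : derivable (f y) t 1 by exact: ex_derive.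
have fl' : l = f' y.
  by rewrite -(@derive_val _ _ _ _ _ _ _ dfy) /derive; apply/esym/cvg_lim.
have /cvgr_dnbhsP/(_ h) := fl.
have hh : (forall n, h n != 0) /\ h n @[n --> \oo] --> 0.
  by split => // n; rewrite gt_eqF.
move=> /(_ hh); rewrite fl'; apply: cvg_trans; apply: near_eq_cvg.
by near=> n; rewrite /= scaler1.
Unshelve. all: by end_near. Qed.

(** Iterated differentiation under the integral sign: since [mu B] is finite, the uniform bound on
    the next derivative is an integrable majorant, and that derivative is measurable in [y] as a
    limit of difference quotients. *)
Lemma bounded_derivs_integral (R : realType) (J : Type) (A : set J)
    d (T : measurableType d) (mu : {measure set T -> \bar R}) (B : set T)
    (dl : R) (k : nat) (f : J * T -> R -> R) :
  measurable B -> (mu B < +oo)%E ->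
  (forall j t, A j -> `|t| < dl -> measurable_fun B (fun y => f (j, y) t)) ->
  bounded_derivs [set p | A p.1 /\ B p.2] dl k f ->
  bounded_derivs A dl k (fun j t => \int[mu]_(y in B) f (j, y) t).
Proof.
move=> mB muB.
have main (g : J * T -> R -> R) M j t :
    (forall i t, A i.1 /\ B i.2 -> `|t| < dl -> `|g i t| <= M) ->
    A j -> measurable_fun B (fun y => g (j, y) t) -> `|t| < dl ->
    mu.-integrable B (EFin \o (fun y => g (j, y) t)).
  move=> gM Aj mg tdl; apply: measurable_bounded_integrable => //.
  exists M; split; first exact: num_real.
  by move=> x Mx y By; rewrite /= (le_trans (gM (j, y) t _ _))// ltW.
have bound (g : J * T -> R -> R) M :
    (forall j t, A j -> `|t| < dl -> measurable_fun B (fun y => g (j, y) t)) ->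
    (forall i t, A i.1 /\ B i.2 -> `|t| < dl -> `|g i t| <= M) ->
    exists M', forall j t, A j -> `|t| < dl ->
      `|\int[mu]_(y in B) g (j, y) t| <= M'.
  move=> mg gM; exists (M * fine (mu B)) => j t Aj tdl.
  have ig := main g M j t gM Aj (mg j t Aj tdl) tdl.
  apply: le_trans (le_normr_Rintegral mB ig) _.
  rewrite -Rintegral_cst//; apply: le_Rintegral => //.
  - exact: integrable_norm.
  - apply: measurable_bounded_integrable => //.
    by apply: bounded_cst.
  - by move=> y By; exact: gM.
elim: k f => [|k IH] f mf [[M bf] Hf]; split => //.
- exact: bound bf.
- exact: bound bf.
case: Hf => f' df bf'.
have mf' j t : A j -> `|t| < dl -> measurable_fun B (fun y => f' (j, y) t).
  move=> Aj tdl.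
  apply: (@measurable_fun_is_derive _ _ _ B (fun y => f (j, y)) _ t dl) => //.
    by move=> s sdl; exact: mf.
  by move=> y By; exact: df.
exists (fun j t => \int[mu]_(y in B) f' (j, y) t); last exact: IH.
move=> j t Aj tdl.
have [M' bM'] := bounded_derivs_bound bf'.
(* [M'] may be negative when [B] is empty, while the majorant has to be nonnegative. *)
have M'0 : 0 <= Num.max M' 0 by rewrite le_max lexx orbT.
have Idl s : `]- dl, dl[%classic s <-> `|s| < dl.
  by rewrite /= in_itv/= ltr_norml.
have d1E s y : `|s| < dl -> B y ->
    partial1of2 (fun x y => f (j, y) x) s y = f' (j, y) s.
  move=> sdl By; rewrite partial1of2E.
  by have dfs := df (j, y) s (conj Aj By) sdl; exact: derive_val.
have Ht : `]- dl, dl[%classic t by apply/Idl.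
have Hint s : `]- dl, dl[%classic s ->
    mu.-integrable B (EFin \o (fun y => f (j, y) s)).
  by move=> /Idl sdl; apply: (main f M) => //; exact: mf.
have Hder s y : `]- dl, dl[%classic s -> B y -> derivable (fun x => f (j,
  y) x) s 1.
  by move=> /Idl sdl By; have dfs := df (j, y) s (conj Aj By) sdl;
    exact: ex_derive.
have Gint : mu.-integrable B (EFin \o cst (Num.max M' 0)).
  by apply: measurable_bounded_integrable => //; exact: bounded_cst.
have Gub s y : `]- dl, dl[%classic s -> B y ->
    `|partial1of2 (fun x y => f (j, y) x) s y| <= cst (Num.max M' 0) y.
  by move=> /Idl sdl By; rewrite d1E// /= le_max bM'.
have H1 := @derivable_under_integral _ _ _ mu (fun x y => f (j,
  y) x) B mB t (- dl) dl
  Ht Hint Hder _ (fun=> M'0) Gint Gub.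
have H2 := @differentiation_under_integral _ _ _ mu (fun x y => f (j,
  y) x) B mB t (- dl) dl
  Ht Hint Hder _ (fun=> M'0) Gint Gub.
apply: DeriveDef => //; rewrite -derive1E H2.
by apply: eq_Rintegral => y /set_mem By; exact: d1E.
Qed.

(** * Functions of several variables *)

(** A directional derivative written in one real variable, so that the one-variable rules and the
    mean value theorem apply. *)
Definition line_derive (R : realType) (n : nat) (g : 'rV[R]_n -> R)
    (x v : 'rV[R]_n) (a : R) : Prop :=
  is_derive (0 : R) 1 (fun h : R => g (x + h *: v)) a.

(** The differential of [g] at [x] applied to [v], as [line_derive_grad] shows when the partial
    derivatives are continuous. *)
Definition grad (R : realType) (n : nat) (g : 'rV[R]_n -> R)
    (x v : 'rV[R]_n) : R := \sum_(i < n) v ord0 i * partial i g x.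

Section line_derive.
Context {R : realType} {n : nat}.
Implicit Types (g : 'rV[R]_n -> R) (x v w : 'rV[R]_n) (U : set 'rV[R]_n).

Lemma derivable_line_derive g x v : derivable g x v ->
  line_derive g x v ('D_v g x).
Proof.
move=> dg; rewrite /line_derive.
have F : (fun h : R => h^-1 *: (g (x + (h *: (1 : R) + 0) *: v) - g (x + 0 *:
  v))) =
    (fun h : R => h^-1 *: (g (h *: v + x) - g x)).
  by apply/funext => h; rewrite addr0 scaler1 scale0r addr0 (addrC x).
by apply: DeriveDef; [move: dg; rewrite /derivable -F|rewrite /derive -F].
Qed.

Lemma line_derive_at g x v a (t : R) : line_derive g (x + t *: v) v a ->
  is_derive t 1 (fun h : R => g (x + h *: v)) a.
Proof.
rewrite /line_derive => dg.
have d1 : is_derive t 1 (fun h : R => h - t) (1 - 0).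
  by apply: is_derive_funB; exact: is_derive_cst.
rewrite -(subrr t) in dg.
have := is_derive_comp_fun d1 dg; rewrite subr0 mulr1.
rewrite (_ : (fun y => _) = fun h => g (x + h *: v))//.
by apply/funext => h; rewrite -addrA -scalerDl subrKC.
Qed.

Lemma line_deriveZ g x v a (c : R) : line_derive g x v a ->
  line_derive g x (c *: v) (a * c).
Proof.
rewrite /line_derive => dg.
have d1 : is_derive (0 : R) 1 (fun h : R => h * c) (1 * c + 0 * 0).
  by apply: is_derive_funM; exact: is_derive_cst.
rewrite mul0r addr0 mul1r in d1.
rewrite -(mul0r c) in dg.
have := is_derive_comp_fun d1 dg.
rewrite (_ : (fun y => _) = fun h => g (x + h *: (c *: v)))//.
by apply/funext => h; rewrite scalerA.
Qed.

Lemma line_derive_MVT g U x v (b : 'rV[R]_n -> R) :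
  (forall z, U z -> line_derive g z v (b z)) ->
  (forall s : R, 0 <= s <= 1 -> U (x + s *: v)) ->
  exists2 s : R, 0 <= s <= 1 & g (x + v) - g x = b (x + s *: v).
Proof.
move=> db xU.
have [s s01|s s01] := @is_derive_MVT R (fun h => g (x + h *: v))
  (fun h => b (x + h *: v)) 0 1 ler01.
  by apply: line_derive_at; apply: db; exact: xU.
by rewrite scale1r scale0r addr0 subr0 mulr1 => E; exists s.
Qed.

Lemma near_segment U x v w : open U -> U x ->
  \forall h \near (0 : R), forall s : R, 0 <= s <= 1 ->
    U (x + h *: v + s *: (h *: w)).
Proof.
move=> oU Ux; have /nbhs_ballP[e /= e0 eU] : nbhs x U by exact: open_nbhs_nbhs.
have C0 : 0 < `|v| + `|w| + 1 by rewrite ltr_wpDl// addr_ge0.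
exists (e / (`|v| + `|w| + 1)); first by rewrite /= divr_gt0.
move=> h /=; rewrite sub0r normrN ltr_pdivlMr// => he s /andP[s0 s1].
apply: eU; rewrite -ball_normE /ball_ /= -addrA opprD addrA subrr sub0r normrN.
apply: le_lt_trans (ler_normD _ _) _; rewrite !normrZ (ger0_norm s0).
apply: le_lt_trans he; rewrite !mulrDr mulr1.
rewrite -addrA lerD// ler_wpDr//.
by rewrite ler_piMl// mulr_ge0.
Qed.

Lemma cvg_segment x v w (s : R -> R) :
  (\forall h \near (0 : R)^', 0 <= s h <= 1) ->
  x + h *: v + s h *: (h *: w) @[h --> (0 : R)^'] --> x.
Proof.
move=> s01.
suff : x + h *: v + s h *: (h *: w) @[h --> (0 : R)^'] --> x + 0 + 0.
  by rewrite !addr0.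
have h0 : (h : R) @[h --> 0^'] --> (0 : R).
  by apply: cvg_within; exact: cvg_id.
apply: cvgD; first apply: cvgD; first exact: cvg_cst.
  by rewrite -(scale0r v); apply: cvgZr_tmp.
rewrite (_ : (fun h => _) = fun h => (s h * h) *: w); last first.
  by apply/funext => h; rewrite scalerA.
rewrite -(scale0r w); apply: cvgZr_tmp.
apply: norm_cvg0.
have n0 : `|h : R| @[h --> 0^'] --> (0 : R) by rewrite -[X in _ --> X](@normr0 R
  R); exact: cvg_norm.
apply: (squeeze_cvgr (f := fun=> 0) (h := fun h : R => `|h|));
  [|exact: cvg_cst|exact: n0].
near=> h; rewrite normr_ge0/= normrM ler_piMl// ger0_norm.
  by have /andP[] : 0 <= s h <= 1 by near: h.
by have /andP[] : 0 <= s h <= 1 by near: h.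
Unshelve. all: by end_near. Qed.

(** The increment is split at [x + h *: v]. The part along [v] starts at the fixed point [x]; the
    part along [w] starts at a moving point and is controlled by the mean value theorem and the
    continuity of [b]. *)
Lemma line_deriveD g U v w (a b : 'rV[R]_n -> R) x : open U ->
  (forall z, U z -> line_derive g z v (a z)) ->
  (forall z, U z -> line_derive g z w (b z)) ->
  (forall z, U z -> {for z, continuous b}) -> U x ->
  line_derive g x (v + w) (a x + b x).
Proof.
move=> oU da db cb Ux.
have seg := near_segment v w oU Ux.
(* Choice makes the mean value point a function of [h], with default 0 for those [h] whose segment
   leaves [U]. *)
have [s sP] : exists s : R -> R, forall h,
    (forall s : R, 0 <= s <= 1 -> U (x + h *: v + s *: (h *: w))) ->
    0 <= s h <= 1 /\ g (x + h *: v + h *: w) - g (x + h *: v) =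
      b (x + h *: v + s h *: (h *: w)) * h.
  have H (h : R) : exists s : R,
    (forall s : R, 0 <= s <= 1 -> U (x + h *: v + s *: (h *: w))) ->
    0 <= s <= 1 /\ g (x + h *: v + h *: w) - g (x + h *: v) =
      b (x + h *: v + s *: (h *: w)) * h.
    have [P|nP] := pselect (forall s : R, 0 <= s <= 1 ->
      U (x + h *: v + s *: (h *: w))); last by exists 0 => /nP.
    have [z Uz|s s01 E] := @line_derive_MVT g U (x + h *: v) (h *: w) (fun z =>
      b z * h) _ P.
      by apply: line_deriveZ; exact: db.
    by exists s.
  by have [s sP] := choice H; exists s.
have nseg : \forall h \near (0 : R)^', 0 <= s h <= 1.
  by apply: cvg_within; apply: filterS seg => h /sP[].
have cz := @cvg_segment x v w s nseg.
have cb' : b (x + h *: v + s h *: (h *: w)) @[h --> (0 : R)^'] --> b x.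
  exact: (cvg_comp _ _ cz (cb x Ux)).
have := da x Ux; rewrite /line_derive => dax.
have ca : h^-1 *: (g (x + h *: v) - g x) @[h --> (0 : R)^'] --> a x.
  have /cvg_ex[l fl] : derivable (fun h : R =>
    g (x + h *: v)) 0 1 by exact: ex_derive.
  have <- : l = a x.
    by rewrite -(@derive_val _ _ _ _ _ _ _ dax) /derive; apply/esym/cvg_lim.
  move: fl; apply: cvg_trans; apply: near_eq_cvg; near=> h.
  by rewrite /= addr0 scaler1 scale0r addr0.
have cab : h^-1 *: (g (x + h *: (v + w)) - g x) @[h --> (0 : R)^'] --> a x + b
  x.
  apply: cvg_trans (cvgD ca cb'); apply: near_eq_cvg.
  near=> h; have hn0 : h != 0 by near: h; exact: nbhs_dnbhs_neq.
  have Ph : forall s : R, 0 <= s <= 1 -> U (x + h *: v + s *: (h *: w)).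
    by near: h; apply: cvg_within.
  have [_ E] := sP h Ph.
  transitivity (h^-1 * (g (x + h *: v) - g x) + b (x + h *: v + s h *: (h *:
    w))) => //.
  have -> : b (x + h *: v + s h *: (h *: w)) =
      h^-1 * (g (x + h *: v + h *: w) - g (x + h *: v)).
    by rewrite E mulrC mulfK.
  rewrite -mulrDr -[RHS]/(h^-1 * _) scalerDr; congr (_ * _).
  by rewrite [x + (_ + _)]addrA; ring.
have E h : h^-1 *: (g (x + (h *: (1 : R) + 0) *: (v + w)) - g (x + 0 *: (v +
  w))) =
    h^-1 *: (g (x + h *: (v + w)) - g x).
  by rewrite addr0 scaler1 scale0r addr0.
apply: DeriveDef.
  by apply/cvg_ex; exists (a x + b x) => /=; under eq_fun do rewrite E.
by rewrite /derive; under eq_fun do rewrite E; exact: cvg_lim.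
Unshelve. all: by end_near. Qed.

End line_derive.

Lemma cvg_sum_seq (R : realType) (T I : Type) (F : set_system T) {FF : Filter F}
    (s : seq I) (f : I -> T -> R) (a : I -> R) :
  (forall i, f i x @[x --> F] --> a i) ->
  \sum_(i <- s) f i x @[x --> F] --> \sum_(i <- s) a i.
Proof.
move=> fa; elim: s => [|i s IH].
  by rewrite big_nil; under eq_fun do rewrite big_nil; exact: cvg_cst.
by rewrite big_cons; under eq_fun do rewrite big_cons; exact: cvgD.
Qed.

Section grad.
Context {R : realType} {n : nat}.
Variables (U : set 'rV[R]_n) (g : 'rV[R]_n -> R).
Hypothesis oU : open U.
Hypothesis dg : forall x i, U x -> derivable g x (delta_mx ord0 i).
Hypothesis cg : forall x i, U x -> {for x, continuous (partial i g)}.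

Lemma grad_continuous v x : U x -> {for x, continuous (fun z => grad g z v)}.
Proof.
move=> Ux; apply: (@cvg_sum_seq _ _ _ (nbhs x)) => i; apply: cvgM;
  first exact: cvg_cst.
exact: cg.
Qed.

Lemma line_derive_grad v x : U x -> line_derive g x v (grad g x v).
Proof.
(* The coordinates of [v] are added one at a time, each by an application of [line_deriveD]. *)
pose vm m : 'rV[R]_n := \sum_(i < n | (i < m)%N) v ord0 i *: delta_mx ord0 i.
pose gm m z : R := \sum_(i < n | (i < m)%N) v ord0 i * partial i g z.
suff H m : forall z, U z -> line_derive g z (vm m) (gm m z).
  move=> Ux; have := H n x Ux.
  rewrite /vm /gm /grad [in X in line_derive _ _ X _](eq_bigl xpredT);
    last first.
    by move=> i; rewrite ltn_ord.
  rewrite -row_sum_delta [in X in line_derive _ _ _ X](eq_bigl xpredT)// => i.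
  by rewrite ltn_ord.
elim: m => [|m IH] z Uz.
  rewrite /vm /gm !big_pred0//; rewrite /line_derive.
  by under eq_fun do rewrite scaler0 addr0; exact: is_derive_cst.
have [mn|nm] := ltnP m n; last first.
  have E (i : 'I_n) : (i < m.+1)%N = (i < m)%N.
    by rewrite ltnS [RHS](leq_trans (ltn_ord i))// ltnW//
      (leq_trans (ltn_ord i)).
  rewrite /vm /gm (eq_bigl _ _ E) [X in line_derive _ _ _ X](eq_bigl _ _ E).
  exact: IH.
pose i0 := Ordinal mn.
have E (i : 'I_n) : ((i < m.+1)%N && (i != i0)) = (i < m)%N.
  by rewrite ltnS ltn_neqAle andbC.
rewrite /vm /gm (bigD1 i0)//= [X in line_derive _ _ _ X](bigD1 i0)//=.
rewrite (eq_bigl _ _ E) [X in line_derive _ _ _ (_ + X)](eq_bigl _ _ E).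
rewrite addrC [X in line_derive _ _ _ X]addrC.
apply: (@line_deriveD _ _ _ U (vm m) _ (gm m) (fun z =>
  v ord0 i0 * partial i0 g z)) => //.
- move=> y Uy; rewrite mulrC; apply: line_deriveZ.
  by apply: derivable_line_derive; exact: dg.
- by move=> y Uy; apply: (cvgM (F := nbhs y)); [exact: cvg_cst|exact: cg].
Qed.

End grad.

Lemma gradD (R : realType) (n : nat) (g : 'rV[R]_n -> R) x v w :
  grad g x (v + w) = grad g x v + grad g x w.
Proof. by rewrite /grad -big_split; apply: eq_bigr => i _; rewrite mxE mulrDl.
  Qed.

Lemma gradZ (R : realType) (n : nat) (g : 'rV[R]_n -> R) x (c : R) v :
  grad g x (c *: v) = c * grad g x v.
Proof. by rewrite /grad mulr_sumr; apply: eq_bigr => i _; rewrite mxE mulrA.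
  Qed.

Lemma is_derive_quotient (R : realType) (f : R -> R) (t a : R) :
  is_derive t 1 f a <-> h^-1 * (f (t + h) - f t) @[h --> (0 : R)^'] --> a.
Proof.
have E : (fun h : R => h^-1 *: (f (h *: (1 : R) + t) - f t)) =
    (fun h : R => h^-1 * (f (t + h) - f t)).
  by apply/funext => h; rewrite scaler1 (addrC t).
split=> [fa|fa].
  have /cvg_ex[l] : derivable f t 1 by exact: ex_derive.
  rewrite E => fl; suff <- : l = a by [].
  by rewrite -(@derive_val _ _ _ _ _ _ _ fa) /derive E; apply/esym/cvg_lim.
apply: DeriveDef; first by apply/cvg_ex; exists a; rewrite E.
by rewrite /derive E; exact: cvg_lim.
Qed.

(** * Chain rule and implicit differentiation along a curve *)

Section curve.
Context {R : realType} {n : nat}.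
Variables (U : set 'rV[R]_n) (g : 'rV[R]_n -> R).
Hypothesis oU : open U.
Hypothesis dg : forall x i, U x -> derivable g x (delta_mx ord0 i).
Hypothesis cg : forall x i, U x -> {for x, continuous (partial i g)}.
Variables (xi w : 'rV[R]_n) (u : R -> R) (t : R).
Let x s := s *: xi + u s *: w.
Hypothesis cu : {for t, continuous u}.
Hypothesis Ut : U (x t).

(** The mean value theorem on the segment from [x t] to [x (t + h)]. It relies on [u] being
    continuous at [t] only, so the same expansion serves the chain rule, where [u'] is given, and
    implicit differentiation, where it is to be found. *)
Lemma curve_increment : exists alpha beta : R -> R,
  [/\ alpha h @[h --> (0 : R)^'] --> grad g (x t) xi,
      beta h @[h --> (0 : R)^'] --> grad g (x t) w &
      \forall h \near (0 : R)^', g (x (t + h)) - g (x t) =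
        h * alpha h + (u (t + h) - u t) * beta h].
Proof.
pose D h := h *: xi + (u (t + h) - u t) *: w.
have xD h : x (t + h) = x t + D h.
  by rewrite /x /D scalerDl scalerBl [RHS]addrACA subrKC.
have h0 : (h : R) @[h --> 0^'] --> (0 : R).
  by apply: cvg_within; exact: cvg_id.
have th : t + h @[h --> (0 : R)^'] --> t.
  by rewrite -[X in _ --> X]addr0; apply: cvgD => //; exact: cvg_cst.
have du : u (t + h) - u t @[h --> (0 : R)^'] --> (0 : R).
  suff : u (t + h) - u t @[h --> (0 : R)^'] --> u t - u t by rewrite subrr.
  by apply: cvgB; [exact: (cvg_comp _ _ th cu)|exact: cvg_cst].
have D0 : D h @[h --> (0 : R)^'] --> (0 : 'rV[R]_n).
  suff : D h @[h --> (0 : R)^'] --> 0 *: xi + 0 *: w by rewrite !scale0r addr0.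
  by apply: cvgD; exact: cvgZr_tmp.
have /nbhs_ballP[e /= e0 eU] : nbhs (x t) U by exact: open_nbhs_nbhs.
have nD : \forall h \near (0 : R)^', forall s : R,
  0 <= s <= 1 -> U (x t + s *: D h).
  have : \forall h \near (0 : R)^', `|D h| < e.
    by move/cvgr0_norm_lt: D0; exact.
  apply: filterS => h Dh s /andP[s0 s1]; apply: eU.
  rewrite -ball_normE /ball_ /= opprD addrA subrr sub0r normrN normrZ
    ger0_norm//.
  by rewrite (le_lt_trans _ Dh)// ler_piMl.
have H (h : R) : exists s : R, (forall s : R,
  0 <= s <= 1 -> U (x t + s *: D h)) ->
    0 <= s <= 1 /\ g (x t + D h) - g (x t) = grad g (x t + s *: D h) (D h).
  have [P|nP] := pselect (forall s : R, 0 <= s <= 1 -> U (x t + s *: D h));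
    last first.
    by exists 0 => /nP.
  have [z Uz|s s01 E] := @line_derive_MVT _ _ g U (x t) (D h) (fun z =>
    grad g z (D h)) _ P.
    exact: (line_derive_grad oU dg cg).
  by exists s.
have [s sP] := choice H.
have zc : x t + s h *: D h @[h --> (0 : R)^'] --> x t.
  rewrite -[X in _ --> X]addr0; apply: cvgD; first exact: cvg_cst.
  apply: norm_cvg0.
  have n0 : `|D h| @[h --> 0^'] --> (0 : R).
    suff : `|D h| @[h --> (0 : R)^'] --> `|0 : 'rV[R]_n| by rewrite normr0.
    exact: cvg_norm.
  apply: (squeeze_cvgr (f := fun=> 0) (h := fun h : R => `|D h|));
    [|exact: cvg_cst|exact: n0].
  apply: filterS nD => h /sP[/andP[s0 s1] _].
  by rewrite normr_ge0/= normrZ ler_piMl// ger0_norm.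
exists (fun h => grad g (x t + s h *: D h) xi), (fun h =>
  grad g (x t + s h *: D h) w).
split.
- exact: (cvg_comp _ _ zc (@grad_continuous _ _ U g cg xi _ Ut)).
- exact: (cvg_comp _ _ zc (@grad_continuous _ _ U g cg w _ Ut)).
- by apply: filterS nD => h /sP[_]; rewrite xD gradD !gradZ.
Qed.

Lemma is_derive_curve (u' : R) : is_derive t 1 u u' ->
  is_derive t 1 (fun s => g (x s)) (grad g (x t) xi + u' * grad g (x t) w).
Proof.
move=> /is_derive_quotient du; apply/is_derive_quotient.
have [alpha [beta [ca cb E]]] := curve_increment.
apply: cvg_trans (cvgD ca (cvgM du cb)); apply: near_eq_cvg.
near=> h; have h0 : h != 0 by near: h; exact: nbhs_dnbhs_neq.
have -> : g (x (t + h)) - g (x t) = h * alpha h + (u (t + h) - u t) * beta h.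
  by near: h.
rewrite -[LHS]/(alpha h + h^-1 * (u (t + h) - u t) * beta h).
by rewrite [RHS]mulrDr !mulrA mulVf// mul1r.
Unshelve. all: by end_near. Qed.

(** Along a level curve the expansion reads [0 = h * alpha h + (u (t + h) - u t) * beta h], and
    [beta] is nonzero near 0, so the difference quotient of [u] equals [- alpha / beta]. *)
Lemma is_derive_implicit : (\forall s \near t, g (x s) = g (x t)) ->
  grad g (x t) w != 0 ->
  is_derive t 1 u (- grad g (x t) xi * (grad g (x t) w)^-1).
Proof.
move=> gx w0; apply/is_derive_quotient.
have [alpha [beta [ca cb E]]] := curve_increment.
apply: cvg_trans (cvgM (cvgN ca) (cvgV w0 cb)); apply: near_eq_cvg.
have th : t + h @[h --> (0 : R)^'] --> t.
  rewrite -[X in _ --> X]addr0; apply: cvgD; first exact: cvg_cst.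
  by apply: cvg_within; exact: cvg_id.
near=> h; have h0 : h != 0 by near: h; exact: nbhs_dnbhs_neq.
have b0 : beta h != 0 by near: h; exact: (cvgr_neq0 _ cb).
have : g (x (t + h)) - g (x t) = h * alpha h + (u (t + h) - u t) * beta h.
  by near: h.
have -> : g (x (t + h)) = g (x t) by near: h; exact: (th _ gx).
rewrite subrr => /esym/eqP; rewrite addr_eq0 => /eqP hE.
rewrite -[LHS]/(- alpha h * (beta h)^-1).
apply: (mulIf b0); rewrite divfK// -mulrA -[X in _ * X]opprK.
rewrite [_ * beta h](_ : _ = - (h * alpha h)); last by rewrite hE opprK.
by rewrite opprK mulrN mulrA mulVf// mul1r.
Unshelve. all: by end_near. Qed.

End curve.

(** * Lebesgue measure in coordinates *)

Lemma measurable_preimage d1 d2 (X : measurableType d1) (Y : measurableType d2)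
    (f : X -> Y) (A : set Y) :
  measurable_fun setT f -> measurable A -> measurable (f @^-1` A).
Proof. by move=> mf mA; rewrite -[X in measurable X]setTI; exact: mf. Qed.

(** Makes a multiple of an image measure available as a measure, to be compared with Lebesgue and
    product measures through their uniqueness theorems. *)
Lemma scaled_pushforward_measure (R : realType) d1 d2 (X : measurableType d1)
    (Y : measurableType d2) (mu : {measure set X -> \bar R}) (f : X -> Y) (c :
      R) :
  measurable_fun setT f -> 0 <= c ->
  exists m : {measure set Y -> \bar R},
    forall A, m A = (c%:E * mu (f @^-1` A))%E.
Proof.
move=> mf c0.
pose nu : {measure set _ -> \bar R} :=
  measure_function_pushforward__canonical__measure_function_Measure mu mf.
by exists (mscale (NngNum c0) nu).
Qed.

Notation tup R k := (k.-tuple (measurableTypeR R)).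

Definition leb (R : realType) (k : nat) :
    {sigma_finite_measure set (tup R k) -> \bar R} :=
  sval (cid (lebesgue_tuple_measure R k)).

Lemma lebE (R : realType) (k : nat) :
  (leb R k : set _ -> \bar R) = @lebesgue_tuple R k.
Proof. exact: svalP (cid (lebesgue_tuple_measure R k)). Qed.

(** Tuples carry the sigma-algebra and the measure, row vectors the linear algebra and the topology;
    [rv] and [tv] pass between the two. *)
Definition rv (R : realType) (k : nat) (y : tup R k) : 'rV[R]_k :=
  \row_j tnth y j.

Definition tv (R : realType) (k : nat) (x : 'rV[R]_k) : tup R k :=
  [tuple x ord0 j | j < k].

Lemma tvK (R : realType) (k : nat) : cancel (@tv R k) (@rv R k).
Proof. by move=> x; apply/rowP => j; rewrite mxE tnth_mktuple. Qed.

Lemma measurable_rv_coord (R : realType) (k : nat) (i : 'I_k) :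
  measurable_fun setT (fun y : tup R k => rv y ord0 i).
Proof.
have -> : (fun y : tup R k => rv y ord0 i) = (fun y => tnth y i : R).
  by apply: funext => y; rewrite mxE.
exact: measurable_tnth.
Qed.

Lemma measurable_tv (R : realType) (k : nat) d (X : measurableType d)
    (f : X -> 'rV[R]_k) :
  (forall i, measurable_fun setT (fun x => f x ord0 i)) ->
  measurable_fun setT (fun x => tv (f x)).
Proof.
move=> mf; apply/measurable_fun_tnthP => i.
apply: (eq_measurable_fun (fun x => f x ord0 i)) => // x _ /=.
by rewrite tnth_mktuple.
Qed.

Definition rmeasurable (R : realType) (k : nat) (E : set 'rV[R]_k) :=
  measurable (@rv R k @^-1` E).

Lemma measurable_preimage_rmeasurable (R : realType) (k : nat) d
    (X : measurableType d) (f : X -> 'rV[R]_k) (E : set 'rV[R]_k) :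
  (forall i, measurable_fun setT (fun x => f x ord0 i)) ->
  rmeasurable E -> measurable (f @^-1` E).
Proof.
move=> mf mE; rewrite (_ : f @^-1` E = (fun x =>
  tv (f x)) @^-1` (@rv R k @^-1` E)).
  by rewrite -[X in measurable X]setTI; exact: measurable_tv.
by apply/seteqP; split => x /=; rewrite tvK.
Qed.

Definition vol (R : realType) (k : nat) (E : set 'rV[R]_k) : \bar R :=
  leb R k (@rv R k @^-1` E).

Lemma lebS (R : realType) (k : nat) (E : set (tup R k.+1)) :
  leb R k.+1 E = (lebesgue_measure \x leb R k)%E (@tuple_cons R k @^-1` E).
Proof. by rewrite !lebE. Qed.

Lemma lebesgue_measure_affine (R : realType) (s a : R) (A : set (measurableTypeR
  R)) :
  0 < s -> measurable A ->
  (s%:E * lebesgue_measure [set x : measurableTypeR R | A ((s * x + a)%R)])%E =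
    lebesgue_measure A.
Proof.
move=> s0 mA.
pose f (x : measurableTypeR R) : measurableTypeR R := s * x + a.
have mf : measurable_fun setT f.
  apply: measurable_funD; last exact: measurable_cst.
  by apply: measurable_funM; [exact: measurable_cst|exact: measurable_id].
have [m mE] := scaled_pushforward_measure (@lebesgue_measure R) mf (ltW s0).
rewrite [RHS](@lebesgue_measure_unique _ m)// => X.
move=> [[u v]] _ <- /=.
rewrite [RHS](_ : _ = s%:E * lebesgue_measure (f @^-1` `]u, v]))%E;
  last exact: mE.
have -> : f @^-1` `]u, v] = `](u - a) / s, (v - a) / s]%classic.
  apply/seteqP; split => x; rewrite /f /= !in_itv/= ltr_pdivrMr// ler_pdivlMr//;
  by rewrite (mulrC x) ltrBlDr lerBrDr.
rewrite !lebesgue_measure_itv/= !lte_fin ltr_pM2r ?invr_gt0// ltrD2r.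
case: ifP => _; last by rewrite mule0.
rewrite -!EFinB -EFinM; congr EFin.
by field; rewrite gt_eqF.
Qed.

Lemma product_section (R : realType) d1 d2 (T1 : measurableType d1)
    (T2 : measurableType d2) (m1 : {sigma_finite_measure set T1 -> \bar R})
    (m2 : {sigma_finite_measure set T2 -> \bar R}) (S : set (T1 * T2)) :
  measurable S ->
  (\int[m1]_x m2 [set y | S (x, y)] = \int[m2]_y m1 [set x | S (x, y)])%E.
Proof.
move=> mS; have := @indic_fubini_tonelli _ _ _ _ _ m1 m2 S mS.
rewrite indic_fubini_tonelli_FE// indic_fubini_tonelli_GE//.
have -> : m2 \o xsection S = fun x => m2 [set y | S (x, y)].
  by apply/funext => x /=; congr (m2 _); apply/seteqP; split => y /=;
    rewrite /xsection/= inE.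
have -> // : m1 \o ysection S = fun y => m1 [set x | S (x, y)].
by apply/funext => x /=; congr (m1 _); apply/seteqP; split => y /=;
  rewrite /ysection/= inE.
Qed.

Lemma product_measure1_sections (R : realType) d1 d2 (T1 : measurableType d1)
    (T2 : measurableType d2) (m1 : {sigma_finite_measure set T1 -> \bar R})
    (m2 : {sigma_finite_measure set T2 -> \bar R}) (S : set (T1 * T2)) :
  ((m1 \x m2) S = \int[m1]_x m2 [set y | S (x, y)])%E.
Proof.
rewrite /product_measure1; apply: eq_integral => x _ /=; congr (m2 _).
by apply/seteqP; split => y /=; rewrite /xsection/= inE.
Qed.

(** Induction on the dimension: both sides are measures, and on rectangles they agree by the
    one-dimensional case and the induction hypothesis. *)
Lemma leb_affine (R : realType) (k : nat) (s : R) (a : 'rV[R]_k)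
    (A : set (tup R k)) :
  0 < s -> measurable A ->
  ((s ^+ k)%:E * leb R k [set x | A (tv (s *: rv x + a))])%E = leb R k A.
Proof.
move=> s0; elim: k a A => [|k IH] a A mA.
  rewrite expr0 mul1e; congr (leb _ _ _); apply/seteqP; split => x /=;
  by rewrite (tuple0 x) (tuple0 (tv _)).
pose a0 : R := a ord0 ord0.
pose a' : 'rV[R]_k := \row_j a ord0 (lift ord0 j).
pose f (x : measurableTypeR R * tup R k) : measurableTypeR R * tup R k :=
  (s * x.1 + a0, tv (s *: rv x.2 + a')).
have mf : measurable_fun setT f.
  apply: measurable_fun_pair.
    apply: measurable_funD; last exact: measurable_cst.
    by apply: measurable_funM; [exact: measurable_cst|exact: measurable_fst].
  apply: measurable_tv => i.
  rewrite (_ : (fun x => _) = (fun x : measurableTypeR R * tup R k =>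
      s * rv x.2 ord0 i + a' ord0 i)); last by apply/funext => x; rewrite !mxE.
  apply: measurable_funD; last exact: measurable_cst.
  apply: measurable_funM; first exact: measurable_cst.
  apply: (measurableT_comp (@measurable_rv_coord _ _ _)).
  exact: measurable_snd.
pose mm : {measure set _ -> \bar R} :=
  lebesgue_integral_fubini_product_measure1__canonical__measure_function_Measure
    (@lebesgue_measure R) (leb R k).
have [m mE] := scaled_pushforward_measure mm mf (ltW (exprn_gt0 k.+1 s0)).
have mC : measurable (@tuple_cons R k @^-1` A).
  by rewrite -[X in measurable X]setTI; exact: measurable_tuple_cons.
rewrite !lebS [RHS](@product_measure_unique _ _ _ _ _ _ _ m)//.
  rewrite mE; congr (_ * _)%E.
  congr (_ _); apply/seteqP; split => -[x y] /=; congr A;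
    apply: eq_from_tnth => i;
  rewrite tnth_mktuple /tuple_cons /f /= !mxE;
  by have [j ->|->] := unliftP ord0 i;
    rewrite ?tnthS ?tnth_mktuple ?mxE ?(tnth_nth 0).
move=> X Y mX mY; rewrite mE.
have -> : f @^-1` (X `*` Y) = [set x | X (s * x + a0)] `*`
    [set x | Y (tv (s *: rv x + a'))] by apply/seteqP; split => -[x y].
have mX' : measurable [set x : measurableTypeR R | X (s * x + a0)].
  apply: (measurable_preimage _ mX).
  apply: measurable_funD; last exact: measurable_cst.
  by apply: measurable_funM; [exact: measurable_cst|exact: measurable_id].
have mY' : measurable [set x | Y (tv (s *: rv x + a'))].
  apply: (measurable_preimage _ mY).
  apply: measurable_tv => i.
  rewrite (_ : (fun x => _) = (fun x : tup R k =>
    s * rv x ord0 i + a' ord0 i)); last by apply/funext => x; rewrite !mxE.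
  apply: measurable_funD; last exact: measurable_cst.
  apply: measurable_funM; first exact: measurable_cst.
  exact: measurable_rv_coord.
pose lX := (lebesgue_measure [set x : measurableTypeR R | X (s * x + a0)%R]).
pose lY := leb R k [set x | Y (tv (s *: rv x + a'))].
rewrite [X in (_ * X)%E](_ : _ = lX * lY)%E; last exact: product_measure1E.
rewrite [RHS](_ : _ = (s%:E * lX) * ((s ^+ k)%:E * lY))%E; last first.
  by congr (_ * _)%E; [exact/esym/lebesgue_measure_affine|exact/esym/IH].
rewrite exprS EFinM !muleA; congr (_ * _)%E.
by rewrite -!muleA; congr (_ * _)%E; rewrite muleC.
Qed.

Lemma vol_affine (R : realType) (k : nat) (s : R) (a : 'rV[R]_k)
    (E : set 'rV[R]_k) :
  0 < s -> rmeasurable E ->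
  ((s ^+ k)%:E * vol [set x | E (s *: x + a)%R])%E = vol E.
Proof.
move=> s0 mE; rewrite /vol -(leb_affine a s0 mE); congr (_ * leb _ _ _)%E.
by apply/seteqP; split => x /=; rewrite tvK.
Qed.

Lemma vol_translate (R : realType) (k : nat) (a : 'rV[R]_k) (E : set 'rV[R]_k) :
  rmeasurable E -> vol [set x | E (x + a)] = vol E.
Proof.
move=> mE; rewrite -(vol_affine a ltr01 mE) expr1n mul1e; congr vol.
by apply/seteqP; split => x /=; rewrite scale1r.
Qed.

Lemma vol_box (R : realType) (k : nat) (a b : 'I_k -> R) :
  (forall i, a i <= b i) ->
  vol [set x : 'rV[R]_k | forall i, a i <= x ord0 i <= b i] =
  (\prod_(i < k) (b i - a i))%:E.
Proof.
move=> ab; rewrite -(lebesgue_tuple_box ab) /vol lebE; congr lebesgue_tuple.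
by apply/seteqP; split => x /= xab i; have := xab i; rewrite mxE.
Qed.

Lemma rmeasurable_le (R : realType) (k : nat) (f g : 'rV[R]_k -> R) :
  measurable_fun setT (f \o @rv R k) ->
  measurable_fun setT (g \o @rv R k) ->
  rmeasurable [set x | f x <= g x].
Proof.
move=> mf mg; rewrite /rmeasurable (_ : _ @^-1` _ =
  (fun y => (f \o @rv R k) y <= (g \o @rv R k) y) @^-1` [set true]).
  apply: measurable_preimage => //; exact: measurable_fun_ler.
by apply/seteqP; split => y.
Qed.

Lemma measurable_dot (R : realType) (k : nat) d (X : measurableType d)
    (f g : X -> 'rV[R]_k) :
  (forall i, measurable_fun setT (fun x => f x ord0 i)) ->
  (forall i, measurable_fun setT (fun x => g x ord0 i)) ->
  measurable_fun setT (fun x => dot (f x) (g x)).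
Proof.
by move=> mf mg; apply: measurable_sum => i; apply: measurable_funM.
Qed.

Lemma measurable_mulmx (R : realType) (k l : nat) d (X : measurableType d)
    (f : X -> 'rV[R]_k) (M : 'M[R]_(k, l)) :
  (forall i, measurable_fun setT (fun x => f x ord0 i)) ->
  forall i, measurable_fun setT (fun x => (f x *m M) ord0 i).
Proof.
move=> mf i; rewrite (_ : (fun x => _) = fun x => \sum_j f x ord0 j * M j i).
  apply: measurable_sum => j; exact: measurable_funM.
by apply/funext => x; rewrite mxE.
Qed.

Lemma measurable_coordD (R : realType) (k : nat) d (X : measurableType d)
    (f g : X -> 'rV[R]_k) :
  (forall i, measurable_fun setT (fun x => f x ord0 i)) ->
  (forall i, measurable_fun setT (fun x => g x ord0 i)) ->
  forall i, measurable_fun setT (fun x => (f x + g x) ord0 i).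
Proof.
move=> mf mg i.
rewrite (_ : (fun x => _) = fun x => f x ord0 i + g x ord0 i).
  exact: measurable_funD.
by apply/funext => x; rewrite mxE.
Qed.

Lemma measurable_coordZ (R : realType) (k : nat) d (X : measurableType d)
    (c : X -> R) (f : X -> 'rV[R]_k) :
  measurable_fun setT (c) ->
  (forall i, measurable_fun setT (fun x => f x ord0 i)) ->
  forall i, measurable_fun setT (fun x => (c x *: f x) ord0 i).
Proof.
move=> mc mf i.
rewrite (_ : (fun x => _) = fun x => c x * f x ord0 i).
  exact: measurable_funM.
by apply/funext => x; rewrite mxE.
Qed.

Lemma le_vol (R : realType) (k : nat) (E F : set 'rV[R]_k) :
  rmeasurable E -> rmeasurable F -> E `<=` F -> (vol E <= vol F)%E.
Proof. by move=> mE mF EF; apply: le_measure; rewrite ?inE// => x /EF. Qed.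

(** * Euclidean balls, boxes and invariance of the volume *)

Definition eball (R : realType) (k : nat) (r : R) : set 'rV[R]_k :=
  [set x | dot x x <= r ^+ 2].

Lemma rmeasurable_eball (R : realType) (k : nat) (r : R) : rmeasurable (@eball R
  k r).
Proof.
apply: (@rmeasurable_le R k (fun x => dot x x)); last exact: measurable_cst.
by apply: measurable_dot => i; exact: measurable_rv_coord.
Qed.

Lemma rmeasurable_box (R : realType) (k : nat) (a b : 'I_k -> R) :
  rmeasurable [set x : 'rV[R]_k | forall i, a i <= x ord0 i <= b i].
Proof.
rewrite (_ : [set _ | _] = \bigcap_(i in [set: 'I_k])
   ([set x : 'rV[R]_k | a i <= x ord0 i] `&` [set x | x ord0 i <= b i]));
     last first.
  apply/seteqP; split => x /=; first by move=> + i _ => /(_ i)/andP[].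
  by move=> + i => /(_ i Logic.I)[/= -> ->].
rewrite /rmeasurable preimage_bigcap; apply: fin_bigcap_measurable => // i _.
rewrite preimage_setI; apply: measurableI.
- apply: (@rmeasurable_le R k (cst (a i)) (fun x => x ord0 i)).
    exact: measurable_cst.
  exact: measurable_rv_coord.
- apply: (@rmeasurable_le R k (fun x => x ord0 i) (cst (b i))).
    exact: measurable_rv_coord.
  exact: measurable_cst.
Qed.

Lemma sqr_coord_le_dot (R : realType) (k : nat) (x : 'rV[R]_k) (i : 'I_k) :
  x ord0 i ^+ 2 <= dot x x.
Proof.
rewrite /dot (bigD1 i)//= expr2 lerDl sumr_ge0// => j _.
by rewrite -expr2 sqr_ge0.
Qed.

Lemma dot_ge0 (R : realType) (k : nat) (x : 'rV[R]_k) : 0 <= dot x x.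
Proof. by apply: sumr_ge0 => i _; rewrite -expr2 sqr_ge0. Qed.

Lemma eball_sub_box (R : realType) (k : nat) (r : R) : 0 <= r ->
  @eball R k r `<=` [set x | forall i, - r <= x ord0 i <= r].
Proof.
move=> r0 x xr i; rewrite -ler_norml -(@ler_pXn2r R 2)// ?nnegrE//.
by rewrite real_normK ?num_real// (le_trans (sqr_coord_le_dot x i)).
Qed.

Lemma vol_eball_fin (R : realType) (k : nat) (r : R) : 0 <= r ->
  (vol (@eball R k r) < +oo)%E.
Proof.
move=> r0.
apply: le_lt_trans (le_vol (rmeasurable_eball r) (rmeasurable_box _ _)
  (eball_sub_box r0)) _.
by rewrite vol_box ?ltry// => i; rewrite ge0_cp.
Qed.

Lemma vol_eball_gt0 (R : realType) (k : nat) (r : R) : 0 < r ->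
  (0 < vol (@eball R k r))%E.
Proof.
move=> r0.
(* The cube of half-side [r / (k + 1)] lies in the ball because [k <= (k + 1)^2]; the [+ 1] covers
   [k = 0]. *)
have c0 : 0 < r / k.+1%:R by rewrite divr_gt0.
have sub : [set x : 'rV[R]_k | forall i,
  - (r / k.+1%:R) <= x ord0 i <= r / k.+1%:R]
  `<=` eball r.
  move=> x xc; rewrite /eball /=.
  apply: (@le_trans _ _ (\sum_(i < k) (r / k.+1%:R) ^+ 2)).
    apply: ler_sum => i _; rewrite -expr2 -(real_normK (num_real _)).
    have := xc i; rewrite -ler_norml => xi.
    by rewrite ler_pXn2r ?nnegrE ?(ltW c0).
  rewrite sumr_const card_ord expr_div_n -[_ *+ k]mulr_natr -mulrA ler_piMr
    ?sqr_ge0//.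
  rewrite mulrC ler_pdivrMr ?exprn_gt0// mul1r expr2 -natrM ler_nat.
  by rewrite (leq_trans (leqnSn k))// leq_pmulr.
apply: lt_le_trans (le_vol (rmeasurable_box _ _) (rmeasurable_eball r) sub).
rewrite vol_box => [|i]; last by rewrite ge0_cp// ltW.
by rewrite lte_fin prodr_gt0// => i _; rewrite opprK addr_gt0.
Qed.

Lemma integral_indic_cond (R : realType) d (T : measurableType d)
    (m : {measure set T -> \bar R}) (A : set T) (c : \bar R) (f : T -> \bar R) :
  measurable A -> (0 <= c)%E -> (forall x, A x -> f x = c) ->
  (forall x, ~ A x -> f x = 0%E) -> (\int[m]_x f x = c * m A)%E.
Proof.
move=> mA c0 fA fnA.
rewrite (eq_integral (fun x => c * (\1_A x)%:E))%E => [|x _]; last first.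
  rewrite indicE; have [/set_mem Ax|/negP nAx] := boolP (x \in A).
    by rewrite mule1 fA.
  by rewrite mule0 fnA// => Ax; apply: nAx; exact: mem_set.
rewrite ge0_integralZl ?integral_indic ?setIT//.
by apply/measurable_EFinP; exact: measurable_indic.
Qed.

Lemma dotC (R : realType) (k : nat) (x y : 'rV[R]_k) : dot x y = dot y x.
Proof. by apply: eq_bigr => i _; rewrite mulrC. Qed.

Lemma dot_mulmx (R : realType) (k l : nat) (x : 'rV[R]_k) (y : 'rV[R]_l)
    (M : 'M[R]_(k, l)) : dot (x *m M) y = dot x (y *m M^T).
Proof. by rewrite !dotE trmx_mul trmxK mulmxA. Qed.

Lemma dot_orthogonal (R : realType) (k l : nat) (x y : 'rV[R]_k)
    (M : 'M[R]_(k, l)) : M *m M^T = 1%:M -> dot (x *m M) (y *m M) = dot x y.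
Proof. by move=> MM; rewrite dot_mulmx -mulmxA MM mulmx1. Qed.

Lemma dotN (R : realType) (k : nat) (x : 'rV[R]_k) : dot (- x) (- x) = dot x x.
Proof. by apply: eq_bigr => i _; rewrite !mxE mulrNN. Qed.

(** Count the pairs [(x, y)] with [x] in the unit ball [B] and [x + y M] in [G] in two ways. For
    fixed [x] the points [y] form a translate of [H]. With [z = x + y M] in [G] fixed instead, they
    form a unit ball about [z M^T], since [M] preserves [dot]. Hence
    [vol H * vol B = vol B * vol G], by translation invariance and Tonelli, without determinants. *)
Lemma vol_orthogonal (R : realType) (k : nat) (M : 'M[R]_k) (G : set 'rV[R]_k) :
  M *m M^T = 1%:M -> rmeasurable G -> vol [set x | G (x *m M)] = vol G.
Proof.
move=> MM mG; have MM' := mulmx1C MM.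
pose B : set 'rV[R]_k := eball 1.
have B0 : (0 < vol B)%E by exact: vol_eball_gt0.
have Boo : (vol B < +oo)%E by exact: vol_eball_fin.
have mB : rmeasurable B by exact: rmeasurable_eball.
pose H : set 'rV[R]_k := [set x | G (x *m M)].
have mrv i : measurable_fun setT (fun y : tup R k => rv y ord0 i).
  exact: measurable_rv_coord.
have m1 i : measurable_fun setT (fun p : tup R k * tup R k =>
    rv p.1 ord0 i).
  exact: (measurableT_comp (mrv i) measurable_fst).
have m2 i : measurable_fun setT (fun p : tup R k * tup R k =>
    rv p.2 ord0 i).
  exact: (measurableT_comp (mrv i) measurable_snd).
have mH : rmeasurable H.
  by apply: (measurable_preimage_rmeasurable (f := fun y => rv y *m M)) => //;
    exact: measurable_mulmx.
pose S1 := [set p : tup R k * tup R k | B (rv p.1) /\ G (rv p.1 + rv p.2 *m M)].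
have mS1 : measurable S1.
  apply: measurableI; first exact: (measurable_preimage_rmeasurable m1).
  apply: (measurable_preimage_rmeasurable (f := fun p : tup R k * tup R k =>
    rv p.1 + rv p.2 *m M)) => //.
  by apply: measurable_coordD => //; exact: measurable_mulmx.
pose S2 := [set p : tup R k * tup R k | B (rv p.1 - rv p.2 *m M) /\ G (rv p.1)].
have mS2 : measurable S2.
  apply: measurableI; last exact: (measurable_preimage_rmeasurable m1).
  apply: (measurable_preimage_rmeasurable (f := fun p : tup R k * tup R k =>
    rv p.1 - rv p.2 *m M)) => //.
  move=> i; rewrite (_ : (fun p => _) =
    (fun p : tup R k * tup R k => (rv p.1 + rv p.2 *m (- M)) ord0 i)).
    by apply: measurable_coordD => // j; exact: measurable_mulmx.
  by apply/funext => p; rewrite mulmxN.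
have E1 : (\int[leb R k]_x leb R k [set y | S1 (x, y)] = vol H * vol B)%E.
  apply: integral_indic_cond => // x Bx; last first.
    by rewrite (_ : [set y | _] = set0) ?measure0//; apply/seteqP; split =>
      y //= -[].
  rewrite -(vol_translate (rv x *m M^T) mH); congr (leb R k _).
  apply/seteqP; split => y /=;
    rewrite /S1 /H /= mulmxDl -mulmxA MM' mulmx1 addrC.
    by case.
  by [].
have E2 : (\int[leb R k]_x leb R k [set y | S2 (x, y)] = vol B * vol G)%E.
  apply: integral_indic_cond => // x Gx; last first.
    by rewrite (_ : [set y | _] = set0) ?measure0//; apply/seteqP; split =>
      y //= -[].
  rewrite -(vol_translate (- (rv x *m M^T)) mB); congr (leb R k _).
  have key y : dot (rv x - rv y *m M) (rv x - rv y *m M) =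
      dot (rv y - rv x *m M^T) (rv y - rv x *m M^T).
    rewrite -(@dot_orthogonal _ _ _ (rv y - rv x *m M^T) _ M)//
      mulmxBl -mulmxA MM' mulmx1.
    by rewrite -dotN opprB.
  apply/seteqP; split => y /=; rewrite /S2 /B /eball /= key; last by [].
  by case.
(* For fixed [y] the two sections differ by the translation by [y M]. *)
have E3 : (\int[leb R k]_y leb R k [set x | S1 (x, y)] =
           \int[leb R k]_y leb R k [set x | S2 (x, y)])%E.
  apply: eq_integral => y _.
  pose F : set 'rV[R]_k := [set x | B (x - rv y *m M) /\ G x].
  have mF : rmeasurable F.
    apply: measurableI => //.
    apply: (measurable_preimage_rmeasurable (f := fun x =>
      rv x - rv y *m M)) => //.
    by apply: measurable_coordD => // i; exact: measurable_cst.
  rewrite [RHS](_ : _ = vol F)// -(vol_translate (rv y *m M) mF).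
  by congr (leb R k _); apply/seteqP; split => x; rewrite /S1 /F /= addrK.
have : (vol H * vol B = vol B * vol G)%E.
  by rewrite -E1 -E2 !product_section// E3.
have [b b0 ->] : exists2 b, 0 < b & vol B = b%:E.
  exists (fine (vol B)); first by rewrite fine_gt0// B0.
  by rewrite fineK// ge0_fin_numE// ltW.
rewrite muleC => /(congr1 (mule b^-1%:E)).
by rewrite !muleA -EFinM mulVf ?mul1e// gt_eqF.
Qed.

(** Balls of the sup norm are boxes, so each point of [U] lies in a box with rational corners
    contained in [U], and there are countably many of these. *)
Lemma open_rmeasurable (R : realType) (k : nat) (U : set 'rV[R]_k) :
  open U -> rmeasurable U.
Proof.
move=> oU.
pose bx (q : 'rV[rat]_k * 'rV[rat]_k) : set 'rV[R]_k :=
  [set x | forall i, ratr (q.1 ord0 i) <= x ord0 i <= ratr (q.2 ord0 i)].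
pose F q : set 'rV[R]_k := if `[< bx q `<=` U >] then bx q else set0.
have -> : U = \bigcup_q F q.
  apply/seteqP; split => [x Ux|x [q _]]; last first.
    by rewrite /F; case: asboolP => // + bqx; exact.
  have /nbhs_ballP[e /= e0 eU] : nbhs x U by exact: open_nbhs_nbhs.
  have Ha i : exists q : rat, ratr q \in `]x ord0 i - e, x ord0 i[.
    have [|q qx] := @rat_in_itvoo R (x ord0 i - e) (x ord0 i); last by exists q.
    by rewrite gtrBl.
  have Hb i : exists q : rat, ratr q \in `]x ord0 i, x ord0 i + e[.
    have [|q qx] := @rat_in_itvoo R (x ord0 i) (x ord0 i + e); last by exists q.
    by rewrite ltrDl.
  have /choice[a aP] := Ha; have /choice[b bP] := Hb.
  exists (\row_i a i, \row_i b i) => //; rewrite /F.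
  case: asboolP => [_ i|[]]; last first.
    move=> y yq; apply: eU; split => // i j; rewrite ord1.
    have := yq j; rewrite !mxE; have := aP j; have := bP j.
    rewrite !in_itv/= => /andP[b1 b2] /andP[a1 a2] /andP[y1 y2].
    by rewrite /ball /= ltr_distl; apply/andP; split; lra.
  by rewrite !mxE; have := aP i; have := bP i; rewrite !in_itv/=;
    move=> /andP[/ltW -> _] /andP[_ /ltW ->].
rewrite /rmeasurable preimage_bigcup; apply: countable_bigcupT_measurable => //.
move=> q; rewrite /F; case: asboolP => _; last by rewrite preimage_set0.
exact: rmeasurable_box.
Qed.

Lemma rmeasurableC (R : realType) (k : nat) (U : set 'rV[R]_k) :
  rmeasurable U -> rmeasurable (~` U).
Proof. by move=> mU; rewrite /rmeasurable preimage_setC; exact: measurableC.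
  Qed.

Lemma closed_rmeasurable (R : realType) (k : nat) (U : set 'rV[R]_k) :
  closed U -> rmeasurable U.
Proof.
move=> cU; rewrite -(setCK U); apply: rmeasurableC; apply: open_rmeasurable.
by rewrite openC.
Qed.

Lemma col_mx_frame_orthogonal (R : realType) (d : nat) (xi : 'rV[R]_d.+1)
    (B : 'M[R]_(d, d.+1)) :
  dot xi xi = 1 -> (forall i j, dot (row i B) (row j B) = (i == j)%:R) ->
  (forall i, dot (row i B) xi = 0) ->
  col_mx xi B *m (col_mx xi B)^T = 1%:M.
Proof.
move=> xi1 BB Bxi.
rewrite tr_col_mx mul_col_row [RHS]scalar_mx_block.
congr block_mx.
- by apply/matrixP => i j; rewrite !ord1 -dotE xi1 !mxE.
- apply/matrixP => i j; rewrite ord1 mxE [RHS]mxE -[RHS](Bxi j) dotC /dot.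
  by apply: eq_bigr => l _; rewrite !mxE.
- apply/matrixP => i j; rewrite ord1 mxE [RHS]mxE -[RHS](Bxi i) /dot.
  by apply: eq_bigr => l _; rewrite !mxE.
- apply/matrixP => i j; rewrite mxE [RHS]mxE -[RHS](BB i j) /dot.
  by apply: eq_bigr => l _; rewrite !mxE.
Qed.

Lemma sphere_dot (R : realType) (n : nat) (xi : 'rV[R]_n) :
  sphere xi <-> dot xi xi = 1.
Proof.
split => [xi1|xi1]; last by rewrite /sphere /= xi1 sqrtr1.
by rewrite -(sqr_sqrtr (dot_ge0 xi)) xi1 expr1n.
Qed.

Definition slice (R : realType) (d : nat) (xi : 'rV[R]_d.+1) (t : R)
    (E : set 'rV[R]_d.+1) : set 'rV[R]_d :=
  [set y | E (t *: xi + y *m frame xi)].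

Lemma dotDl (R : realType) (k : nat) (x y z : 'rV[R]_k) :
  dot (x + y) z = dot x z + dot y z.
Proof. by rewrite /dot -big_split; apply: eq_bigr => i _; rewrite mxE mulrDl.
  Qed.

Lemma dotDr (R : realType) (k : nat) (x y z : 'rV[R]_k) :
  dot x (y + z) = dot x y + dot x z.
Proof. by rewrite dotC dotDl !(dotC x). Qed.

Lemma dotZl (R : realType) (k : nat) (a : R) (x y : 'rV[R]_k) :
  dot (a *: x) y = a * dot x y.
Proof. by rewrite /dot mulr_sumr; apply: eq_bigr => i _; rewrite mxE mulrA. Qed.

Lemma dotZr (R : realType) (k : nat) (a : R) (x y : 'rV[R]_k) :
  dot x (a *: y) = a * dot x y.
Proof. by rewrite dotC dotZl dotC. Qed.

Lemma frame_orthogonal (R : realType) (d : nat) (xi : 'rV[R]_d.+1) :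
  sphere xi -> frame xi *m (frame xi)^T = 1%:M.
Proof.
move=> xi1; have [BB _] := frameP xi1.
apply/matrixP => i j; rewrite mxE [RHS]mxE -[RHS](BB i j) /dot.
by apply: eq_bigr => l _; rewrite !mxE.
Qed.

Lemma dot_frame (R : realType) (d : nat) (xi : 'rV[R]_d.+1) (y : 'rV[R]_d) :
  sphere xi -> dot (y *m frame xi) xi = 0.
Proof.
move=> xi1; have [_ Bxi] := frameP xi1.
rewrite dot_mulmx (_ : xi *m _ = 0).
  by rewrite /dot big1// => i _; rewrite mxE mulr0.
apply/rowP => i; rewrite mxE [RHS]mxE -[RHS](Bxi i) /dot.
by apply: eq_bigr => l _; rewrite !mxE mulrC.
Qed.

Lemma rmeasurable_slice (R : realType) (d : nat) (xi : 'rV[R]_d.+1) (t : R)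
    (E : set 'rV[R]_d.+1) : rmeasurable E -> rmeasurable (slice xi t E).
Proof.
move=> mE.
apply: (measurable_preimage_rmeasurable (f := fun y : tup R d =>
  t *: xi + rv y *m frame xi)) => //.
apply: measurable_coordD => i; first exact: measurable_cst.
by apply: measurable_mulmx => j; exact: measurable_rv_coord.
Qed.

Lemma measurable_vol_slice (R : realType) (d : nat) (xi : 'rV[R]_d.+1)
    (E : set 'rV[R]_d.+1) : rmeasurable E ->
  measurable_fun setT (fun t : measurableTypeR R => vol (slice xi t E)).
Proof.
move=> mE.
pose S := [set p : measurableTypeR R * tup R d |
  E (p.1 *: xi + rv p.2 *m frame xi)].
have mS : measurable S.
  apply: (measurable_preimage_rmeasurable (f :=
    fun p : measurableTypeR R * tup R d =>
    p.1 *: xi + rv p.2 *m frame xi)) => //.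
  apply: measurable_coordD.
    apply: measurable_coordZ; first exact: measurable_fst.
    by move=> i; exact: measurable_cst.
  apply: measurable_mulmx => i.
  exact: (measurableT_comp (measurable_rv_coord i) measurable_snd).
apply: eq_measurable_fun (measurable_fun_xsection (leb R d) mS) => x _ /=.
by congr (leb R d _); apply/seteqP; split => y; rewrite /xsection /S /= ?inE.
Qed.

(* The rows of [frame xi] complete [xi] to an orthonormal basis, so that the
   orthogonal invariance of the volume reduces the claim to Tonelli's theorem
   in the coordinates of that basis. *)
Lemma vol_slices (R : realType) (d : nat) (xi : 'rV[R]_d.+1)
    (E : set 'rV[R]_d.+1) (I : set R) : sphere xi -> rmeasurable E ->
  measurable (I : set (measurableTypeR R)) ->
  vol [set x | E x /\ I (dot x xi)] =
  (\int[lebesgue_measure]_(t in I) vol (slice xi t E))%E.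
Proof.
move=> xi1 mE mI; have [BB Bxi] := frameP xi1.
pose M : 'M[R]_d.+1 := col_mx xi (frame xi).
have MM : M *m M^T = 1%:M.
  exact: (col_mx_frame_orthogonal ((sphere_dot xi).1 xi1) BB Bxi).
pose F := [set x | E x /\ I (dot x xi)].
have mF : rmeasurable F.
  apply: measurableI => //.
  apply: (@measurable_preimage _ _ _ _ (fun y : tup R d.+1 =>
    dot (rv y) xi : measurableTypeR R) I) => //.
  apply: measurable_dot => i; first exact: measurable_rv_coord.
  exact: measurable_cst.
rewrite -/F -(vol_orthogonal MM mF) /vol lebS product_measure1_sections.
rewrite [RHS]integral_mkcond; apply: eq_integral => t _.
have key (y : tup R d) : rv (tuple_cons (t,
  y)) *m M = t *: xi + rv y *m frame xi.
  rewrite (_ : rv _ = row_mx (t%:M : 'M[R]_1) (rv y)).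
    by rewrite -[LHS]/(row_mx t%:M (rv y) *m col_mx xi (frame xi)) mul_row_col
      mul_scalar_mx.
  apply/rowP => i; rewrite mxE.
  have [j ->|j ->] := split_ordP (i : 'I_(1 + d)).
    by rewrite row_mxEl !ord1 mxE (tnth_nth 0).
  by rewrite row_mxEr mxE !(tnth_nth 0).
have dt (y : tup R d) : dot (t *: xi + rv y *m frame xi) xi = t.
  by rewrite dotDl dot_frame// addr0 dotZl (sphere_dot xi).1// mulr1.
rewrite patchE; case: ifPn => [/set_mem tI|/negP tI].
  by congr (leb R d _); apply/seteqP; split => y;
    rewrite /slice /= /F /= key dt; tauto.
rewrite (_ : [set y | _] = set0) ?measure0//; apply/seteqP; split => y //=.
by rewrite /F /= key dt => -[_ It]; apply: tI; exact: mem_set.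
Qed.

Definition section_volume (R : realType) (d : nat) (E : set 'rV[R]_d.+1)
    (xi : 'rV[R]_d.+1) (t : R) : R := fine (vol (slice xi t E)).

Definition halfspace_volume (R : realType) (k : nat) (E : set 'rV[R]_k)
    (v : 'rV[R]_k) (s : R) : R := fine (vol [set x | E x /\ dot x v <= s]).

Lemma dot_slice (R : realType) (d : nat) (xi : 'rV[R]_d.+1) (t : R)
    (y : 'rV[R]_d) : sphere xi ->
  dot (t *: xi + y *m frame xi) (t *: xi + y *m frame xi) = t ^+ 2 + dot y y.
Proof.
move=> xi1; rewrite dotDl !dotDr !dotZl !dotZr (sphere_dot xi).1//.
rewrite (dotC xi) !dot_frame// dot_orthogonal ?frame_orthogonal//.
by rewrite !mulr0 addr0 add0r mulr1 expr2.
Qed.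

Lemma slice_eball (R : realType) (d : nat) (xi : 'rV[R]_d.+1) (t r : R) :
  sphere xi -> `|t| <= r ->
  slice xi t (eball r) = eball (Num.sqrt (r ^+ 2 - t ^+ 2)).
Proof.
move=> xi1 tr; have r0 : 0 <= r by exact: le_trans tr.
have tr2 : 0 <= r ^+ 2 - t ^+ 2.
  by rewrite subr_ge0 -(real_normK (num_real t)) ler_pXn2r ?nnegrE.
apply/seteqP; split => y; rewrite /slice /eball /= dot_slice// sqr_sqrtr//.
  by rewrite lerBrDl.
by rewrite lerBrDl.
Qed.

Lemma vol_eball (R : realType) (k : nat) (r : R) : 0 < r ->
  vol (@eball R k r) = ((r ^+ k)%:E * vol (@eball R k 1))%E.
Proof.
move=> r0; rewrite -(vol_affine 0 r0 (rmeasurable_eball r)).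
congr (_ * vol _)%E; apply/seteqP; split => x;
rewrite /eball /= addr0 dotZl dotZr mulrA -expr2 expr1n.
  by rewrite -[leRHS]mulr1 ler_pM2l ?exprn_gt0.
by move=> x1; rewrite -[leRHS]mulr1 ler_pM2l ?exprn_gt0.
Qed.

Lemma section_volume_eball (R : realType) (d : nat) (xi : 'rV[R]_d.+1) (t r : R)
  :
  sphere xi -> `|t| < r ->
  section_volume (eball r) xi t =
  fine (vol (@eball R d 1)) * Num.sqrt (r ^+ 2 - t ^+ 2) ^+ d.
Proof.
move=> xi1 tr; rewrite /section_volume slice_eball ?ltW//.
have r0 : 0 < r by exact: le_lt_trans tr.
have s0 : 0 < r ^+ 2 - t ^+ 2.
  by rewrite subr_gt0 -(real_normK (num_real t)) ltr_pXn2r ?nnegrE ?(ltW r0).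
rewrite vol_eball ?sqrtr_gt0// fineM//; first by rewrite mulrC.
by rewrite ge0_fin_numE ?vol_eball_fin.
Qed.

Lemma fin_num_vol (R : realType) (k : nat) (r : R) (E : set 'rV[R]_k) :
  0 <= r -> rmeasurable E -> E `<=` eball r -> vol E \is a fin_num.
Proof.
move=> r0 mE Er; rewrite ge0_fin_numE//.
exact: le_lt_trans (le_vol mE (rmeasurable_eball r) Er) (vol_eball_fin k r0).
Qed.

Lemma slice_sub_eball (R : realType) (d : nat) (xi : 'rV[R]_d.+1) (t r : R)
    (E : set 'rV[R]_d.+1) : sphere xi ->
  E `<=` eball r -> slice xi t E `<=` eball r.
Proof.
move=> xi1 Er y /Er; rewrite /eball /= dot_slice//; apply: le_trans.
by rewrite lerDr sqr_ge0.
Qed.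

Lemma rmeasurable_halfspace (R : realType) (k : nat) (E : set 'rV[R]_k)
    (v : 'rV[R]_k) (s : R) :
  rmeasurable E -> rmeasurable [set x | E x /\ dot x v <= s].
Proof.
move=> mE; apply: measurableI => //.
apply: (@rmeasurable_le R k (fun x => dot x v) (cst s));
  last exact: measurable_cst.
apply: measurable_dot => i; first exact: measurable_rv_coord.
exact: measurable_cst.
Qed.

(** By [vol_slices] the half-space volume is the integral of the section function over []-oo, s]],
    so this is the fundamental theorem of calculus at a point of continuity. *)
Lemma is_derive_halfspace_volume (R : realType) (d : nat)
    (E : set 'rV[R]_d.+1) (xi : 'rV[R]_d.+1) (r s : R) :
  0 <= r -> sphere xi -> rmeasurable E -> E `<=` eball r ->
  {for s, continuous (section_volume E xi)} ->
  is_derive s 1 (halfspace_volume E xi) (section_volume E xi s).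
Proof.
move=> r0 xi1 mE Er cs.
have volE t : vol (slice xi t E) = (section_volume E xi t)%:E.
  rewrite /section_volume fineK//.
  apply: (fin_num_vol r0 (rmeasurable_slice _ _ mE)).
  exact: slice_sub_eball.
have cumE t : vol [set x | E x /\ dot x xi <= t] =
    (\int[lebesgue_measure]_(u in `]-oo, t]) (section_volume E xi u)%:E)%E.
  under eq_integral => u _ do rewrite -volE.
  rewrite -vol_slices//.
have fin t : vol [set x | E x /\ dot x xi <= t] \is a fin_num.
  apply: (fin_num_vol r0 (rmeasurable_halfspace _ _ mE)).
  by move=> x [/Er].
have mf : measurable_fun setT (section_volume E xi).
  apply/measurable_EFinP; apply: eq_measurable_fun (measurable_vol_slice xi mE).
  by move=> t _ /=.
(* Integrability is taken up to [s + 1] to make [s] an interior point. *)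
have intf : lebesgue_measure.-integrable `]-oo,
  (s + 1)] (EFin \o section_volume E xi).
  apply/integrableP; split.
    by apply/measurable_EFinP; exact: measurable_funTS.
  under eq_integral => u _ do rewrite /= ger0_norm ?fine_ge0//.
  by rewrite -cumE -ge0_fin_numE// cumE; apply: integral_ge0 => u _;
    rewrite lee_fin fine_ge0.
have := @continuous_FTC1 R (section_volume E xi) -oo%O s (s + 1).
rewrite ltrDl ltr01 => /(_ isT intf) FTC.
have [dF F'] := FTC (ltNyr _) cs.
move: dF F'; set F := (X in derivable X _ _).
have HF : halfspace_volume E xi = F.
  by apply/funext => t; rewrite /halfspace_volume cumE.
by move=> dF F'; apply: DeriveDef; rewrite HF// -derive1E.
Qed.

Lemma halfspace_volumeZ (R : realType) (k : nat) (E : set 'rV[R]_k)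
    (v : 'rV[R]_k) (c s : R) : 0 < c ->
  halfspace_volume E (c *: v) s = halfspace_volume E v (s / c).
Proof.
move=> c0; congr (fine (vol _)); apply/seteqP; split => x /=;
by rewrite dotZr ler_pdivlMr// mulrC.
Qed.

Lemma section_functionE (R : realType) (d : nat) (K : set 'rV[R]_d.+1)
    (xi : 'rV[R]_d.+1) :
  sphere xi -> section_function K xi = section_volume K xi.
Proof.
move=> xi1; apply/funext => t.
rewrite /section_function /section_volume /hyperplane_volume /vol lebE.
congr (fine (lebesgue_tuple _)); apply/seteqP; split => y /=.
  by case.
move=> Ky; split => //=.
by rewrite dotDl dot_frame// addr0 dotZl (sphere_dot xi).1// mulr1.
Qed.

(** * Volume in polar coordinates *)

Lemma measurable_inv (R : realType) : measurable_fun setT (@GRing.inv R).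
Proof.
have -> : [set: R] = [set x | x != 0] `|` [set 0].
  apply/seteqP; split => // x _.
  by have [->|x0] := eqVneq x 0; [right|left].
have oD : open [set x : R | x != 0].
  rewrite (_ : [set _ | _] = ~` [set 0]); first by rewrite openC;
    exact: closed_eq.
  by apply/seteqP; split => x /= /eqP.
apply/measurable_funU => //; first exact: open_measurable.
split; last exact: measurable_fun_set1.
apply: open_continuous_measurable_fun => // x; rewrite inE /= => x0.
exact: inv_continuous.
Qed.

Definition enorm (R : realType) (k : nat) (x : 'rV[R]_k) : R :=
  Num.sqrt (dot x x).

Lemma enorm_ge0 (R : realType) (k : nat) (x : 'rV[R]_k) : 0 <= enorm x.
Proof. exact: sqrtr_ge0. Qed.

Lemma enormZ (R : realType) (k : nat) (a : R) (x : 'rV[R]_k) :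
  enorm (a *: x) = `|a| * enorm x.
Proof. by rewrite /enorm dotZl dotZr mulrA -expr2 sqrtrM ?sqr_ge0// sqrtr_sqr.
  Qed.

Lemma dot_eq0 (R : realType) (k : nat) (x : 'rV[R]_k) : (dot x x == 0) = (x ==
  0).
Proof.
apply/eqP/eqP => [x0|->]; last by rewrite /dot big1// => i _; rewrite mxE mul0r.
apply/rowP => i; rewrite [RHS]mxE; apply/eqP;
  rewrite -sqrf_eq0 eq_le sqr_ge0 andbT.
by rewrite -x0 sqr_coord_le_dot.
Qed.

Lemma enorm_eq0 (R : realType) (k : nat) (x : 'rV[R]_k) : (enorm x == 0) = (x ==
  0).
Proof. by rewrite /enorm sqrtr_eq0 -dot_eq0 eq_le dot_ge0 andbT. Qed.

Lemma measurable_enorm (R : realType) (k : nat) :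
  measurable_fun setT (fun y : tup R k => enorm (rv y)).
Proof.
apply: (measurableT_comp (f := @Num.sqrt R)).
  by apply: continuous_measurable_fun; exact: sqrt_continuous.
by apply: measurable_dot => i; exact: measurable_rv_coord.
Qed.

Lemma integral_leb_scale (R : realType) (k : nat) (s : R) (f : tup R k -> \bar
  R) :
  0 < s -> measurable_fun setT f -> (forall y, 0 <= f y)%E ->
  (\int[leb R k]_y f y =
   (s ^+ k)%:E * \int[leb R k]_z f (tv (s *: rv z)%R))%E.
Proof.
move=> s0 mf f0.
have sk0 : 0 <= s ^+ k by rewrite exprn_ge0// ltW.
pose phi (z : tup R k) : tup R k := tv (s *: rv z).
have mphi : measurable_fun setT phi.
  apply: measurable_tv; apply: measurable_coordZ => // i.
  exact: measurable_rv_coord.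
pose nu : {measure set _ -> \bar R} :=
  measure_function_pushforward__canonical__measure_function_Measure (leb R k)
    mphi.
rewrite (@eq_measure_integral _ _ _ _ (mscale (NngNum sk0) nu)); last first.
  move=> A mA _; apply: (etrans (esym (leb_affine 0 s0 mA))).
  congr (_ * leb _ _ _)%E.
  by apply/seteqP; split => x /=; rewrite addr0.
rewrite ge0_integral_mscale//; congr (_ * _)%E.
by rewrite ge0_integral_pushforward// preimage_setT.
Qed.

Lemma integral_exprn (R : realType) (k : nat) (u : R) : 0 <= u ->
  (\int[lebesgue_measure]_(s in `]0%R,
    u]) (s ^+ k)%:E = (u ^+ k.+1 / k.+1%:R)%:E)%E.
Proof.
rewrite le_eqVlt => /orP[/eqP <-|u0].
  by rewrite set_itvoc0 integral_set0 expr0n mul0r.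
pose F (s : R) := s ^+ k.+1 / k.+1%:R.
have cX n : continuous (fun s : R => s ^+ n) by exact: exprn_continuous.
have cF : continuous F by move=> s; apply: cvgM; [exact: cX|exact: cvg_cst].
have dF (s : R) : is_derive s 1 F (s ^+ k).
  rewrite /F (_ : (fun s => _) = fun s => k.+1%:R^-1 * s ^+ k.+1).
    apply: (is_derive_eq (is_derive_funZ _ (is_derive_funX k.+1 (is_derive_id s
      1)))).
    by rewrite mulr1 mulrA mulVf ?mul1r.
  by apply/funext => y; rewrite mulrC.
rewrite (integral_itv_obnd_cbnd (f := fun s => (s ^+ k)%:E)); last first.
  by apply/measurable_EFinP; exact: measurable_funX.
rewrite (@continuous_FTC2 _ _ F)//.
- by rewrite /F expr0n mul0r sube0.
- by apply: continuous_subspaceT; exact: cX.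
- split.
  + by move=> s _; exact: ex_derive.
  + by apply: cvg_at_right_filter; exact: cF.
  + by apply: cvg_at_left_filter; exact: cF.
- by move=> s _; rewrite derive1E; exact: derive_val.
Qed.

(** The shell [1/2 <= |z| <= 1] replaces the unit sphere, so that no surface measure occurs. In
    [vol_polar] the weight [1 / |z|] is the right one: [u] is homogeneous of degree -1, which leaves
    the radial integral of [r^-2] from 1/2 to 1, that is, 1. *)
Definition shell (R : realType) (k : nat) : set 'rV[R]_k :=
  [set z | enorm z <= 1 <= 2 * enorm z].

Lemma rmeasurable_shell (R : realType) (k : nat) : rmeasurable (@shell R k).
Proof.
rewrite (_ : @shell R k = [set z | enorm z <= 1] `&` [set z | 1 <= 2 * enorm
  z]).
  apply: measurableI.
    apply: (@rmeasurable_le R k (@enorm R k) (cst 1));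
      first exact: measurable_enorm.
    exact: measurable_cst.
  apply: (@rmeasurable_le R k (cst 1) (fun z => 2 * enorm z)).
    exact: measurable_cst.
  by apply: measurable_funM; [exact: measurable_cst|exact: measurable_enorm].
by apply/seteqP; split => z; rewrite /shell /=; [move=> /andP|move=> [-> ->]].
Qed.

(* Double counting of [(y, s)] with [y \in E] and [enorm y <= s <= 2 * enorm y],
   each weighted by [1 / enorm y], followed by the substitution [y = s *: z]. *)
Lemma vol_polar (R : realType) (d : nat) (E : set 'rV[R]_d.+1)
    (u : 'rV[R]_d.+1 -> R) :
  rmeasurable E ->
  (forall z, shell z -> 0 <= u z) ->
  (forall z s, shell z -> 0 < s -> E (s *: z) <-> s <= u z) ->
  (vol E = \int[leb R d.+1]_(y in @rv R d.+1 @^-1` @shell R d.+1)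
    ((enorm (rv y))^-1 * (u (rv y) ^+ d.+1 / d.+1%:R))%:E)%E.
Proof.
move=> mE u0 Eu.
pose N (y : tup R d.+1) := enorm (rv y).
have mN : measurable_fun setT N by exact: measurable_enorm.
have mN1 : measurable_fun setT (fun p : tup R d.+1 * measurableTypeR R =>
  N p.1).
  exact: (measurableT_comp mN measurable_fst).
have mNV : measurable_fun setT (fun p : tup R d.+1 * measurableTypeR R =>
  (N p.1)^-1).
  exact: (measurableT_comp (@measurable_inv R) mN1).
have ms : measurable_fun setT (fun p : tup R d.+1 * measurableTypeR R =>
  p.2 : R).
  exact: measurable_snd.
pose S := [set p : tup R d.+1 * measurableTypeR R |
  [/\ E (rv p.1), N p.1 <= p.2 & p.2 <= 2 * N p.1]].
have mle (f g : tup R d.+1 * measurableTypeR R -> R) :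
    measurable_fun setT f -> measurable_fun setT g ->
    measurable [set p | f p <= g p].
  move=> mf mg; rewrite (_ : [set _ | _] = (fun p =>
    f p <= g p) @^-1` [set true])//.
  by apply: measurable_preimage => //; exact: measurable_fun_ler.
have mS : measurable S.
  rewrite (_ : S = [set p | E (rv p.1)] `&` ([set p | N p.1 <= p.2] `&`
      [set p | p.2 <= 2 * N p.1])); last first.
    by apply/seteqP; split => p; rewrite /S /=; [case|case=> ? []].
  apply: measurableI; last apply: measurableI.
  - apply: (measurable_preimage_rmeasurable
      (f := fun p : tup R d.+1 * measurableTypeR R => rv p.1)) => // i.
    exact: (measurableT_comp (measurable_rv_coord i) measurable_fst).
  - exact: mle.
  - by apply: mle => //; apply: measurable_funM.
(* [T] is what [S] becomes under [y = s *: z]: for [s > 0] the condition [|y| <= s <= 2 |y|] says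
   that [z] lies in the shell. *)
pose T := [set p : tup R d.+1 * measurableTypeR R |
  [/\ shell (rv p.1), 0 < (p.2 : R) & E ((p.2 : R) *: rv p.1)]].
have mT : measurable T.
  rewrite (_ : T = [set p | shell (rv p.1)] `&` (~` [set p | p.2 <= 0] `&`
      [set p | E (p.2 *: rv p.1)])); last first.
    apply/seteqP; split => p; rewrite /T /=.
      by case=> ? ? ?; split => //; split => //; apply/negP; rewrite -ltNge.
    by case=> ? [/negP]; rewrite -ltNge.
  apply: measurableI; last apply: measurableI.
  - apply: (measurable_preimage_rmeasurable
      (f := fun p : tup R d.+1 * measurableTypeR R => rv p.1)) => //.
      by move=> i; exact: (measurableT_comp (measurable_rv_coord i)
        measurable_fst).
    exact: rmeasurable_shell.
  - by apply: measurableC; apply: mle.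
  - apply: (measurable_preimage_rmeasurable
      (f := fun p : tup R d.+1 * measurableTypeR R =>
        (p.2 : R) *: rv p.1)) => //.
    apply: measurable_coordZ => // i.
    exact: (measurableT_comp (measurable_rv_coord i) measurable_fst).
pose f (p : tup R d.+1 * measurableTypeR R) : R := (N p.1)^-1 * \1_S p.
(* The Jacobian [s ^+ d.+1] times the weight [1 / (s |z|)] leaves [s ^+ d / |z|]. *)
pose h (p : tup R d.+1 * measurableTypeR R) : R :=
  (N p.1)^-1 * ((p.2 : R) ^+ d * \1_T p).
have f0 p : 0 <= f p by rewrite mulr_ge0// invr_ge0 enorm_ge0.
have h0 p : 0 <= h p.
  rewrite mulr_ge0// ?invr_ge0 ?enorm_ge0// indicE.
  case: (boolP (p \in T)) => [/set_mem[_ p0 _]|_]; last by rewrite mulr0.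
  by rewrite mulr1 exprn_ge0// ltW.
have mf : measurable_fun setT f.
  by apply: measurable_funM => //; exact: measurable_indic.
have mh : measurable_fun setT h.
  apply: measurable_funM => //; apply: measurable_funM;
    last exact: measurable_indic.
  exact: measurable_funX.
have E0 : [set 0] = [set x : 'rV[R]_d.+1 | forall i, 0 <= x ord0 i <= 0].
  apply/seteqP; split => x /=; first by move=> -> i; rewrite mxE lexx.
  by move=> x0; apply/rowP => i; rewrite mxE; apply/eqP; rewrite eq_le andbC.
have m0 : rmeasurable [set (0 : 'rV[R]_d.+1)] by rewrite E0;
  exact: rmeasurable_box.
have S1 : (\int[leb R d.+1]_y \int[lebesgue_measure]_s (f (y, s))%:E = vol E)%E.
  (* At the origin the weight is [0^-1 = 0], so the double integral misses this point, which is a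
     null set. *)
  have -> : vol E = vol (E `\ 0).
    have v0 : vol [set (0 : 'rV[R]_d.+1)] = 0%E.
      by rewrite E0 (@vol_box R d.+1 (fun=> 0) (fun=> 0))//
        big_ord_recl subrr mul0r.
    apply/eqP; rewrite eq_le; apply/andP; split; last first.
      by apply: le_vol => //; exact: measurableD.
    have mE0 : rmeasurable (E `\ 0) by exact: measurableD.
    apply: (@le_trans _ _ (vol (E `\ 0 `|` [set 0]))).
      apply: le_vol => //; first exact: measurableU.
      by move=> x Ex; have [->|/eqP x0] := eqVneq x 0; [right|left].
    rewrite -[leRHS]adde0 -[X in (_ + X)%E]v0.
    exact: (measureU2 (leb R d.+1)).
  transitivity (\int[leb R d.+1]_y (\1_(@rv R d.+1 @^-1` (E `\ 0)) y)%:E)%E.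
    apply: eq_integral => y _; rewrite /f /=.
    under eq_integral do rewrite EFinM.
    have mSy : measurable [set s : measurableTypeR R | S (y, s)].
      by apply: (measurable_preimage _ mS); exact: measurable_fun_pair.
    rewrite ge0_integralZl//=; last 2 first.
    - by apply/measurable_EFinP; apply: measurableT_comp => //.
    - by rewrite lee_fin invr_ge0 enorm_ge0.
    rewrite (_ : (fun s => _) = fun s =>
      (\1_[set s : measurableTypeR R | S (y, s)] s)%:E); last first.
      by apply/funext => s; rewrite !indicE; congr (_%:R%:E); apply/idP/idP;
        rewrite !inE.
    rewrite integral_indic// setIT indicE.
    have [y0|y0] := eqVneq (rv y) 0.
      rewrite /N y0 (eqP (_ : enorm 0 == 0)) ?enorm_eq0// invr0 mul0e.
      by rewrite memNset//= => -[_] /(_ y0).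
    have Ny : 0 < N y by rewrite lt_neqAle eq_sym enorm_eq0 y0 enorm_ge0.
    have [Ey|nEy] := pselect (E (rv y)); last first.
      rewrite (_ : [set s | _] = set0) ?measure0 ?mule0 ?memNset//.
        by case.
      by apply/seteqP; split => // s [].
    rewrite mem_set; last by split => //; apply/eqP.
    (* The admissible [s] fill the interval from [N y] to [2 * N y], whose length cancels the
       weight. *)
    rewrite [X in (_ * X)%E](_ : _ = (N y)%:E);
      first by rewrite -EFinM mulVf// gt_eqF.
    transitivity (@lebesgue_measure R `[N y, 2 * N y]%classic).
      congr (lebesgue_measure _); apply/seteqP; split => s;
        rewrite /S /= in_itv/=.
        by case=> _ -> ->.
      by move=> /andP[].
    rewrite lebesgue_measure_itv/= lte_fin ltr_pMl// ltr1n -EFinB.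
    by rewrite mulr_natl mulr2n addrK.
  rewrite integral_indic// ?setIT//.
  exact: (measurableD mE m0).
have S2 : (\int[lebesgue_measure]_s \int[leb R d.+1]_y (f (y, s))%:E =
           \int[lebesgue_measure]_s \int[leb R d.+1]_y (h (y, s))%:E)%E.
  apply: eq_integral => s _; have [s0|s0] := ltP 0 s; last first.
    apply: eq_integral => y _; rewrite /f /h /= [X in (_ * (_ * X))%R]indicE.
    rewrite memNset ?mulr0; last by rewrite /T /= => -[_ /lt_geF]; rewrite s0.
    rewrite indicE; case: (boolP (_ \in _)); last by rewrite mulr0.
    move=> /set_mem[/= _ Ns _].
    have -> : N y = 0 by apply/eqP; rewrite eq_le enorm_ge0 (le_trans Ns).
    by rewrite invr0 mul0r.
  rewrite (integral_leb_scale s0); last 2 first.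
  - apply/measurable_EFinP; apply: (measurableT_comp mf).
    by apply: measurable_fun_pair => //; exact: measurable_cst.
  - by move=> y; rewrite lee_fin.
  rewrite -ge0_integralZl//; last 3 first.
  - apply/measurable_EFinP; apply: (measurableT_comp mf).
    apply: measurable_fun_pair; last exact: measurable_cst.
    apply: measurable_tv; apply: measurable_coordZ => // i.
    exact: measurable_rv_coord.
  - by move=> y _; rewrite lee_fin.
  - by rewrite lee_fin exprn_ge0// ltW.
  apply: eq_integral => z _; rewrite /f /h /= -EFinM; congr EFin.
  rewrite /N tvK enormZ gtr0_norm// invfM exprS.
  rewrite (_ : \1_S (tv (s *: rv z), s) = \1_T (z, s)).
    by move: (enorm _)^-1 => Ni; field; rewrite gt_eqF.
  rewrite !indicE; congr ((nat_of_bool _)%:R); apply/idP/idP;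
    rewrite !inE /S /T /= /N tvK enormZ gtr0_norm//.
    case=> Es; rewrite ger_pMr// mulrCA ler_pMr// => *; split => //.
    by apply/andP.
  by case=> /andP[? ?] _ Es; split; rewrite // ?ger_pMr// mulrCA ler_pMr.
have S3 : (\int[leb R d.+1]_y \int[lebesgue_measure]_s (h (y, s))%:E =
   \int[leb R d.+1]_(y in @rv R d.+1 @^-1` @shell R d.+1)
    ((enorm (rv y))^-1 * (u (rv y) ^+ d.+1 / d.+1%:R))%:E)%E.
  rewrite [RHS]integral_mkcond; apply: eq_integral => y _; rewrite patchE.
  case: ifPn => [/set_mem yQ|/negP yQ]; last first.
    rewrite integral0_eq// => s _; rewrite /h indicE memNset ?mulr0// =>
      -[/= /mem_set].
    by move/yQ.
  under eq_integral do rewrite /h /= EFinM.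
  rewrite ge0_integralZl//=; last 3 first.
  - apply/measurable_EFinP; apply: measurable_funM;
    first exact: measurable_funX.
    by apply: measurableT_comp => //.
  - move=> s _; rewrite lee_fin indicE.
    case: (boolP (_ \in T)) => [/set_mem[_ /= p0 _]|_]; last by rewrite mulr0.
    by rewrite mulr1 exprn_ge0// ltW.
  - by rewrite lee_fin invr_ge0 enorm_ge0.
  rewrite EFinM; congr (_ * _)%E.
  rewrite -integral_exprn ?u0// [RHS]integral_mkcond; apply: eq_integral => s _.
  rewrite patchE indicE; case: ifPn => [/set_mem|/negP su].
    rewrite /= in_itv/= => /andP[s0 su].
    by rewrite mem_set ?mulr1//; split => //; apply/Eu.
  rewrite memNset ?mulr0// => -[/= _ s0 /(Eu _ _ yQ s0) su'].
  by apply/su/mem_set; rewrite /= in_itv/= s0.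
rewrite -S1 (fubini_tonelli (EFin \o f))//; first last.
  by apply/measurable_EFinP.
by rewrite [LHS]S2 -(fubini_tonelli (EFin \o h))//; apply/measurable_EFinP.
Qed.

(** * Sections of smooth convex bodies *)

Definition segment_closed (R : realType) (n : nat) (K : set 'rV[R]_n) :=
  forall x y (a : R), K x -> K y -> 0 <= a <= 1 -> K (a *: x + (1 - a) *: y).

Lemma convex_segment_closed (R : realType) (n : nat) (K : set 'rV[R]_n) :
  convex_set K -> segment_closed K.
Proof.
move=> cK x y a Kx Ky a01.
have a01' : Itv.spec (@Itv.num_sem R) (Itv.Real `[0%Z, 1%Z]) a.
  by rewrite /Itv.spec/= /Itv.num_sem num_real/= in_itv/= a01.
pose l : {i01 R} := Itv.mk a01'.
by have /set_mem := cK x y l (mem_set Kx) (mem_set Ky).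
Qed.

Lemma closed_compact_rV (R : realType) (n : nat) (K : set 'rV[R]_n) :
  compact K -> closed K.
Proof. by apply: compact_closed; exact: norm_hausdorff. Qed.

Lemma compact_sub_eball (R : realType) (n : nat) (K : set 'rV[R]_n) :
  compact K -> exists2 r, 0 < r & K `<=` eball r.
Proof.
move=> /compact_bounded[M [_ KM]].
pose B := Num.max 1 (M + 1).
have B1 : 1 <= B by rewrite le_max lexx.
have n1 : 1 <= n.+1%:R :> R by rewrite ler1n.
exists (n.+1%:R * B); first by rewrite mulr_gt0 ?ltr0n// (lt_le_trans ltr01).
move=> x Kx; rewrite /eball /=.
have xB : `|x| <= B by apply: KM => //; rewrite lt_max ltrDl ltr01 orbT.
have xi i : x ord0 i * x ord0 i <= B ^+ 2.
  rewrite -expr2 -(real_normK (num_real (x ord0 i))) ler_pXn2r ?nnegrE//;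
    last exact: le_trans ler01 B1.
  apply: le_trans xB; rewrite [leRHS]mx_normrE.
  by apply: le_trans (le_bigmax _ _ (ord0, i)).
apply: le_trans (ler_sum _ (fun i _ => xi i)) _.
rewrite sumr_const card_ord -[_ *+ n]mulr_natl exprMn ler_wpM2r ?sqr_ge0//.
rewrite expr2 (le_trans (_ : _ <= n.+1%:R))// ?ler_nat//.
by rewrite ler_peMl.
Qed.

Lemma interior_sup_eball (R : realType) (n : nat) (K : set 'rV[R]_n) :
  K° 0 -> exists2 r, 0 < r & eball r `<=` K.
Proof.
move=> /nbhs_ballP[e /= e0 eK]; exists (e / 2); first by rewrite divr_gt0.
move=> x xe; apply: eK; split => // i j; rewrite ord1 /ball /= mxE sub0r normrN.
have e2 : e / 2 < e by lra.
apply: le_lt_trans e2; rewrite -(@ler_pXn2r R 2)//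
  ?nnegrE ?divr_ge0 ?(ltW e0)//.
by rewrite real_normK ?num_real// (le_trans (sqr_coord_le_dot x j)).
Qed.

Section minkowski.
Context {R : realType} {n : nat}.
Variables (K : set 'rV[R]_n) (r : R).
Hypothesis r_gt0 : 0 < r.
Hypothesis rK : eball r `<=` K.
(* Unqualified, [minkowski] is the inequality of [hoelder.v]. *)
Let p := Defs.minkowski K.

Lemma eball0 (s : R) : eball s (0 : 'rV[R]_n).
Proof. by rewrite /eball /= /dot big1 ?sqr_ge0// => i _; rewrite mxE mul0r. Qed.

Let S x := [set a | 0 <= a /\ exists2 y, K y & x = a *: y].

Lemma has_lbound_minkowski x : has_lbound (S x).
Proof. by exists 0 => a []. Qed.

Lemma sqr_enorm (x : 'rV[R]_n) : enorm x ^+ 2 = dot x x.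
Proof. by rewrite sqr_sqrtr// dot_ge0. Qed.

Lemma eballE (s : R) (x : 'rV[R]_n) : 0 <= s -> @eball R n s x = (enorm x <= s).
Proof.
by move=> s0; rewrite /eball /= -sqr_enorm ler_pXn2r ?nnegrE ?enorm_ge0.
Qed.

Lemma minkowski_nonempty x : S x (enorm x / r).
Proof.
split; first by rewrite divr_ge0 ?enorm_ge0// ltW.
have [x0|x0] := eqVneq x 0.
  by exists 0; [exact: rK (eball0 r)|rewrite scaler0 x0].
have ex : 0 < enorm x by rewrite lt_neqAle eq_sym enorm_eq0 x0 enorm_ge0.
exists ((r / enorm x) *: x).
  apply: rK; rewrite eballE ?(ltW r_gt0)//
    enormZ ger0_norm ?divr_ge0 ?enorm_ge0 ?(ltW r_gt0)//.
  by rewrite divfK ?enorm_eq0.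
by rewrite scalerA mulrA divfK ?gt_eqF// divff ?gt_eqF// scale1r.
Qed.

Lemma minkowski_le_enorm x : p x <= enorm x / r.
Proof. exact: (ge_inf (has_lbound_minkowski x) (minkowski_nonempty x)). Qed.

Lemma minkowski_le1 x : K x -> p x <= 1.
Proof.
move=> Kx; apply: (ge_inf (has_lbound_minkowski x)).
by split => //; exists x => //; rewrite scale1r.
Qed.

Lemma minkowski_lt x (c : R) : p x < c ->
  exists a y, [/\ 0 <= a, a < c, K y & x = a *: y].
Proof.
move=> /(inf_lt (ex_intro _ _ (minkowski_nonempty x)))[a [a0 [y Ky xE]] ac].
by exists a, y.
Qed.

Lemma minkowskiZ_le x (c : R) : 0 < c -> p (c *: x) <= c * p x.
Proof.
move=> c0; rewrite mulrC -ler_pdivrMr//; apply: lb_le_inf.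
  by exists (enorm x / r); exact: minkowski_nonempty.
move=> a [a0 [y Ky ->]]; rewrite ler_pdivrMr//.
apply: (ge_inf (has_lbound_minkowski _)); split; first by rewrite mulr_ge0//
  ltW.
by exists y => //; rewrite scalerA mulrC.
Qed.

Lemma minkowskiZ x (c : R) : 0 < c -> p (c *: x) = c * p x.
Proof.
move=> c0; apply/eqP; rewrite eq_le minkowskiZ_le//=.
have := @minkowskiZ_le (c *: x) c^-1; rewrite scalerA mulVf ?gt_eqF// scale1r.
by rewrite invr_gt0 ler_pdivlMl// => /(_ c0).
Qed.

End minkowski.

(** For small [t] the section at height [t] is star-shaped about [t *: xi]; this is its radial
    function from that point, in units of [w]. *)
Definition radial (R : realType) (n : nat) (K : set 'rV[R]_n)
    (xi w : 'rV[R]_n) (t : R) : R :=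
  sup [set s | 0 <= s /\ K (t *: xi + s *: w)].

(** These pairs include all [(xi, z *m frame xi)] with [z] in the shell. As [frame] is obtained by
    choice and nothing is known of its dependence on [xi], the estimates are made uniform over all
    such pairs. *)
Definition frames (R : realType) (n : nat) : set ('rV[R]_n * 'rV[R]_n) :=
  [set q | [/\ dot q.1 q.1 = 1, dot q.2 q.1 = 0, dot q.2 q.2 <= 1 &
    1 <= 4 * dot q.2 q.2]].

Section radial.
Context {R : realType} {n : nat}.
Variables (K : set 'rV[R]_n) (r Rb : R).
Hypothesis cvK : segment_closed K.
Hypothesis clK : closed K.
Hypothesis r_gt0 : 0 < r.
Hypothesis rK : eball r `<=` K.
Hypothesis Rb_gt0 : 0 < Rb.
Hypothesis KRb : K `<=` eball Rb.
Variables (xi w : 'rV[R]_n).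
Hypothesis fr : frames (xi, w).

Let xi1 : dot xi xi = 1. Proof. by case: fr. Qed.
Let wxi : dot w xi = 0. Proof. by case: fr. Qed.
Let w1 : dot w w <= 1. Proof. by case: fr. Qed.
Let w4 : 1 <= 4 * dot w w. Proof. by case: fr. Qed.

Let dotx (t s : R) :
  dot (t *: xi + s *: w) (t *: xi + s *: w) = t ^+ 2 + s ^+ 2 * dot w w.
Proof.
rewrite dotDl !dotDr !dotZl !dotZr xi1 wxi (dotC xi) wxi.
by rewrite !mulr0 addr0 add0r mulr1 mulrA -!expr2.
Qed.

Lemma axis_in (t : R) : `|t| <= r -> K (t *: xi).
Proof.
move=> tr; apply: rK; rewrite /eball /= dotZl dotZr xi1 mulr1 -expr2.
by rewrite -(real_normK (num_real t)) ler_pXn2r ?nnegrE// ltW.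
Qed.

Let S (t : R) := [set s | 0 <= s /\ K (t *: xi + s *: w)].

Lemma radial_bound_set t s : S t s -> s <= 2 * Rb.
Proof.
move=> [s0 /KRb]; rewrite /eball /= dotx => le1.
rewrite -(@ler_pXn2r R 2)// ?nnegrE ?mulr_ge0// ?(ltW Rb_gt0)//.
have := sqr_ge0 t; have := sqr_ge0 s; rewrite exprMn.
have : s ^+ 2 * 1 <= s ^+ 2 * (4 * dot w w) by rewrite ler_wpM2l ?sqr_ge0.
lra.
Qed.

Let ubS t : has_ubound (S t).
Proof. by exists (2 * Rb) => s /radial_bound_set. Qed.

Let S0 t : `|t| <= r -> S t 0.
Proof. by move=> tr; split => //; rewrite scale0r addr0; exact: axis_in. Qed.

Lemma radial_le t : `|t| <= r -> radial K xi w t <= 2 * Rb.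
Proof.
move=> tr; apply: ge_sup; first by exists 0; exact: S0.
by move=> s /radial_bound_set.
Qed.

Lemma radial_ge0 t : `|t| <= r -> 0 <= radial K xi w t.
Proof. by move=> tr; apply: ub_le_sup; [exact: ubS|exact: S0]. Qed.

Lemma radial_in t : `|t| <= r -> K (t *: xi + radial K xi w t *: w).
Proof.
move=> tr.
have clS : closed [set s : R | K (t *: xi + s *: w)].
  apply: (@closed_comp _ _ (fun s : R => t *: xi + s *: w)) => // s _.
  by apply: cvgD; [exact: cvg_cst|apply: cvgZr_tmp; exact: cvg_id].
apply: clS; apply: closureS (closure_sup _ (ubS t)); first by move=> s [].
by exists 0; exact: S0.
Qed.

(** For the converse, the point is a convex combination of the farthest point of the ray and of
    [t *: xi], which lies in [K] by [axis_in]. *)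
Lemma radialP t s : `|t| <= r -> 0 <= s ->
  K (t *: xi + s *: w) <-> s <= radial K xi w t.
Proof.
move=> tr s0; split => [Ks|su]; first by apply: ub_le_sup; [exact: ubS|].
have [u0|u0] := eqVneq (radial K xi w t) 0.
  have -> : s = radial K xi w t by apply/eqP; rewrite eq_le su u0 s0.
  exact: radial_in.
have up : 0 < radial K xi w t by rewrite lt_neqAle eq_sym u0 radial_ge0.
have l01 : 0 <= s / radial K xi w t <= 1.
  by rewrite divr_ge0 ?(ltW up)//= ler_pdivrMr// mul1r.
have := cvK (radial_in tr) (axis_in tr) l01.
rewrite scalerDr !scalerA divfK// addrAC -scalerDl.
by rewrite -mulrDl subrKC mul1r.
Qed.

Lemma radial_gt0 t : `|t| < r -> 0 < radial K xi w t.
Proof.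
move=> tr; apply: (@lt_le_trans _ _ (r - `|t|)); first by rewrite subr_gt0.
apply/radialP; rewrite ?ltW ?subr_gt0//; apply: rK.
rewrite /eball /= dotx -(real_normK (num_real t)).
have : (r - `|t|) ^+ 2 * dot w w <= (r - `|t|) ^+ 2 * 1 by rewrite ler_wpM2l
  ?sqr_ge0.
have : 0 <= `|t| * (r - `|t|) by rewrite mulr_ge0// subr_ge0 ltW.
by rewrite !expr2; nra.
Qed.

(** Suppose [x = a *: y] with [y] in [K] and [a < 1]. A point slightly beyond [x], corrected by a
    point of the axis, gives a point of [K] on the ray [t *: xi + s *: w] with [s > u], against the
    maximality of [u]. *)
Lemma minkowski_radial t : `|t| < r ->
  Defs.minkowski K (t *: xi + radial K xi w t *: w) = 1.
Proof.
move=> tr; have tr' := ltW tr; have up := radial_gt0 tr.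
set u := radial K xi w t; set x := _ + _.
have Kx : K x by exact: radial_in.
apply/eqP; rewrite eq_le minkowski_le1//=; rewrite leNgt; apply/negP.
move=> /(minkowski_lt r_gt0 rK)[a [y [a0 a1 Ky xE]]].
have [a00|an0] := eqVneq a 0.
  have : dot x x = 0 by apply/eqP; rewrite dot_eq0 xE a00 scale0r.
  rewrite dotx => d0; have := sqr_ge0 t; have : 0 < u ^+ 2 * dot w w.
    by rewrite mulr_gt0 ?exprn_gt0//; have := w4; lra.
  lra.
have ap : 0 < a by rewrite lt_neqAle eq_sym an0.
pose q := (r - `|t|) / 2; have q0 : 0 < q by rewrite divr_gt0// subr_gt0.
(* [l] is slightly above [a], so that [l *: y] lies slightly beyond [x]. *)
pose eta := Num.min ((1 - a) / 2) (a * (1 - a) / 2 * (q / (r + 1))).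
have [eta0 eta1 eta2] : [/\ 0 < eta, eta <= (1 - a) / 2 &
    eta <= a * (1 - a) / 2 * (q / (r + 1))].
  split; last 2 first.
  - by rewrite ge_min lexx.
  - by rewrite ge_min lexx orbT.
  rewrite lt_min divr_gt0 ?subr_gt0//= !mulr_gt0 ?subr_gt0 ?invr_gt0//.
  by rewrite addr_gt0.
pose l := a + eta; have l1 : l < 1 by rewrite /l; lra.
have l0 : 0 < l by rewrite addr_gt0.
(* Chosen so that [l *: y + (1 - l) *: (tau *: xi)] has coordinate [t] along [xi]. The two bounds in
   [eta] give [|tau| <= r], so that the axis point is in [K]. *)
pose tau := (t - l / a * t) / (1 - l).
have tauE : tau = - (t * eta / (a * (1 - l))).
  by rewrite /tau /l; field; rewrite an0 subr_eq0 gt_eqF.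
have taur : `|tau| <= r.
  rewrite tauE normrN !normrM (gtr0_norm eta0) normfV (@gtr0_norm _ (a * _));
    last first.
    by rewrite mulr_gt0// subr_gt0.
  rewrite ler_pdivrMr ?mulr_gt0 ?subr_gt0//.
  have h1 : (1 - a) / 2 <= 1 - l by rewrite /l; lra.
  have h2 : a * ((1 - a) / 2) <= a * (1 - l) by rewrite ler_pM2l.
  have h3 : q / (r + 1) <= 1.
    rewrite ler_pdivrMr ?addr_gt0// mul1r /q; have := normr_ge0 t; lra.
  have h4 : eta <= a * ((1 - a) / 2).
    apply: le_trans eta2 _; rewrite [leRHS]mulrA ler_piMr//.
    by rewrite !mulr_ge0 ?subr_ge0// ltW.
  by apply: ler_pM => //; [exact: ltW|exact: le_trans h2].
have := cvK Ky (axis_in taur) (_ : 0 <= l <= 1).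
rewrite (ltW l0) (ltW l1) => /(_ isT).
have -> : y = a^-1 *: x by rewrite xE scalerA mulVf// scale1r.
rewrite !scalerA /x scalerDr !scalerA addrAC -scalerDl.
have -> : l * a^-1 * t + (1 - l) * tau = t.
  by rewrite /tau mulrCA divff ?mulr1 ?subr_eq0 ?gt_eqF//; ring.
move=> /(radialP tr'); rewrite mulr_ge0 ?mulr_ge0 ?invr_ge0 ?(ltW up) ?(ltW l0)
  ?(ltW ap)//.
move=> /(_ isT); rewrite -/u; apply/negP; rewrite -ltNge.
rewrite ltr_pMl// ltr_pdivlMr// mul1r ltrDl//.
Qed.

(** The lower estimate comes from convexity, the upper one from closedness: a point outside [K]
    stays outside when its height varies a little. *)
Lemma radial_continuous t : `|t| < r -> {for t, continuous (radial K xi w)}.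
Proof.
move=> tr; have tr' := ltW tr; have up := radial_gt0 tr.
set u := radial K xi w t.
apply/cvgrPdist_le => e e0.
have nr : \forall t' \near t, `|t'| <= r.
  by apply: filterS (near_lt_norm tr) => ? /ltW.
have lower : \forall t' \near t, u - e <= radial K xi w t'.
  have [ue|ue] := leP u e.
    apply: filterS nr => t' t'r; rewrite (le_trans _ (radial_ge0 t'r))//.
    by rewrite subr_le0.
  (* The point of height [t'] is the combination, with weight [l], of the boundary point at height
     [t] and the axis point of height [(t' - l * t) / (1 - l)], which tends to [t]. *)
  pose l := (u - e) / u.
  have l0 : 0 <= l by rewrite divr_ge0 ?(ltW up)// subr_ge0 ltW.
  have l1 : l < 1 by rewrite ltr_pdivrMr// mul1r gtrBl.
  have cl : (fun t' : R => (t' - l * t) / (1 - l)) @ t --> t.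
    have tE : (t - l * t) / (1 - l) = t by field; rewrite subr_eq0 gt_eqF.
    suff : (fun t' : R => (t' - l * t) / (1 - l)) @ t --> (t - l * t) / (1 - l).
      by rewrite tE.
    apply: cvgM; last exact: cvg_cst.
    by apply: cvgB; [exact: cvg_id|exact: cvg_cst].
  have := cl _ (near_lt_norm tr); rewrite nbhs_simpl /= => nz.
  near=> t'; have t'r : `|t'| <= r by near: t'.
  apply/radialP; rewrite ?subr_ge0 ?(ltW ue)//.
  have zr : `|(t' - l * t) / (1 - l)| <= r by apply: ltW; near: t'.
  have l01 : 0 <= l <= 1 by rewrite l0 ltW.
  have := cvK (radial_in tr') (axis_in zr) l01.
  have -> : l *: (t *: xi + radial K xi w t *: w) +
      (1 - l) *: (((t' - l * t) / (1 - l)) *: xi) = t' *: xi + (u - e) *: w.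
    rewrite scalerDr !scalerA addrAC -scalerDl -/u; congr (_ *: _ + _ *: _).
      by rewrite mulrCA divff ?mulr1 ?subr_eq0 ?gt_eqF// subrKC.
    by rewrite divfK// gt_eqF.
  by [].
have upper : \forall t' \near t, radial K xi w t' <= u + e.
  have nK : (~` K) (t *: xi + (u + e) *: w).
    move=> /(radialP tr'); rewrite addr_ge0 ?(ltW up) ?(ltW e0)// => /(_ isT).
    by rewrite -/u leNgt ltrDl e0.
  have oK : open (~` K) by rewrite openC.
  have cx : (fun t' : R => t' *: xi + (u + e) *: w) @ t --> t *: xi + (u + e) *:
    w.
    by apply: cvgD; [apply: cvgZr_tmp; exact: cvg_id|exact: cvg_cst].
  have := cx _ (open_nbhs_nbhs (conj oK nK)); rewrite nbhs_simpl /= => nz.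
  near=> t'; have t'r : `|t'| <= r by near: t'.
  have zK : ~ K (t' *: xi + (u + e) *: w) by near: t'.
  rewrite leNgt; apply/negP => ut; apply: zK; apply/radialP => //;
    last exact: ltW.
  by rewrite addr_ge0// ltW.
near=> t'; rewrite distrC ler_distl; apply/andP; split; near: t';
  [exact: lower|exact: upper].
Unshelve. all: by end_near. Qed.

End radial.

Lemma dot_continuous (R : realType) (n : nat) : continuous (fun x : 'rV[R]_n =>
  dot x x).
Proof.
move=> x; apply: (@cvg_sum_seq _ _ _ (nbhs x)) => i.
by apply: (cvgM (F := nbhs x)); exact: coord_continuous.
Qed.

Lemma normr_coord_le1 (R : realType) (n : nat) (x : 'rV[R]_n) (i : 'I_n) :
  dot x x <= 1 -> `|x ord0 i| <= 1.
Proof.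
move=> x1; rewrite -(@ler_pXn2r R 2)// ?nnegrE// expr1n real_normK ?num_real//.
exact: le_trans (sqr_coord_le_dot x i) x1.
Qed.

(** * Smooth dependence of the radial function on the height *)

Section smooth_radial.
Context {R : realType} {n : nat}.
Variables (K : set 'rV[R]_n) (r Rb : R).
Hypothesis cptK : compact K.
Hypothesis cvK : segment_closed K.
Hypothesis r_gt0 : 0 < r.
Hypothesis rK : eball r `<=` K.
Hypothesis Rb_gt0 : 0 < Rb.
Hypothesis KRb : K `<=` eball Rb.
Hypothesis smK : infinitely_smooth K.

Let p := Defs.minkowski K.
Let D (s : seq 'I_n) := foldr (@partial R n) p s.
Let U : set 'rV[R]_n := [set x | x != 0].
Let clK : closed K. Proof. exact: closed_compact_rV. Qed.

Let oU : open U.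
Proof.
rewrite (_ : U = ~` [set 0]); last by apply/seteqP; split => x /= /eqP.
by rewrite openC; apply: closed_compact_rV; exact: compact_set1.
Qed.

Let dD s x i : U x -> derivable (D s) x (delta_mx ord0 i).
Proof. by move=> Ux; exact: (smK s Ux).2. Qed.

Let cD s x i : U x -> {for x, continuous (partial i (D s))}.
Proof. by move=> Ux; exact: (smK (i :: s) Ux).1. Qed.

(** A compact set that avoids the origin and contains all boundary points [X q t]; the iterated
    partial derivatives of [p] are continuous, hence bounded, on it. *)
Let Bd := K `&` [set x | r ^+ 2 <= dot x x].

Let BdU x : Bd x -> U x.
Proof.
move=> [_ /= rx]; apply/eqP => x0; move: rx.
have -> : dot x x = 0 by apply/eqP; rewrite dot_eq0 x0.
by rewrite leNgt exprn_gt0.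
Qed.

Let compact_Bd : compact Bd.
Proof.
apply: compact_closedI => //.
apply: (@closed_comp _ _ (fun x : 'rV[R]_n => dot x x) [set y | r ^+ 2 <= y]).
  by move=> x _; exact: dot_continuous.
exact: closed_ge.
Qed.

Let D_bounded s : exists M : R, forall x, Bd x -> `|D s x| <= M.
Proof.
have cDs : {within Bd, continuous (D s)}.
  apply: continuous_in_subspaceT => x /set_mem /BdU Ux.
  exact: (smK s Ux).1.
have /compact_bounded[M [_ HM]] := continuous_compact cDs compact_Bd.
exists (M + 1) => x Bx; apply: HM; first by rewrite ltrDl.
by exists x.
Qed.

Let X (q : 'rV[R]_n * 'rV[R]_n) (t : R) := t *: q.1 + radial K q.1 q.2 t *: q.2.

Let pX q t : frames q -> `|t| < r -> p (X q t) = 1.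
Proof. by case: q => xi w fq tr;
  exact: (minkowski_radial cvK clK r_gt0 rK Rb_gt0 KRb fq). Qed.

Let XBd q t : frames q -> `|t| < r -> Bd (X q t).
Proof.
move=> fq tr; split.
  by case: q fq => xi w fq; apply: (radial_in clK r_gt0 rK Rb_gt0 KRb fq);
    exact: ltW.
rewrite /= -sqr_enorm ler_pXn2r ?nnegrE ?enorm_ge0 ?(ltW r_gt0)//.
have := minkowski_le_enorm r_gt0 rK (X q t).
by rewrite -/p pX// ler_pdivlMr// mul1r.
Qed.

Let D_line s x v : U x -> line_derive (D s) x v (grad (D s) x v).
Proof. exact: (line_derive_grad oU (@dD s) (@cD s)). Qed.

(** Differentiate [p ((1 + h) x) = (1 + h) p x] at [h = 0]. *)
Let euler x : U x -> grad p x x = p x.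
Proof.
move=> Ux; have := D_line [::] x Ux; rewrite /line_derive => d1.
have d2 : is_derive (0 : R) 1 (fun h : R => p (x + h *: x)) (p x).
  apply: (@is_derive_near _ (fun h => (1 + h) * p x)).
    have : \forall h \near (0 : R), `|h| < 1 by apply: near_lt_norm;
      rewrite normr0.
    apply: filterS => h; rewrite ltr_norml => /andP[h1 _].
    rewrite -[X in p (X + _)]scale1r -scalerDl /p (minkowskiZ r_gt0 rK)//.
    by rewrite -ltrBlDl sub0r.
  have dh := is_derive_funD (is_derive_cst (1 : R) (0 : R) 1) (is_derive_id (0 :
    R) 1).
  apply: (is_derive_eq (is_derive_funM dh (is_derive_cst (p x) (0 : R) 1))).
  by rewrite add0r mul1r mulr0 addr0.
by rewrite -(@derive_val _ _ _ _ _ _ _ d1) (@derive_val _ _ _ _ _ _ _ d2).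
Qed.

Let grad_bounded : exists2 C : R, 0 < C &
  forall x v, Bd x -> dot v v <= 1 -> `|grad p x v| <= C.
Proof.
have [M HM] := choice (fun i => D_bounded [:: i]).
exists (\sum_i `|M i| + 1); first by rewrite ltr_wpDl// sumr_ge0.
move=> x v Bx v1; rewrite ler_wpDr//.
apply: le_trans (ler_norm_sum _ _ _) _; apply: ler_sum => i _.
rewrite normrM -[leRHS]mul1r ler_pM// ?normr_coord_le1//.
by apply: le_trans (ler_norm _); exact: HM.
Qed.

Let radial_cont q (t : R) : frames q -> `|t| < r -> {for t,
  continuous (radial K q.1 q.2)}.
Proof.
by case: q => xi w fq; exact: (radial_continuous cvK clK r_gt0 rK Rb_gt0 KRb
  fq).
Qed.

Lemma bounded_derivs_radial : exists2 dl, 0 < dl <= r & forall k,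
  bounded_derivs (@frames R n) dl k (fun q t => radial K q.1 q.2 t).
Proof.
have [C C0 HC] := grad_bounded.
(* By Euler's identity [1 = t * grad p xi + u * grad p w] at the boundary point. For
   [|t| <= 1 / (2 C)] the first term is at most 1/2, and [u <= 2 * Rb] then gives
   [grad p w >= 1 / (4 * Rb)]. *)
pose dl := Num.min r (2 * C)^-1.
have dl0 : 0 < dl by rewrite lt_min r_gt0 invr_gt0 mulr_gt0.
have dlr : dl <= r by rewrite ge_min lexx.
have dlC : dl <= (2 * C)^-1 by rewrite ge_min lexx orbT.
exists dl; first by rewrite dl0.
have ltr (t : R) : `|t| < dl -> `|t| < r by move=> /lt_le_trans; exact.
have XB q t : frames q -> `|t| < dl -> Bd (X q t) by move=> fq /ltr; exact: XBd.
have gradw q (t : R) : frames q -> `|t| < dl -> (4 * Rb)^-1 <= grad p (X q t)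
  q.2.
  move=> fq tdl; have Bx := XB q t fq tdl.
  have := euler (BdU Bx); rewrite (pX fq (ltr t tdl)) {2}/X gradD !gradZ => E.
  have u0 : 0 < radial K q.1 q.2 t.
    by case: (q) fq => xi w fq;
      apply: (radial_gt0 cvK clK r_gt0 rK Rb_gt0 KRb fq); exact: ltr.
  have u2 : radial K q.1 q.2 t <= 2 * Rb.
    by case: (q) fq => xi w fq; apply: (radial_le r_gt0 rK Rb_gt0 KRb fq);
      apply: ltW; exact: ltr.
  have tg : t * grad p (X q t) q.1 <= 2^-1.
    apply: le_trans (ler_norm _) _; rewrite normrM.
    have q1 : dot q.1 q.1 <= 1 by case: fq => ->.
    have h1 := HC _ _ Bx q1.
    have -> : 2^-1 = (2 * C)^-1 * C :> R by field; rewrite gt_eqF.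
    by apply: ler_pM => //; apply: ltW; exact: lt_le_trans dlC.
  have ug : 2^-1 <= radial K q.1 q.2 t * grad p (X q t) q.2 by lra.
  have g0 : 0 < grad p (X q t) q.2.
    by rewrite -(pmulr_rgt0 _ u0); lra.
  rewrite -[leLHS]mul1r ler_pdivrMr ?mulr_gt0//.
  have : radial K q.1 q.2 t * grad p (X q t) q.2 <= 2 * Rb * grad p (X q t) q.2.
    by rewrite ler_pM2r.
  lra.
have gradw0 q (t : R) : frames q -> `|t| < dl -> grad p (X q t) q.2 != 0.
  move=> fq tdl; rewrite gt_eqF// (lt_le_trans _ (gradw q t fq tdl))//.
  by rewrite invr_gt0 mulr_gt0.
have du q (t : R) : frames q -> `|t| < dl -> is_derive t 1 (radial K q.1 q.2)
    (- grad p (X q t) q.1 * (grad p (X q t) q.2)^-1).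
  move=> fq tdl; apply: (@is_derive_implicit _ _ U p oU (@dD [::]) (@cD [::])).
  - exact: radial_cont fq (ltr t tdl).
  - exact: BdU (XB q t fq tdl).
  - apply: filterS (near_lt_norm tdl) => s sdl.
    by rewrite -!/(X q _) !pX//; exact: ltr.
  - exact: gradw0.
have dX s q (t : R) : frames q -> `|t| < dl -> is_derive t 1 (fun s' =>
  D s (X q s'))
    (grad (D s) (X q t) q.1 + (- grad p (X q t) q.1 * (grad p (X q t) q.2)^-1) *
      grad (D s) (X q t) q.2).
  move=> fq tdl; apply: (@is_derive_curve _ _ U (D s) oU (@dD s) (@cD s)).
  - exact: radial_cont fq (ltr t tdl).
  - exact: BdU (XB q t fq tdl).
  - exact: du.
have cst1 k i : bounded_derivs (@frames R n) dl k (fun q _ => q.1 ord0 i).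
  apply: (@bounded_derivs_cst _ _ _ _ _ _ 1) => q [q1 _ _ _].
  by apply: normr_coord_le1; rewrite q1.
have cst2 k i : bounded_derivs (@frames R n) dl k (fun q _ => q.2 ord0 i).
  by apply: (@bounded_derivs_cst _ _ _ _ _ _ 1) => q [_ _ q2 _];
    exact: normr_coord_le1.
(* The three families are treated together because the derivative of each is a polynomial in their
   members and the coordinates of [q]. The first needs all [s], as differentiating [D s] brings in
   [D (i :: s)]. *)
suff claim k : (forall s, bounded_derivs (@frames R n) dl k (fun q t =>
  D s (X q t))) /\
    bounded_derivs (@frames R n) dl k (fun q t => radial K q.1 q.2 t) /\
    bounded_derivs (@frames R n) dl k (fun q t => (grad p (X q t) q.2)^-1).
  by move=> k; have [_ []] := claim k.
have b1 s : exists M : R, forall q (t : R),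
  frames q -> `|t| < dl -> `|D s (X q t)| <= M.
  by have [M HM] := D_bounded s; exists M => q t fq tdl;
    exact: HM (XB q t fq tdl).
have b2 : exists M : R, forall q (t : R),
  frames q -> `|t| < dl -> `|radial K q.1 q.2 t| <= M.
  exists (2 * Rb) => -[xi w] t fq /ltr/ltW tr.
  rewrite ger0_norm; first exact: (radial_le r_gt0 rK Rb_gt0 KRb fq).
  exact: (radial_ge0 r_gt0 rK Rb_gt0 KRb fq).
have b3 : exists M : R, forall q (t : R), frames q -> `|t| < dl ->
    `|(grad p (X q t) q.2)^-1| <= M.
  exists (4 * Rb) => q t fq tdl; have h := gradw q t fq tdl.
  have h0 : 0 < (4 * Rb)^-1 by rewrite invr_gt0 mulr_gt0.
  rewrite ger0_norm ?invr_ge0 ?(le_trans (ltW h0))//.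
  by rewrite -[leRHS]invrK lef_pV2// posrE (lt_le_trans h0).
elim: k => [|k [IHD [IHu IHi]]]; first by split => [s|]; [split|split; split].
have bgrad1 s : bounded_derivs (@frames R n) dl k (fun q t =>
  grad (D s) (X q t) q.1).
  by apply: bounded_derivs_sum => i; apply: bounded_derivsM => //;
    exact: (IHD (i :: s)).
have bgrad2 s : bounded_derivs (@frames R n) dl k (fun q t =>
  grad (D s) (X q t) q.2).
  by apply: bounded_derivs_sum => i; apply: bounded_derivsM => //;
    exact: (IHD (i :: s)).
have bu' : bounded_derivs (@frames R n) dl k
    (fun q t => - grad p (X q t) q.1 * (grad p (X q t) q.2)^-1).
  by apply: bounded_derivsM => //; apply: bounded_derivsN; exact: (bgrad1 [::]).
have bD' s : bounded_derivs (@frames R n) dl k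
    (fun q t => grad (D s) (X q t) q.1 +
      (- grad p (X q t) q.1 * (grad p (X q t) q.2)^-1) * grad (D s) (X q t)
        q.2).
  by apply: bounded_derivsD => //; apply: bounded_derivsM.
split; [move=> s|split]; (split; first by [exact: b1|exact: b2|exact: b3]).
- by eexists; [exact: dX|exact: bD'].
- by eexists; [exact: du|exact: bu'].
pose G' (q : 'rV[R]_n * 'rV[R]_n) (t : R) : R :=
  \sum_i q.2 ord0 i * (grad (D [:: i]) (X q t) q.1 +
   (- grad p (X q t) q.1 * (grad p (X q t) q.2)^-1) * grad (D [:: i]) (X q t)
     q.2).
exists (fun q t => - (grad p (X q t) q.2)^-1 ^+ 2 * G' q t); last first.
  apply: bounded_derivsM.
    by apply: bounded_derivsN; exact: bounded_derivsX.
  by apply: bounded_derivs_sum => i; apply: bounded_derivsM.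
move=> q t fq tdl; apply: is_derive_funV; first exact: gradw0.
have H m (f : 'I_m -> R -> R) (f' : 'I_m -> R) :
    (forall i, is_derive t 1 (f i) (f' i)) ->
    is_derive t 1 (fun s => \sum_(i < m) f i s) (\sum_(i < m) f' i).
  elim: m f f' => [|m IH] f f' df.
    by rewrite big_ord0; under eq_fun do rewrite big_ord0; exact: is_derive_cst.
  rewrite big_ord_recl; under eq_fun do rewrite big_ord_recl.
  exact: is_derive_funD (df ord0) (IH _ _ (fun i => df (lift ord0 i))).
apply: H => i; apply: is_derive_funZ; exact: (dX [:: i] q t fq tdl).
Qed.

End smooth_radial.

Lemma frames_shell (R : realType) (d : nat) (xi : 'rV[R]_d.+1) (z : 'rV[R]_d) :
  sphere xi -> shell z -> frames (xi, z *m frame xi).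
Proof.
move=> xi1 /andP[z1 z2]; split => /=.
- exact/sphere_dot.
- exact: dot_frame.
- rewrite dot_orthogonal ?frame_orthogonal// -sqr_enorm.
  by rewrite -(expr1n _ 2) ler_pXn2r ?nnegrE ?enorm_ge0.
- rewrite dot_orthogonal ?frame_orthogonal// -sqr_enorm.
  have -> : 4 * enorm z ^+ 2 = (2 * enorm z) ^+ 2 by rewrite exprMn -natrX.
  by rewrite -[leLHS](expr1n _ 2) ler_pXn2r ?nnegrE ?mulr_ge0 ?enorm_ge0.
Qed.

Section smooth_sections.
Context {R : realType} {d : nat}.
Variables (K : set 'rV[R]_d.+2) (r Rb : R).
Hypothesis cptK : compact K.
Hypothesis cvK : segment_closed K.
Hypothesis r_gt0 : 0 < r.
Hypothesis rK : eball r `<=` K.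
Hypothesis Rb_gt0 : 0 < Rb.
Hypothesis KRb : K `<=` eball Rb.
Hypothesis smK : infinitely_smooth K.

Let clK : closed K. Proof. exact: closed_compact_rV. Qed.
Let mK : rmeasurable K. Proof. exact: closed_rmeasurable. Qed.
Let B := @rv R d.+1 @^-1` @shell R d.+1.
Let mB : measurable B. Proof. exact: rmeasurable_shell. Qed.

Let integrand (q : 'rV[R]_d.+2 * tup R d.+1) (t : R) : R :=
  (enorm (rv q.2))^-1 * (radial K q.1 (rv q.2 *m frame q.1) t ^+ d.+1 /
    d.+1%:R).

(** By [radialP], the radial function is at least [c > 0] exactly when [t *: xi + c *: w] is in [K],
    so measurability in the direction follows from that of [K]. *)
Let measurable_integrand xi (t : R) : sphere xi -> `|t| <= r ->
  measurable_fun B (fun y => integrand (xi, y) t).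
Proof.
move=> xi1 tr; apply: measurable_funM.
  apply: measurable_funTS; apply: (measurableT_comp (@measurable_inv R)).
  exact: measurable_enorm.
apply: measurable_funM; last exact: measurable_cst.
apply: measurable_funX.
have fr y : B y -> frames (xi, rv y *m frame xi) by exact: frames_shell.
apply: (measurability _ (RGenCInfty.measurableE R)) => _ [_ [c ->] <-].
have [c0|c0] := leP c 0.
  rewrite (_ : _ `&` _ = B)//; apply/seteqP; split => y; first by case.
  move=> By; split => //; rewrite /= in_itv/= andbT (le_trans c0)//.
  exact: (radial_ge0 r_gt0 rK Rb_gt0 KRb (fr y By) tr).
rewrite (_ : _ `&` _ = B `&` [set y | K (t *: xi + c *: (rv y *m frame xi))]).
  apply: measurableI => //.
  apply: (measurable_preimage_rmeasurable
    (f := fun y : tup R d.+1 => t *: xi + c *: (rv y *m frame xi))) => //.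
  apply: measurable_coordD => i; first exact: measurable_cst.
  apply: measurable_coordZ => [|j]; first exact: measurable_cst.
  by apply: measurable_mulmx => l; exact: measurable_rv_coord.
by apply/seteqP; split => y /= [By]; rewrite in_itv/= andbT;
  move=> /(radialP cvK clK r_gt0 rK Rb_gt0 KRb (fr y By) tr (ltW c0)).
Qed.

Lemma bounded_derivs_section_volume : exists2 dl, 0 < dl <= r & forall k,
  bounded_derivs (@sphere R d.+2) dl k (fun xi t => section_volume K xi t).
Proof.
have [dl /andP[dl0 dlr] bd] :=
  bounded_derivs_radial cptK cvK r_gt0 rK Rb_gt0 KRb smK.
exists dl; first by rewrite dl0.
move=> k.
have volB : (leb R d.+1 B < +oo)%E.
  apply: le_lt_trans (vol_eball_fin d.+1 ler01).
  apply: le_vol; [exact: rmeasurable_shell|exact: rmeasurable_eball|].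
  by move=> z /andP[z1 _]; rewrite eballE.
apply: (bounded_derivs_ext
    (f := fun xi t => \int[leb R d.+1]_(y in B) integrand (xi, y) t)).
  move=> xi t xi1 tdl; rewrite /section_volume.
  have tr : `|t| <= r by rewrite ltW// (lt_le_trans tdl).
  rewrite (@vol_polar _ _ _ (fun z => radial K xi (z *m frame xi) t))//.
  - exact: rmeasurable_slice.
  - move=> z /(frames_shell xi1) fz.
    exact: (radial_ge0 r_gt0 rK Rb_gt0 KRb fz tr).
  - move=> z s /(frames_shell xi1) fz s0; rewrite /slice /= -scalemxAl.
    exact: (radialP cvK clK r_gt0 rK Rb_gt0 KRb fz tr (ltW s0)).
apply: bounded_derivs_integral => //.
  by move=> xi t xi1 tdl; apply: measurable_integrand => //; rewrite ltW//
    (lt_le_trans tdl).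
apply: bounded_derivsM.
  apply: (@bounded_derivs_cst _ _ _ _ _ _ 2) => -[xi y] /= [_ /andP[_ y2]].
  have y0 : 0 < enorm (rv y) by move: y2; rewrite -/enorm; lra.
  by rewrite ger0_norm ?invr_ge0 ?enorm_ge0// -[leLHS]mul1r ler_pdivrMr.
apply: bounded_derivsM; last first.
  by apply: (@bounded_derivs_cst _ _ _ _ _ (fun=> d.+1%:R^-1) `|d.+1%:R^-1|).
apply: bounded_derivsX.
apply: (bounded_derivs_reindex (phi := fun q => (q.1,
  rv q.2 *m frame q.1))) (bd k).
by move=> [xi y] /= [xi1 By]; exact: frames_shell.
Qed.

End smooth_sections.

(** * Averaging over directions *)

Lemma derive1n_chain (R : realType) (f : R -> R) (g : nat -> R -> R) (dl : R)
    (k : nat) : (forall t, `|t| < dl -> f t = g 0%N t) ->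
  (forall j (t : R), (j < k)%N -> `|t| < dl -> is_derive t 1 (g j) (g j.+1 t))
    ->
  forall t, `|t| < dl -> derive1n k f t = g k t.
Proof.
move=> fg; elim: k => [|k IH] dg t tdl; first by rewrite derive1n0 fg.
have {}IH := IH (fun j t jk => dg j t (ltnW jk)).
rewrite derive1nS derive1E.
have dgk := dg k t (ltnSn k) tdl.
apply: derive_val; apply: is_derive_near dgk.
by apply: filterS (near_lt_norm tdl) => s /IH.
Qed.

(** Pure linearity: no regularity of [f y] in its real argument enters. *)
Lemma Rintegral_fdiff (R : realType) d (T : measurableType d)
    (mu : {measure set T -> \bar R}) (B : set T) (k : nat) (h : R)
    (f : T -> R -> R) : measurable B ->
  (forall s, mu.-integrable B (EFin \o (f ^~ s))) -> forall x,
  mu.-integrable B (EFin \o (fun y => fdiff k h (f y) x)) /\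
  \int[mu]_(y in B) fdiff k h (f y) x =
    fdiff k h (fun s => \int[mu]_(y in B) f y s) x.
Proof.
move=> mB fi; elim: k => [|k IH] x /=; first by split.
have [i1 E1] := IH (x + h); have [i2 E2] := IH x; split.
  apply: eq_integrable (integrableB mB i1 i2) => //.
by rewrite RintegralB// E1 E2.
Qed.

Lemma continuous_ge_near (R : realType) (f : R -> R) (c : R) :
  {for (0 : R), continuous f} -> c < f 0 ->
  exists2 dl, 0 < dl & forall t, `|t| < dl -> c <= f t.
Proof.
move=> cf c0; have : \forall t \near (0 : R), c < f t by apply: (cvgr_gt _ cf).
move=> [e /= e0 ce]; exists e => // t te; apply: ltW; apply: ce.
by rewrite /= sub0r normrN.
Qed.

Lemma halfspace_volumeD (R : realType) (k : nat) (r : R) (E F : set 'rV[R]_k)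
    (v : 'rV[R]_k) (s : R) : 0 <= r -> rmeasurable E -> rmeasurable F ->
  E `<=` F -> F `<=` eball r ->
  halfspace_volume (F `\` E) v s = halfspace_volume F v s - halfspace_volume E v
    s.
Proof.
move=> r0 mE mF EF Fr; rewrite /halfspace_volume.
have mFE : rmeasurable (F `\` E) by exact: measurableD.
have fin (G : set 'rV[R]_k) : rmeasurable G -> G `<=` F ->
    vol [set x | G x /\ dot x v <= s] \is a fin_num.
  move=> mG GF; apply: (fin_num_vol r0 (rmeasurable_halfspace _ _ mG)).
  by move=> x [/GF /Fr].
have : vol [set x | F x /\ dot x v <= s] =
   (vol [set x | E x /\ (dot x v <= s)%R] +
    vol [set x | (F `\` E) x /\ (dot x v <= s)%R])%E.
  rewrite /vol -measureU//.
  - congr (leb R k _); apply/seteqP; split => y /=.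
      move=> [Fy ys]; have [Ey|nEy] := pselect (E (rv y)); first by left.
      by right.
    by case=> [[/EF]|[[]]].
  - exact: rmeasurable_halfspace.
  - exact: rmeasurable_halfspace.
  - by apply/seteqP; split => y //= [[Ey _] [[]]].
move=> ->; rewrite fineD ?fin//.
by rewrite addrAC subrr add0r.
Qed.

Lemma is_derive_halfspace_eball (R : realType) (d : nat) (xi : 'rV[R]_d.+1)
    (rho s : R) : sphere xi -> `|s| < rho ->
  is_derive s 1 (halfspace_volume (eball rho) xi)
    (fine (vol (@eball R d 1)) * cap d rho 0 s).
Proof.
move=> xi1 srho.
have rho0 : 0 <= rho by rewrite ltW// (le_lt_trans _ srho).
have E t : `|t| < rho -> section_volume (eball rho) xi t =
    fine (vol (@eball R d 1)) * cap d rho 0 t.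
  exact: section_volume_eball.
rewrite -E//; apply: (is_derive_halfspace_volume rho0 xi1 (rmeasurable_eball
  rho)) => //.
have := is_derive_funZ (fine (vol (@eball R d 1))) (is_derive_cap d 0 srho).
move=> /(is_derive_near (g := section_volume (eball rho) xi)) =>
  /(_ _)/is_derive_continuous; apply.
by apply: filterS (near_lt_norm srho) => t /E.
Qed.

Lemma fubini_halfspace (R : realType) (k : nat) (rE rF : R)
    (E F : set 'rV[R]_k) (s : R) : 0 <= rE -> 0 <= rF ->
  rmeasurable E -> rmeasurable F -> E `<=` eball rE -> F `<=` eball rF ->
  \int[leb R k]_(v in @rv R k @^-1` F) halfspace_volume E (rv v) s =
  \int[leb R k]_(x in @rv R k @^-1` E) halfspace_volume F (rv x) s.
Proof.
move=> rE0 rF0 mE mF Er Fr.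
have fin (G : set 'rV[R]_k) rG v : 0 <= rG -> rmeasurable G -> G `<=` eball rG
  ->
    vol [set x | G x /\ dot x v <= s] \is a fin_num.
  move=> r0 mG Gr; apply: (fin_num_vol r0 (rmeasurable_halfspace _ _ mG)).
  by move=> x [/Gr].
pose S := [set q : tup R k * tup R k |
  [/\ E (rv q.1), F (rv q.2) & dot (rv q.1) (rv q.2) <= s]].
have m1 i : measurable_fun setT (fun q : tup R k * tup R k => rv q.1 ord0 i).
  exact: (measurableT_comp (measurable_rv_coord i) measurable_fst).
have m2 i : measurable_fun setT (fun q : tup R k * tup R k => rv q.2 ord0 i).
  exact: (measurableT_comp (measurable_rv_coord i) measurable_snd).
have mS : measurable S.
  rewrite (_ : S = [set q | E (rv q.1)] `&` ([set q | F (rv q.2)] `&`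
      [set q | dot (rv q.1) (rv q.2) <= s])); last first.
    by apply/seteqP; split => q; rewrite /S /=; [case|case=> ? []].
  apply: measurableI; last apply: measurableI.
  - exact: (measurable_preimage_rmeasurable m1).
  - exact: (measurable_preimage_rmeasurable m2).
  - rewrite (_ : [set _ | _] = (fun q : tup R k * tup R k =>
        dot (rv q.1) (rv q.2) <= s) @^-1` [set true])//.
    apply: measurable_preimage => //; apply: measurable_fun_ler => //.
    exact: measurable_dot.
have := @product_section R _ _ _ _ (leb R k) (leb R k) S mS.
rewrite /Rintegral => H; congr fine; apply/esym.
rewrite [LHS]integral_mkcond [RHS]integral_mkcond.
transitivity (\int[leb R k]_x leb R k [set y | S (x, y)])%E; last rewrite H.
- apply: eq_integral => x _; rewrite patchE; case: ifPn =>
  [/set_mem Ex|/negP Ex].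
    rewrite fineK; last exact: (fin _ rF).
    congr (leb R k _); apply/seteqP; split => y; rewrite /S /= dotC.
      by case.
    by case=> ? ?; split.
  rewrite (_ : [set y | _] = set0) ?measure0//.
  by apply/seteqP; split => y // [] /mem_set.
- apply: eq_integral => y _; rewrite patchE; case: ifPn =>
  [/set_mem Fy|/negP Fy].
    rewrite fineK; last exact: (fin _ rE).
    by congr (leb R k _); apply/seteqP; split => x; rewrite /S /=; case.
  rewrite (_ : [set x | _] = set0) ?measure0//.
  by apply/seteqP; split => x // [_] /mem_set.
Qed.

Lemma integrable_halfspace_volume (R : realType) (k : nat) (rE rF : R)
    (E F : set 'rV[R]_k) (s : R) : 0 <= rE -> 0 <= rF ->
  rmeasurable E -> rmeasurable F -> E `<=` eball rE -> F `<=` eball rF ->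
  (leb R k).-integrable (@rv R k @^-1` F) (EFin \o (fun v =>
    halfspace_volume E (rv v) s)).
Proof.
move=> rE0 rF0 mE mF Er Fr.
have finE : vol E \is a fin_num by exact: fin_num_vol Er.
have volF : (leb R k (@rv R k @^-1` F) < +oo)%E.
  apply: le_lt_trans (vol_eball_fin k rF0).
  by apply: le_vol => //; exact: rmeasurable_eball.
apply: measurable_bounded_integrable => //.
  apply: measurable_funTS.
  pose S := [set q : tup R k * tup R k | E (rv q.2) /\ dot (rv q.2) (rv q.1) <=
    s].
  have m1 i : measurable_fun setT (fun q : tup R k * tup R k => rv q.1 ord0 i).
    exact: (measurableT_comp (measurable_rv_coord i) measurable_fst).
  have m2 i : measurable_fun setT (fun q : tup R k * tup R k => rv q.2 ord0 i).
    exact: (measurableT_comp (measurable_rv_coord i) measurable_snd).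
  have mS : measurable S.
    apply: measurableI; first exact: (measurable_preimage_rmeasurable m2).
    apply: (@measurable_preimage _ _ _ _ (fun q : tup R k * tup R k =>
        dot (rv q.2) (rv q.1) <= s) [set true]) => //.
    by apply: measurable_fun_ler => //; exact: measurable_dot.
  apply: measurableT_comp => //.
  apply: eq_measurable_fun (measurable_fun_xsection (leb R k) mS) => v _ /=.
  by congr (leb R k _); apply/seteqP; split => x; rewrite /xsection /S /= ?inE.
exists (fine (vol E)); split; first exact: num_real.
move=> y My v Fv; rewrite /= ger0_norm ?fine_ge0// (le_trans _ (ltW My))//.
rewrite fine_le//.
  apply: (fin_num_vol rE0 (rmeasurable_halfspace _ _ mE)).
  by move=> x [/Er].
by apply: le_vol => //; [exact: rmeasurable_halfspace|move=> x []].
Qed.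

(** Otherwise the balls of radii 1 and 2 would have the same volume, against the scaling factor
    [2 ^+ n.+1]. *)
Lemma vol_annulus_gt0 (R : realType) (n : nat) :
  (0 < vol (@eball R n.+1 2 `\` eball 1))%E.
Proof.
have sub : @eball R n.+1 1 `<=` eball 2.
  by move=> x; rewrite /eball /= => /le_trans; apply; rewrite expr1n expr2; lra.
have m1 := @rmeasurable_eball R n.+1 1; have m2 := @rmeasurable_eball R n.+1 2.
rewrite lt0e measure_ge0 andbT; apply/eqP => v0.
have : vol (@eball R n.+1 2) =
    (vol (@eball R n.+1 1) + vol (@eball R n.+1 2 `\` eball 1))%E.
  rewrite /vol -measureU//.
  - congr (leb R _ _); rewrite -preimage_setU; congr (_ @^-1` _).
    by rewrite setDUK.
  - exact: measurableD.
  - by rewrite -preimage_setI setDIK preimage_set0.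
rewrite v0 adde0 vol_eball// => E.
have [b b0 vb] : exists2 b, 0 < b & vol (@eball R n.+1 1) = b%:E.
  exists (fine (vol (@eball R n.+1 1))).
    by rewrite fine_gt0// vol_eball_gt0//= vol_eball_fin.
  by rewrite fineK// ge0_fin_numE ?vol_eball_fin.
move: E; rewrite vb -EFinM => -[] /eqP; rewrite -subr_eq0 -{2}[b]mul1r -mulrBl.
rewrite mulf_eq0 (gt_eqF b0) orbF subr_eq0 => /eqP E.
have : 1 < 2 ^+ n.+1 :> R by rewrite exprn_egt1// ltr1n.
by rewrite E ltxx.
Qed.

Lemma is_derive_le_norm (R : realType) (f df : R -> R) (M dl t : R) :
  f 0 = 0 -> (forall s : R, `|s| < dl -> is_derive s 1 f (df s)) ->
  (forall s, `|s| < dl -> `|df s| <= M) -> `|t| < dl -> `|f t| <= M * `|t|.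
Proof.
move=> f0 dfs dfM tdl; have [t0|/ltW t0] := leP 0 t.
  have [s /andP[s0 st]|s /andP[s0 st]] := @is_derive_MVT R f df 0 t t0.
    by apply: dfs; rewrite (le_lt_trans _ tdl)// !ger0_norm.
  rewrite f0 !subr0 => ->; rewrite normrM ler_wpM2r// dfM//.
  by rewrite (le_lt_trans _ tdl)// !ger0_norm.
have [s /andP[st s0]|s /andP[st s0]] := @is_derive_MVT R f df t 0 t0.
  by apply: dfs; rewrite (le_lt_trans _ tdl)// !ler0_norm// lerN2.
rewrite f0 !sub0r => /(congr1 Num.norm); rewrite normrN normrM normrN => ->.
by rewrite ler_wpM2r// dfM// (le_lt_trans _ tdl)// !ler0_norm// lerN2.
Qed.

(** The level 0 is fixed by rescaling, so passing to the unit vector changes only the step. *)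
Lemma halfspace_volume_normalize (R : realType) (n : nat) (E : set 'rV[R]_n)
    (v : 'rV[R]_n) (k : nat) (h : R) : 0 < enorm v ->
  sphere ((enorm v)^-1 *: v) /\
  fdiff k h (halfspace_volume E v) 0 =
    fdiff k (h / enorm v) (halfspace_volume E ((enorm v)^-1 *: v)) 0.
Proof.
move=> v0; split.
  apply/sphere_dot; rewrite dotZl dotZr -sqr_enorm; field.
  by rewrite gt_eqF.
rewrite -[in RHS](mul0r (enorm v)^-1) -fdiff_rescale; congr (fdiff _ _ _ _).
apply/funext => s; rewrite -halfspace_volumeZ// scalerA mulfV ?gt_eqF//.
by rewrite scale1r.
Qed.

Theorem proposition3p1 (R : realType) (n : nat) (n_gt0 : (0 < n)%N)
    (n_even : ~~ odd n) :
  ~ exists K : set 'rV[R]_n,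
      [/\ convex_body K, infinitely_smooth K, K° 0 &
          exists N : nat, forall m : nat, ~~ odd m -> (N <= m)%N ->
            forall xi : 'rV[R]_n, sphere xi ->
              derive1n m (section_function K xi) 0 = 0].
Proof.
(* [n = 1] is odd, so [n = d.+2]; the dimension of the sections is [D = d.+1]. *)
case: n n_gt0 n_even => [//|[//|d]] _ n_even [K [[cptK cvx _] smK K0 [N HN]]].
have cvK := convex_segment_closed cvx.
have [r r0 rK] := interior_sup_eball K0.
have [Rb Rb0 KRb] := compact_sub_eball cptK.
have [dl /andP[dl0 dlr] bd] :=
  bounded_derivs_section_volume cptK cvK r0 rK Rb0 KRb smK.
have mK : rmeasurable K by apply: closed_rmeasurable; exact: closed_compact_rV.
(* This makes [m] even, at least [N] and greater than [D]. *)
pose i := (N + d.+2)%N; pose m := (2 * i)%N; pose D := d.+1.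
have Dltm : (D < m)%N by rewrite /D /m /i; lia.
(* One order beyond [m]: the bound [M] on [g m.+1] controls [g m] near its zero at 0, uniformly in
   [xi]. *)
have [g [g0 gd [M gM]]] := bounded_derivs_chain (bd m.+1).
have gm0 xi : sphere xi -> g m xi 0 = 0.
  move=> xi1; have := HN m _ _ xi xi1; rewrite section_functionE//.
  have H1 t : `|t| < dl -> section_volume K xi t = g 0%N xi t by rewrite g0.
  have H2 j (t : R) : (j < m)%N -> `|t| < dl -> is_derive t 1 (g j xi) (g j.+1
    xi t).
    by move=> jm tdl; apply: gd => //; exact: ltnW.
  have H3 : `|0 : R| < dl by rewrite normr0.
  have -> := @derive1n_chain R (section_volume K xi) (fun j =>
    g j xi) dl m H1 H2 0 H3.
  by apply; [rewrite /m mul2n odd_double|rewrite /m /i; lia].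
pose C := cap_coef R D i.
have C0 : C != 0 by apply: cap_coef_neq0; move: n_even; rewrite /= negbK /D /=.
have C2 : 0 < C ^+ 2 by rewrite lt_neqAle eq_sym sqrf_eq0 C0 sqr_ge0.
pose kap := fine (vol (@eball R D 1)).
have kap0 : 0 < kap by rewrite fine_gt0// vol_eball_gt0//= vol_eball_fin.
(* [a] is [C] times the derivative of order [m] at 0 of the section function of [eball Rb].
   Continuity costs half of it ([dl1]) and [g m] a quarter ([dl3]), which leaves [a / 4]. *)
pose a := kap * C ^+ 2 * (Rb ^+ D / Rb ^+ m).
have a0 : 0 < a by rewrite (mulr_gt0 (mulr_gt0 kap0 C2))// divr_gt0 ?exprn_gt0.
have norm00 (rho : R) : 0 < rho -> `|0 : R| < rho by rewrite normr0.
have [dl1 dl10 Hdl1] : exists2 dl1, 0 < dl1 & forall t, `|t| < dl1 ->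
    a / 2 <= C * (kap * cap D Rb m t).
  apply: (@continuous_ge_near _ (fun t => C * (kap * cap D Rb m t))).
    have d1 := is_derive_cap D m (norm00 _ Rb0).
    exact: is_derive_continuous (is_derive_funZ _ (is_derive_funZ _ d1)).
  rewrite cap_even0// -/C (_ : C * _ = a); last by rewrite /a; ring.
  by lra.
have [dl2 dl20 Hdl2] : exists2 dl2, 0 < dl2 & forall t, `|t| < dl2 ->
    0 <= - C * (kap * (cap D 2 m t - cap D 1 m t)).
  have d2 := is_derive_cap D m (norm00 2 (ltr0Sn R 1)).
  apply: (@continuous_ge_near _ (fun t =>
    - C * (kap * (cap D 2 m t - cap D 1 m t)))).
    have d1 := is_derive_cap D m (norm00 1 ltr01).
    exact: is_derive_continuous (is_derive_funZ _ (is_derive_funZ _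
      (is_derive_funB d2 d1))).
  rewrite !cap_even0// -/C !expr1n divr1.
  have -> : - C * (kap * (C * 2 ^+ D / 2 ^+ m - C * 1)) =
    kap * C ^+ 2 * (1 - 2 ^+ D / 2 ^+ m) by ring.
  rewrite (mulr_gt0 (mulr_gt0 kap0 C2))// subr_gt0 ltr_pdivrMr ?exprn_gt0//
    mul1r.
  by rewrite ltr_eXn2l ?ltr1n.
(* Chosen so that [(|C| |M| + 1) * dl3 = a / 4]; the [1] keeps the denominator positive. *)
pose dl3 := a / (4 * (`|C| * `|M| + 1)).
have CM0 : 0 < `|C| * `|M| + 1 by rewrite ltr_wpDl// mulr_ge0.
have dl30 : 0 < dl3 by rewrite divr_gt0// mulr_gt0.
pose del := Num.min (Num.min dl Rb) (Num.min dl1 dl3).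
have del0 : 0 < del by rewrite !lt_min dl0 Rb0 dl10 dl30.
have delE t : `|t| < del -> [/\ `|t| < dl, `|t| < Rb, `|t| < dl1 & `|t| < dl3].
  by rewrite !lt_min => /andP[/andP[-> ->] /andP[-> ->]].
pose delW := Num.min 1 dl2.
have delW0 : 0 < delW by rewrite lt_min ltr01.
have mn0 : 0 < Num.min del (r * delW) by rewrite lt_min del0 mulr_gt0.
(* The [m.+1] steps must fit into the intervals of [sideD] and [sideW]. They are [h / |v|] with
   [|v| > 1] on [W], and [h / |x|] with [|x| > r] on [Dm]; hence the bounds [del] and [r * delW]. *)
have [h h0 hm] : exists2 h, 0 < h & m.+1%:R * h < Num.min del (r * delW).
  exists (Num.min del (r * delW) / m.+2%:R); first by rewrite divr_gt0.
  by rewrite mulrA ltr_pdivrMr// mulrC ltr_pM2l ?ltr_nat.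
pose Dm := eball Rb `\` K; pose W := @eball R d.+2 2 `\` eball 1.
have mDm : rmeasurable Dm by apply: measurableD => //; exact: rmeasurable_eball.
have mW : rmeasurable W by apply: measurableD; exact: rmeasurable_eball.
have Dmb : Dm `<=` eball Rb by exact: subDsetl.
have Wb : W `<=` eball 2 by exact: subDsetl.
have sub12 : @eball R d.+2 1 `<=` eball 2.
  by move=> x; rewrite /eball /= => /le_trans; apply; rewrite expr1n expr2; lra.
have Rb0' := ltW Rb0; have two0 : 0 <= 2 :> R by [].
have sideD xi h' : sphere xi -> 0 <= h' -> m.+1%:R * h' < del ->
    a / 4 * h' ^+ m.+1 <= C * fdiff m.+1 h' (halfspace_volume Dm xi) 0.
  move=> xi1 h'0 h'del; rewrite -fdiffZ.
  (* Orders are shifted by one: [G 0] is the half-space volume and [G 1] the section function, so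
     [G m.+1] is the derivative of order [m] of the latter. *)
  pose G j := if j is j'.+1 then fun t => C * (kap * cap D Rb j' t - g j' xi t)
    else fun t => C * halfspace_volume Dm xi t.
  apply: (@fdiff_lower_bound _ m.+1 (- del) del h' (a / 4) 0 G) => //.
  - move=> [|j] t jm; rewrite -ltr_norml => /delE[t1 t2 t3 t4].
      apply: is_derive_funZ.
      rewrite (_ : halfspace_volume Dm xi = fun s =>
        halfspace_volume (eball Rb) xi s - halfspace_volume K xi s).
        apply: is_derive_funB; first exact: is_derive_halfspace_eball.
        rewrite g0; apply: (is_derive_halfspace_volume Rb0' xi1 mK KRb).
        have dg0 := gd 0%N xi t isT xi1 t1; rewrite g0 in dg0.
        exact: is_derive_continuous dg0.
      apply/funext => s; apply: (halfspace_volumeD _ _ Rb0' mK) => //.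
      exact: rmeasurable_eball.
    apply: is_derive_funZ; apply: is_derive_funB.
      by apply: is_derive_funZ; exact: is_derive_cap.
    by apply: gd => //; exact: ltnW.
  - move=> t; rewrite -ltr_norml => /delE[t1 t2 t3 t4] /=.
    have h1 := Hdl1 t t3.
    have h2 : `|g m xi t| <= `|M| * `|t|.
      apply: (@is_derive_le_norm _ _ (g m.+1 xi) _ dl) => //.
      + exact: gm0.
      + by move=> s sdl; exact: gd.
      + by move=> s sdl; apply: le_trans (ler_norm _); exact: gM.
    have h3 : C * g m xi t <= a / 4.
      apply: le_trans (ler_norm _) _; rewrite normrM.
      apply: (@le_trans _ _ (`|C| * (`|M| * `|t|))); first by rewrite ler_wpM2l.
      apply: (@le_trans _ _ ((`|C| * `|M| + 1) * dl3)).
        by rewrite mulrA ler_pM// ?mulr_ge0// ?ltW// ltrDl.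
      by rewrite /dl3 le_eqVlt; apply/orP; left; apply/eqP; field;
        rewrite gt_eqF.
    by rewrite mulrBr; lra.
  - by rewrite oppr_lt0.
  - by rewrite add0r.
(* Here the sign is enough, as strictness comes from [sideD]. *)
have sideW xi h' : sphere xi -> 0 <= h' -> m.+1%:R * h' < delW ->
    C * fdiff m.+1 h' (halfspace_volume W xi) 0 <= 0.
  move=> xi1 h'0 h'del; rewrite -oppr_ge0 -mulNr -fdiffZ.
  pose G j := if j is j'.+1 then fun t =>
    - C * (kap * (cap D 2 j' t - cap D 1 j' t))
    else fun t => - C * halfspace_volume W xi t.
  apply: le_trans (_ : 0 * h' ^+ m.+1 <= _); first by rewrite mul0r.
  apply: (@fdiff_lower_bound _ m.+1 (- delW) delW h' 0 0 G) => //.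
  - move=> [|j] t jm; rewrite -ltr_norml lt_min => /andP[t1 t2];
      have t3 : `|t| < 2 by rewrite (lt_trans t1)// ltr1n.
      apply: is_derive_funZ; rewrite mulrBr.
      rewrite (_ : halfspace_volume W xi = fun s =>
        halfspace_volume (eball 2) xi s - halfspace_volume (eball 1) xi s).
        by apply: is_derive_funB; exact: is_derive_halfspace_eball.
      apply/funext => s; apply: (halfspace_volumeD _ _ two0) => //;
        exact: rmeasurable_eball.
    apply: is_derive_funZ; apply: is_derive_funZ.
    by apply: is_derive_funB; exact: is_derive_cap.
  - by move=> t; rewrite -ltr_norml lt_min => /andP[t1 t2] /=; exact: Hdl2.
  - by rewrite oppr_lt0.
  - by rewrite add0r.
have intD s := integrable_halfspace_volume s Rb0' two0 mDm mW Dmb Wb.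
have intW s := integrable_halfspace_volume s two0 Rb0' mW mDm Wb Dmb.
have [iD ED] := Rintegral_fdiff m.+1 h mW intD 0.
have [iW EW] := Rintegral_fdiff m.+1 h mDm intW 0.
(* On [W] also [|v| <= 2], so the step is at least [h / 2]; the lower bound becomes independent of
   [v], and its integral over [W] is positive. *)
pose c1 := a / 4 * (h / 2) ^+ m.+1.
have c10 : 0 < c1 by rewrite mulr_gt0 ?divr_gt0// exprn_gt0// divr_gt0.
have volW : (leb R d.+2 (@rv R d.+2 @^-1` W) < +oo)%E.
  apply: le_lt_trans (vol_eball_fin d.+2 two0).
  by apply: le_vol => //; exact: rmeasurable_eball.
have lowW (v : tup R d.+2) : W (rv v) ->
    c1 <= C * fdiff m.+1 h (halfspace_volume Dm (rv v)) 0.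
  move=> [v2 v1]; have v1' : 1 < enorm (rv v).
    by rewrite ltNge; apply/negP => ?; apply: v1; rewrite eballE.
  have v2' : enorm (rv v) <= 2 by rewrite -eballE.
  have v0 : 0 < enorm (rv v) by exact: lt_trans v1'.
  have [sv ->] := halfspace_volume_normalize Dm m.+1 h v0.
  have hv0 : 0 <= h / enorm (rv v) by rewrite divr_ge0 ?ltW.
  apply: le_trans (sideD _ _ sv hv0 _).
    rewrite /c1 ler_pM2l ?divr_gt0//
      ler_pXn2r ?nnegrE ?divr_ge0 ?(ltW h0) ?enorm_ge0//.
    by rewrite ler_pM2l// lef_pV2 ?posrE.
  apply: (@lt_le_trans _ _ (Num.min del (r * delW)));
    last by rewrite ge_min lexx.
  apply: le_lt_trans hm; rewrite ler_pM2l// ler_pdivrMr// ler_peMr ?(ltW h0)//.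
  exact: ltW.
have upD (x : tup R d.+2) : Dm (rv x) ->
    C * fdiff m.+1 h (halfspace_volume W (rv x)) 0 <= 0.
  move=> [_ nK]; have xr : r < enorm (rv x).
    by rewrite ltNge; apply/negP => ?; apply/nK/rK; rewrite eballE// ltW.
  have x0 : 0 < enorm (rv x) by exact: lt_trans xr.
  have [sx ->] := halfspace_volume_normalize W m.+1 h x0.
  apply: sideW => //; first by rewrite divr_ge0 ?ltW.
  rewrite mulrA ltr_pdivrMr//; apply: lt_le_trans hm _.
  by rewrite ge_min; apply/orP; right; rewrite mulrC ler_pM2l// ltW.
have H1 : 0 < C * \int[leb R d.+2]_(v in @rv R d.+2 @^-1` W)
    fdiff m.+1 h (halfspace_volume Dm (rv v)) 0.
  rewrite -RintegralZl//.
  apply: (@lt_le_trans _ _ (\int[leb R d.+2]_(v in @rv R d.+2 @^-1` W) c1)).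
    rewrite Rintegral_cst// mulr_gt0// fine_gt0//.
    by apply/andP; split => //; exact: vol_annulus_gt0.
  apply: le_Rintegral => //.
  - by apply: measurable_bounded_integrable => //; exact: bounded_cst.
  - exact: (integrableZl mW C iD).
have H2 : C * \int[leb R d.+2]_(x in @rv R d.+2 @^-1` Dm)
    fdiff m.+1 h (halfspace_volume W (rv x)) 0 <= 0.
  rewrite -RintegralZl// -oppr_ge0 -mulN1r -RintegralZl//.
    by apply: Rintegral_ge0 => x /upD; rewrite mulN1r oppr_ge0.
  exact: (integrableZl mDm C iW).
move: H1; rewrite ED.
have -> : (fun s => \int[leb R d.+2]_(v in @rv R d.+2 @^-1` W)
    halfspace_volume Dm (rv v) s) = (fun s =>
    \int[leb R d.+2]_(x in @rv R d.+2 @^-1` Dm) halfspace_volume W (rv x) s).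
  by apply/funext => s; exact: (fubini_halfspace s Rb0' two0).
by rewrite -EW ltNge H2.
Qed.
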